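(* Let $n\ge 1$ and let $Q(z)=(z-a_1)(z-a_2)\cdots(z-a_n)\in\mathbb{C}[z]$ be a monic strong uniqueness polynomial with pairwise distinct roots $a_1,\dots,a_n$, and put $S=\{a_1,\dots,a_n\}$. Let $m_1$ and $m_2$ denote, respectively, the number of distinct simple zeros and the number of distinct multiple zeros of the polynomial $Q(z)-Q(0)$, and let $k$ denote the number of distinct zeros of $Q'(z)$. Suppose that $n>\max\{2k+2,\, m_1+m_2\}$, $m_1+m_2>2$ and $k\ge 2$. Let $\mathfrak{f}$ be a transcendental entire function with hyper-order $\rho_2(\mathfrak{f})<1$, and let $c\in\mathbb{C}\setminus\{0\}$. If $\mathfrak{f}(z)$ and $\mathfrak{f}(z+c)$ share the set $S$ with weak weight $3$, i.e. $E_{3)}(S;\mathfrak{f}(z))=E_{3)}(S;\mathfrak{f}(z+c))$, then $\mathfrak{f}(z)\equiv\mathfrak{f}(z+c)$.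
   Context: A non-constant monic polynomial $P(z)$ is called a strong uniqueness polynomial (for meromorphic functions) if, whenever $\mathfrak{f},\mathfrak{g}$ are non-constant meromorphic functions on $\mathbb{C}$ and $\alpha$ is a non-zero constant with $P(\mathfrak{f})\equiv\alpha P(\mathfrak{g})$, it follows that $\mathfrak{f}\equiv\mathfrak{g}$. The hyper-order of a meromorphic function $\mathfrak{f}$ is $\rho_2(\mathfrak{f})=\limsup_{r\to\infty}\frac{\log\log T(r,\mathfrak{f})}{\log r}$, where $T(r,\mathfrak{f})$ is the Nevanlinna characteristic function. Weak weighted sharing: for a positive integer $l$ (or $\infty$) and $a\in\mathbb{C}$, $E_{l)}(a;\mathfrak{f})$ denotes the set of those $a$-points of $\mathfrak{f}$ whose multiplicity is at most $l$, each counted according to its multiplicity. For a set $S\subset\mathbb{C}$, $E_{l)}(S;\mathfrak{f})=\bigcup_{a\in S}E_{l)}(a;\mathfrak{f})$ (as a multiset of points), and $\mathfrak{f}$, $\mathfrak{g}$ share $S$ with weak weight $l$ if $E_{l)}(S;\mathfrak{f})=E_{l)}(S;\mathfrak{g})$. *)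

(* Defs.v *)
From Stdlib Require Import Reals List.
From Coquelicot Require Import Coquelicot.
Import ListNotations.
Open Scope C_scope.

Definition entire (f : C -> C) : Prop := forall z : C, ex_derive f z.

Fixpoint peval (l : list C) (z : C) : C :=
  match l with
  | [] => 0
  | a :: l' => a + z * peval l' z
  end.

Definition transcendental_entire (f : C -> C) : Prop :=
  entire f /\ ~ (exists l : list C, forall z, f z = peval l z).

(** meromorphic functions on C, represented by a function C -> C whose values
    at the poles are irrelevant: every point has a punctured neighbourhood on
    which f is holomorphic, and at every point where f is not holomorphic,
    |f(w)| -> +oo as w -> z (a pole). *)
Definition regular (f : C -> C) (z : C) : Prop := ex_derive f z.

Definition meromorphic (f : C -> C) : Prop :=
  forall z : C,
    (exists eps : posreal, forall w : C, w <> z -> Cmod (w - z) < eps -> regular f w)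
    /\ (~ regular f z ->
        filterlim (fun w => Cmod (f w)) (within (fun w => w <> z) (locally z))
                  (Rbar_locally p_infty)).

Definition nonconstant (f : C -> C) : Prop :=
  ~ (exists c : C, forall z, regular f z -> f z = c).

Definition strong_uniqueness_poly (P : C -> C) : Prop :=
  forall (f g : C -> C) (alpha : C),
    meromorphic f -> meromorphic g -> nonconstant f -> nonconstant g ->
    alpha <> 0 ->
    (forall z, regular f z -> regular g z -> P (f z) = alpha * P (g z)) ->
    (forall z, regular f z -> regular g z -> f z = g z).

Definition Qprod (a : list C) (z : C) : C :=
  fold_right (fun ai acc => (z - ai) * acc) 1 a.

Definition ncard (P : C -> Prop) (m : nat) : Prop :=
  exists l : list C, NoDup l /\ (forall z, In z l <-> P z) /\ length l = m.

Definition zero_order (h : C -> C) (z0 : C) (m : nat) : Prop :=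
  (1 <= m)%nat /\
  exists (eps : posreal) (g : C -> C),
    (forall z, Cmod (z - z0) < eps -> ex_derive g z /\ h z = Cpow (z - z0) m * g z)
    /\ g z0 <> 0.

Definition share_weak_weight (S : list C) (l : nat) (f g : C -> C) : Prop :=
  forall (z : C) (m : nat), (m <= l)%nat ->
    ((exists a, In a S /\ zero_order (fun w => f w - a) z m) <->
     (exists a, In a S /\ zero_order (fun w => g w - a) z m)).

Definition logp (x : R) : R := Rmax 0 (ln x).

(** Nevanlinna characteristic of an entire function: T(r,f) = m(r,f)
    (the counting function of poles N(r,f) vanishes for entire f) *)
Definition char_entire (f : C -> C) (r : R) : R :=
  (/ (2 * PI) * RInt (fun t => logp (Cmod (f (r * cos t, r * sin t)))) 0 (2 * PI))%R.

(** hyper-order: limsup_{r -> oo} log log T(r,f) / log r,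
    with limsup = inf_{r0} sup_{r >= r0} *)
Definition hyper_order_entire (f : C -> C) : Rbar :=
  Glb_Rbar (fun y => exists r0 : R,
    Lub_Rbar (fun x => exists r : R, r0 <= r /\
                x = (ln (ln (char_entire f r)) / ln r)%R) = Finite y).

(* Main.v *)
Require Import Defs.
From Stdlib Require Import Reals List Lra Lia Classical ClassicalEpsilon.
From Coquelicot Require Import Coquelicot.
Import ListNotations.
Open Scope C_scope.

(** Write F = Q(f), G = Q(g) with g(z) = f(z+c), let d_1, ..., d_k be the zeros of Q' and
    T(w) = (w - d_1)...(w - d_k).  Put H = F''/F' - 2F'/F - G''/G' + 2G'/G.

    If H is not identically 0, the sharing hypothesis makes
    V = H^2 (T(f) f')^2 (T(g) g')^2 / (F G) an entire function: H vanishes at common simple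
    zeros of F and G, is regular at common double zeros, and zeros of order at least 3 are
    compensated by f' and g'; the poles of H at the critical points of F and G are cancelled by
    T.  Wherever the logarithmic derivatives of F, F', G, G', f - a_j, g - a_j are at most
    L in modulus, |V| (1 + |f|) <= C L^6: near the closest root a_j one has
    |f'| <= L |f - a_j| while the other n - 1 >= 2k + 2 factors of Q(f) have size |f|.  On
    suitable circles the logarithmic derivatives are bounded by a power of log M(R, f), so Jensen's
    inequality for V and Poisson's inequality for f give log M(r, f) <= A log log M(288 r, f).
    Together with the hyper-order bound this forces f to be a polynomial.

    If H = 0, integrating twice gives G - K F = B F G with a constant K <> 0.  When B = 0 the strong
    uniqueness property applies.  When B <> 0, f omits the values w with Q(w) = 1/B; since
    k >= 2 there are at least two of them, which the same growth argument, now with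
    V = f' / ((f - b_1)(f - b_2)), excludes. *)

(** The exponents in [V] come from counting zeros. Clearing denominators gives an entire
    [U = H T(f) f' T(g) g' F G], so [V = U^2 / (F G)^3], which is entire as soon as [U] vanishes to
    order at least [3(p+q)/2] wherever [F] and [G] have orders [p] and [q]. Common zeros of order 1
    and 2 reach this number through a cancellation. A zero of order [q] of [G] alone guarantees only
    [2q - 2], which suffices precisely from [q = 4] on: this is what weight 3 provides. Squaring [U]
    deals with the half-integers.

    Estimates of logarithmic derivatives fail near zeros and usually carry an exceptional set of
    radii. Here one good circle is chosen between [r] and a fixed multiple of [r], so the comparison
    of [log M(r, f)] with [log log M(288 r, f)] holds for all large [r]. The factor 288 is harmless
    because the comparison is used only twice: a bound [exp(O(r))] for [log M] first becomes [O(r)]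
    and then [O(log r)], which is polynomial growth. *)

(** * Elementary inequalities for the complex modulus *)

Lemma Cmod_minus_sym (x y : C) : Cmod (x - y) = Cmod (y - x).
Proof. rewrite <- Cmod_opp. f_equal. ring. Qed.

Lemma Cmod_tri3 (x y z : C) : Cmod (x - z) <= Cmod (x - y) + Cmod (y - z).
Proof. replace (x - z) with ((x - y) + (y - z)) by ring. apply Cmod_triangle. Qed.

Lemma Cmod_minus_le (x y : C) : Cmod (x - y) <= Cmod x + Cmod y.
Proof.
  unfold Cminus. eapply Rle_trans. apply Cmod_triangle. rewrite Cmod_opp. lra.
Qed.

Lemma Cmod_minus_ge (x y : C) : Cmod x - Cmod y <= Cmod (x - y).
Proof.
  assert (H := Cmod_triangle (x - y) y). replace (x - y + y) with x in H by ring. lra.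
Qed.

Lemma im_le_Cmod (z : C) : Rabs (Im z) <= Cmod z.
Proof.
  replace (Im z) with (- Re (z * Ci))%R by (rewrite re_mult_Ci; ring).
  rewrite Rabs_Ropp. eapply Rle_trans. apply re_le_Cmod.
  rewrite Cmod_mult, Cmod_Ci. lra.
Qed.

Lemma Cmod_le_re_im (z : C) : Cmod z <= Rabs (Re z) + Rabs (Im z).
Proof.
  replace z with (RtoC (Re z) + Ci * RtoC (Im z)) at 1.
  - eapply Rle_trans. apply Cmod_triangle.
    rewrite Cmod_mult, Cmod_Ci, !Cmod_R. lra.
  - destruct z as [x y]. unfold Cplus, Cmult, Ci, RtoC; simpl. f_equal; ring.
Qed.

Lemma C_eq (a b : C) : Re a = Re b -> Im a = Im b -> a = b.
Proof. destruct a, b; simpl; intros; subst; reflexivity. Qed.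

Lemma re_minus (a b : C) : Re (a - b) = (Re a - Re b)%R.
Proof. reflexivity. Qed.

Lemma im_minus (a b : C) : Im (a - b) = (Im a - Im b)%R.
Proof. reflexivity. Qed.

(** * Continuity and complex differentiability *)

Section Continuity.
Context {T : Type} (d : T -> T -> R).

(** The distance [d] is a parameter, so that one set of closure lemmas serves functions of a complex
    variable, of a real variable and of two real parameters. *)
Definition ccont (g : T -> C) (x : T) : Prop :=
  forall eps : R, 0 < eps -> exists del : R, 0 < del /\
    forall y, d y x < del -> Cmod (g y - g x) < eps.

Lemma ccont_const (c : C) x : ccont (fun _ => c) x.
Proof.
  intros eps He. exists 1%R. split. lra. intros.
  replace (c - c) with (RtoC 0) by ring. rewrite Cmod_0. lra.
Qed.

Lemma ccont_plus g h x : ccont g x -> ccont h x -> ccont (fun y => g y + h y) x.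
Proof.
  intros Hg Hh eps He.
  destruct (Hg (eps / 2)%R) as [d1 [Hd1 H1]]. lra.
  destruct (Hh (eps / 2)%R) as [d2 [Hd2 H2]]. lra.
  exists (Rmin d1 d2). split. apply Rmin_glb_lt; assumption.
  intros y Hy.
  assert (A := H1 y (Rlt_le_trans _ _ _ Hy (Rmin_l _ _))).
  assert (B := H2 y (Rlt_le_trans _ _ _ Hy (Rmin_r _ _))).
  replace (g y + h y - (g x + h x)) with ((g y - g x) + (h y - h x)) by ring.
  eapply Rle_lt_trans. apply Cmod_triangle. lra.
Qed.

Lemma ccont_mult g h x : ccont g x -> ccont h x -> ccont (fun y => g y * h y) x.
Proof.
  intros Hg Hh eps He.
  set (A := (Cmod (g x) + 1)%R). set (B := (Cmod (h x) + 1)%R).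
  assert (HA : 0 < A) by (unfold A; generalize (Cmod_ge_0 (g x)); lra).
  assert (HB : 0 < B) by (unfold B; generalize (Cmod_ge_0 (h x)); lra).
  assert (He1 : 0 < Rmin 1 (eps / (2 * B))).
  { apply Rmin_glb_lt. lra. apply Rdiv_lt_0_compat; lra. }
  assert (He2 : 0 < eps / (2 * A)) by (apply Rdiv_lt_0_compat; lra).
  destruct (Hg _ He1) as [d1 [Hd1 H1]].
  destruct (Hh _ He2) as [d2 [Hd2 H2]].
  exists (Rmin d1 d2). split. apply Rmin_glb_lt; assumption.
  intros y Hy.
  assert (E1 := H1 y (Rlt_le_trans _ _ _ Hy (Rmin_l _ _))).
  assert (E2 := H2 y (Rlt_le_trans _ _ _ Hy (Rmin_r _ _))).
  assert (E3 := Rlt_le_trans _ _ _ E1 (Rmin_l _ _)).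
  assert (E4 := Rlt_le_trans _ _ _ E1 (Rmin_r _ _)).
  replace (g y * h y - g x * h x) with (g y * (h y - h x) + (g y - g x) * h x) by ring.
  eapply Rle_lt_trans. apply Cmod_triangle. rewrite !Cmod_mult.
  assert (Cmod (g y) <= A).
  { unfold A. assert (Z := Cmod_minus_ge (g y) (g x)). lra. }
  assert (Cmod (g y) * Cmod (h y - h x) <= A * (eps / (2 * A)))%R.
  { apply Rmult_le_compat; try apply Cmod_ge_0; lra. }
  assert (Cmod (g y - g x) * Cmod (h x) < eps / (2 * B) * B)%R.
  { apply Rle_lt_trans with (eps / (2 * B) * Cmod (h x))%R.
    apply Rmult_le_compat_r. apply Cmod_ge_0. lra.
    apply Rmult_lt_compat_l. apply Rdiv_lt_0_compat; lra. unfold B; lra. }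
  replace (A * (eps / (2 * A)))%R with (eps / 2)%R in * by (field; lra).
  replace (eps / (2 * B) * B)%R with (eps / 2)%R in * by (field; lra).
  lra.
Qed.

Lemma ccont_opp g x : ccont g x -> ccont (fun y => - g y) x.
Proof.
  intros Hg eps He. destruct (Hg eps He) as [d1 [H1 H2]]. exists d1. split; auto.
  intros y Hy. replace (- g y - - g x) with (- (g y - g x)) by ring. rewrite Cmod_opp. auto.
Qed.

Lemma ccont_minus g h x : ccont g x -> ccont h x -> ccont (fun y => g y - h y) x.
Proof. intros. apply ccont_plus; auto. apply ccont_opp; auto. Qed.

Lemma ccont_ext g h x : (forall y, g y = h y) -> ccont g x -> ccont h x.
Proof.
  intros E H eps He. destruct (H eps He) as [d1 [H1 H2]]. exists d1. split; auto.
  intros. rewrite <- !E. auto.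
Qed.

Lemma ccont_inv (g : T -> C) x : g x <> 0 -> ccont g x -> ccont (fun y => / g y) x.
Proof.
  intros Hn Hg eps He. apply Cmod_gt_0 in Hn. set (m := Cmod (g x)) in *.
  assert (He1 : 0 < Rmin (m / 2) (eps * (m * m / 2))).
  { apply Rmin_glb_lt. lra. apply Rmult_lt_0_compat. lra.
    apply Rdiv_lt_0_compat. apply Rmult_lt_0_compat; lra. lra. }
  destruct (Hg _ He1) as [d1 [Hd1 H1]]. exists d1. split; auto.
  intros y Hy. specialize (H1 y Hy).
  assert (E3 := Rlt_le_trans _ _ _ H1 (Rmin_l _ _)).
  assert (E4 := Rlt_le_trans _ _ _ H1 (Rmin_r _ _)).
  assert (Z := Cmod_minus_ge (g x) (g y)). rewrite Cmod_minus_sym in Z. fold m in Z.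
  assert (Hy2 : m / 2 < Cmod (g y)) by lra.
  assert (N1 : g x <> 0) by (apply Cmod_gt_0; exact Hn).
  assert (N2 : g y <> 0) by (apply Cmod_gt_0; lra).
  replace (/ g y - / g x) with ((g x - g y) * / (g x * g y)) by (field; auto).
  rewrite Cmod_mult, Cmod_inv, Cmod_mult by (apply Cmult_neq_0; auto). fold m.
  rewrite Cmod_minus_sym.
  apply Rmult_lt_reg_r with (m * Cmod (g y))%R. apply Rmult_lt_0_compat; lra.
  rewrite Rmult_assoc, Rinv_l by (apply Rgt_not_eq; apply Rmult_lt_0_compat; lra).
  rewrite Rmult_1_r. eapply Rlt_trans. exact E4.
  apply Rmult_lt_compat_l; auto. 
  replace (m * m / 2)%R with (m * (m / 2))%R by field. apply Rmult_lt_compat_l; lra.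
Qed.

Lemma ccont_pow g n x : ccont g x -> ccont (fun y => g y ^ n) x.
Proof.
  intros H. induction n; simpl. apply ccont_const. apply ccont_mult; auto.
Qed.

Lemma ccont_comp (g : T -> C) (f : C -> C) x :
  ccont g x ->
  (forall eps : R, 0 < eps -> exists del : R, 0 < del /\
     forall w, Cmod (w - g x) < del -> Cmod (f w - f (g x)) < eps) ->
  ccont (fun y => f (g y)) x.
Proof.
  intros Hg Hf eps He. destruct (Hf eps He) as [d1 [H1 H2]].
  destruct (Hg d1 H1) as [d2 [H3 H4]]. exists d2. split; auto.
Qed.
End Continuity.

Definition dC (w z : C) : R := Cmod (w - z).
(** Written through [RtoC] to be convertible with the distance that [slope RtoC] uses. *)
Definition dR (s t : R) : R := Cmod (RtoC s - RtoC t).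
Definition dRR (p q : R * R) : R := Rmax (Rabs (fst p - fst q)) (Rabs (snd p - snd q)).

Lemma dR_Rabs s t : dR s t = Rabs (s - t).
Proof. unfold dR. rewrite <- RtoC_minus. apply Cmod_R. Qed.

(* Caratheodory's form of differentiability, which covers real and complex parameters at once. *)
Definition slope {T : Type} (e : T -> C) (g : T -> C) (x : T) (l : C) : Prop :=
  exists h, ccont (fun y x => Cmod (e y - e x)) h x /\ h x = l /\ forall y, g y - g x = h y * (e y - e x).

Section Slope.
Context {T : Type} (e : T -> C).

Lemma slope_cont g x l : slope e g x l -> ccont (fun y x => Cmod (e y - e x)) g x.
Proof.
  intros (h & Hh & _ & E).
  apply ccont_ext with (fun y => g x + h y * (e y - e x)). { intros y. rewrite <- E. ring. }
  apply ccont_plus. apply ccont_const. apply ccont_mult; auto. apply ccont_minus; [|apply ccont_const].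
  intros eps He. exists eps; auto.
Qed.

Lemma slope_plus g h x l m : slope e g x l -> slope e h x m -> slope e (fun y => g y + h y) x (l + m).
Proof.
  intros (p & Hp & <- & Ep) (q & Hq & <- & Eq). exists (fun y => p y + q y). split; [|split; auto].
  apply ccont_plus; auto.
  intros y. replace (g y + h y - (g x + h x)) with ((g y - g x) + (h y - h x)) by ring. rewrite Ep, Eq. ring.
Qed.

Lemma slope_mult g h x l m : slope e g x l -> slope e h x m -> slope e (fun y => g y * h y) x (l * h x + g x * m).
Proof.
  intros (p & Hp & <- & Ep) Hh. assert (Ch := slope_cont _ _ _ Hh). destruct Hh as (q & Hq & <- & Eq).
  exists (fun y => p y * h y + g x * q y). split; [|split; auto].
  - apply ccont_plus; apply ccont_mult; auto. apply ccont_const.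
  - intros y. replace (g y * h y - g x * h x) with ((g y - g x) * h y + g x * (h y - h x)) by ring. rewrite Ep, Eq. ring.
Qed.

Lemma slope_comp f g x l m : slope (fun w => w) f (g x) l -> slope e g x m -> slope e (fun y => f (g y)) x (l * m).
Proof.
  intros (p & Hp & <- & Ep) Hg. assert (Cg := slope_cont _ _ _ Hg). destruct Hg as (q & Hq & <- & Eq).
  exists (fun y => p (g y) * q y). split; [|split; auto].
  - apply ccont_mult; auto. apply ccont_comp; auto.
  - intros y. rewrite Ep, Eq. ring.
Qed.
End Slope.

(** The inequality is non-strict and multiplied out, so that [w = z] satisfies it and it matches the
    little-o form of [is_derive]. *)
Definition cderiv (f : C -> C) (z l : C) : Prop :=
  forall eps : R, 0 < eps -> exists del : R, 0 < del /\
    forall w, Cmod (w - z) < del -> Cmod (f w - f z - l * (w - z)) <= eps * Cmod (w - z).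

Lemma is_derive_cderiv (f : C -> C) (z l : C) : is_derive f z l <-> cderiv f z l.
Proof.
  split.
  - intros [_ H] eps He. specialize (H z (fun P HP => HP) (mkposreal eps He)).
    destruct H as [del H].
    exists del. split. apply cond_pos. intros w Hw.
    specialize (H w Hw). simpl in H.
    change (Cmod (f w - f z - (w - z) * l) <= eps * Cmod (w - z)) in H.
    rewrite (Cmult_comm l). exact H.
  - intros H. split. apply (is_linear_scal_l (K := C_AbsRing) (V := C_NormedModule)).
    intros x Hx. apply (is_filter_lim_locally_unique (K := C_AbsRing) (V := AbsRing_NormedModule C_AbsRing)) in Hx.
    rewrite <- Hx. clear x Hx.
    intros [eps He]. destruct (H eps He) as [del [Hd H1]].
    exists (mkposreal _ Hd). intros w Hw.
    specialize (H1 w Hw). simpl.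
    change (Cmod (f w - f z - (w - z) * l) <= eps * Cmod (w - z)).
    rewrite (Cmult_comm (w - z)). exact H1.
Qed.

Lemma ex_derive_cderiv (f : C -> C) z : ex_derive f z <-> exists l, cderiv f z l.
Proof. split; intros [l H]; exists l; apply is_derive_cderiv; auto. Qed.

Lemma cderiv_unique_C f z l : cderiv f z l -> C_derive f z = l.
Proof. intros H. apply is_C_derive_unique. apply is_derive_cderiv. exact H. Qed.

Lemma cderiv_uniq f z l l' : cderiv f z l -> cderiv f z l' -> l = l'.
Proof. intros H H'. rewrite <- (cderiv_unique_C _ _ _ H). apply cderiv_unique_C. auto. Qed.

Lemma cderiv_slope f z l : cderiv f z l <-> slope (fun w => w) f z l.
Proof.
  split.
  - intros H. exists (fun w => if Ceq_dec w z then l else (f w - f z) / (w - z)). split; [|split].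
    + intros eps He. destruct (H (eps / 2)%R) as [d [Hd H1]]. lra. exists d. split; auto. intros w Hw.
      destruct (Ceq_dec z z) as [_|]; [|contradiction]. destruct (Ceq_dec w z) as [->|Hn].
      { replace (l - l) with (RtoC 0) by ring. rewrite Cmod_0; auto. }
      assert (N : w - z <> 0) by (apply Cminus_eq_contra; auto).
      replace ((f w - f z) / (w - z) - l) with ((f w - f z - l * (w - z)) / (w - z)) by (field; auto).
      rewrite Cmod_div by auto. apply Cmod_gt_0 in N. apply Rle_lt_trans with (eps / 2)%R; [|lra].
      apply Rmult_le_reg_r with (Cmod (w - z)); auto. unfold Rdiv at 1. rewrite Rmult_assoc, Rinv_l by lra.
      specialize (H1 w Hw). lra.
    + destruct (Ceq_dec z z); auto. contradiction.
    + intros w. destruct (Ceq_dec w z) as [->|Hn]. ring. field. apply Cminus_eq_contra; auto.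
  - intros (h & Hh & <- & E) eps He. destruct (Hh eps He) as [d [Hd H1]]. exists d. split; auto. intros w Hw.
    rewrite E. replace (h w * (w - z) - h z * (w - z)) with ((h w - h z) * (w - z)) by ring. rewrite Cmod_mult.
    apply Rmult_le_compat_r. apply Cmod_ge_0. left. auto.
Qed.

Lemma cderiv_cont f z l : cderiv f z l -> ccont dC f z.
Proof. intros H. apply cderiv_slope in H. exact (slope_cont _ _ _ _ H). Qed.

Lemma cderiv_const c z : cderiv (fun _ => c) z 0.
Proof.
  intros eps He. exists 1%R. split. lra. intros.
  replace (c - c - 0 * (w - z)) with (RtoC 0) by ring. rewrite Cmod_0.
  apply Rmult_le_pos. lra. apply Cmod_ge_0.
Qed.

Lemma cderiv_id z : cderiv (fun w => w) z 1.
Proof.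
  intros eps He. exists 1%R. split. lra. intros.
  replace (w - z - 1 * (w - z)) with (RtoC 0) by ring. rewrite Cmod_0.
  apply Rmult_le_pos. lra. apply Cmod_ge_0.
Qed.

Lemma cderiv_plus f g z l m :
  cderiv f z l -> cderiv g z m -> cderiv (fun w => f w + g w) z (l + m).
Proof. rewrite !cderiv_slope. apply slope_plus. Qed.

Lemma cderiv_mult f g z l m :
  cderiv f z l -> cderiv g z m -> cderiv (fun w => f w * g w) z (l * g z + f z * m).
Proof. rewrite !cderiv_slope. apply slope_mult. Qed.

Lemma cderiv_comp f g z l m :
  cderiv f (g z) l -> cderiv g z m -> cderiv (fun w => f (g w)) z (l * m).
Proof. rewrite !cderiv_slope. apply slope_comp. Qed.

Lemma cderiv_local f g z l r :
  0 < r -> (forall w, Cmod (w - z) < r -> f w = g w) -> cderiv f z l -> cderiv g z l.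
Proof.
  intros Hr E H eps He. destruct (H eps He) as [d [Hd H1]].
  exists (Rmin d r). split. apply Rmin_glb_lt; auto. intros w Hw.
  rewrite <- !E. apply H1. eapply Rlt_le_trans. exact Hw. apply Rmin_l.
  replace (z - z) with (RtoC 0) by ring. rewrite Cmod_0. auto.
  eapply Rlt_le_trans. exact Hw. apply Rmin_r.
Qed.

Lemma cderiv_ext f g z l : (forall w, f w = g w) -> cderiv f z l -> cderiv g z l.
Proof. intros E. apply cderiv_local with 1%R; auto. lra. Qed.

Lemma cderiv_eq f z l l' : l = l' -> cderiv f z l -> cderiv f z l'.
Proof. intros ->; auto. Qed.

Lemma cderiv_scal c f z l : cderiv f z l -> cderiv (fun w => c * f w) z (c * l).
Proof.
  intros H. eapply cderiv_eq; [|apply cderiv_mult; [apply cderiv_const | exact H]]. cbv beta; ring.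
Qed.

Lemma cderiv_opp f z l : cderiv f z l -> cderiv (fun w => - f w) z (- l).
Proof.
  intros H. apply cderiv_ext with (fun w => (- (1)) * f w). intros; ring.
  eapply cderiv_eq; [|apply cderiv_scal; exact H]. ring.
Qed.

Lemma cderiv_minus f g z l m :
  cderiv f z l -> cderiv g z m -> cderiv (fun w => f w - g w) z (l - m).
Proof. intros. apply cderiv_plus; auto. apply cderiv_opp; auto. Qed.

Lemma cderiv_inv (f : C -> C) (z l : C) :
  f z <> 0 -> cderiv f z l -> cderiv (fun w => / f w) z (- l / (f z * f z)).
Proof.
  intros Hn H.
  destruct (cderiv_cont _ _ _ H (Cmod (f z))) as [d [Hd H1]]. { apply Cmod_gt_0; auto. }
  assert (N : forall w, Cmod (w - z) < d -> f w <> 0).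
  { intros w Hw E. specialize (H1 w Hw). rewrite E in H1. replace (0 - f z) with (- f z) in H1 by ring.
    rewrite Cmod_opp in H1. lra. }
  assert (Hc := cderiv_cont _ _ _ H). apply cderiv_slope in H. destruct H as (h & Hh & <- & E).
  (* The slope function of [1/f] is [- h w / (f w * f z)]; its continuity at [z] is all that
     differentiability asks for. *)
  assert (Hk : ccont dC (fun w => - h w * / (f w * f z)) z).
  { apply ccont_mult. apply ccont_opp; exact Hh. apply ccont_inv. apply Cmult_neq_0; auto.
    apply ccont_mult; auto. apply ccont_const. }
  intros eps He. destruct (Hk eps He) as [d' [Hd' H2]]. exists (Rmin d d'). split. apply Rmin_glb_lt; auto.
  intros w Hw. assert (Nw := N w (Rlt_le_trans _ _ _ Hw (Rmin_l _ _))).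
  specialize (H2 w (Rlt_le_trans _ _ _ Hw (Rmin_r _ _))). cbv beta in H2.
  replace (/ f w - / f z - - h z / (f z * f z) * (w - z))
    with ((- h w * / (f w * f z) - - h z * / (f z * f z)) * (w - z)).
  rewrite Cmod_mult. apply Rmult_le_compat_r. apply Cmod_ge_0. lra.
  replace (/ f w - / f z) with (- (f w - f z) / (f w * f z)) by (field; auto). rewrite E. field; auto.
Qed.

(** For [n = 0] the exponent [pred 0 = 0] is a default, killed by the factor [INR 0]. *)
Lemma cderiv_pow f z l n :
  cderiv f z l -> cderiv (fun w => f w ^ n) z (RtoC (INR n) * f z ^ (pred n) * l).
Proof.
  intros H. induction n.
  - simpl. eapply cderiv_eq; [|apply cderiv_const]. ring.
  - apply cderiv_ext with (fun w => f w * f w ^ n). intros; reflexivity.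
    eapply cderiv_eq; [|apply (cderiv_mult f (fun w => f w ^ n)); [exact H | exact IHn]].
    cbv beta. rewrite S_INR, RtoC_plus. destruct n; cbn [pred]; rewrite ?Cpow_S. change (INR 0) with 0%R. ring. ring.
Qed.

(** * Derivatives and integrals along a real parameter *)

Definition rderiv (g : R -> C) (t : R) (l : C) : Prop :=
  is_derive (fun s => Re (g s)) t (Re l) /\ is_derive (fun s => Im (g s)) t (Im l).

Lemma rderiv_slope g t l : rderiv g t l <-> slope RtoC g t l.
Proof.
  assert (R0 : forall s, s <> t -> RtoC s - RtoC t <> 0).
  { intros s Hs E. rewrite <- RtoC_minus in E. apply RtoC_inj in E. lra. }
  split.
  - intros [H1 H2]. apply is_derive_Reals in H1. apply is_derive_Reals in H2.
    exists (fun s => if Req_dec_T s t then l else (g s - g t) / (RtoC s - RtoC t)). split; [|split].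
    + intros eps He. destruct (H1 (eps / 2)%R) as [[d1 Hd1] E1]. lra.
      destruct (H2 (eps / 2)%R) as [[d2 Hd2] E2]. lra. simpl in *.
      exists (Rmin d1 d2). split. apply Rmin_glb_lt; auto. intros s Hs.
      destruct (Req_dec_T t t) as [_|]; [|contradiction]. destruct (Req_dec_T s t) as [->|Hn].
      { replace (l - l) with (RtoC 0) by ring. rewrite Cmod_0; auto. }
      rewrite <- RtoC_minus, Cmod_R in Hs. set (h := (s - t)%R) in *. assert (Hh : h <> 0%R) by (unfold h; lra).
      specialize (E1 h Hh (Rlt_le_trans _ _ _ Hs (Rmin_l _ _))).
      specialize (E2 h Hh (Rlt_le_trans _ _ _ Hs (Rmin_r _ _))).
      replace (t + h)%R with s in * by (unfold h; ring).
      assert (Eh : (g s - g t) / (RtoC s - RtoC t) = RtoC (/ h) * (g s - g t)).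
      { unfold h. rewrite RtoC_inv, RtoC_minus by auto. unfold Cdiv. ring. }
      rewrite Eh. eapply Rle_lt_trans. apply Cmod_le_re_im.
      rewrite re_minus, im_minus, re_scal_l, im_scal_l, re_minus, im_minus.
      unfold Rdiv in E1, E2. rewrite Rmult_comm in E1, E2. lra.
    + destruct (Req_dec_T t t); auto. contradiction.
    + intros s. destruct (Req_dec_T s t) as [->|Hn]. ring. field. auto.
  - intros (h & Hh & <- & E). split; apply is_derive_Reals; intros eps He;
    destruct (Hh eps He) as [d [Hd H1]]; exists (mkposreal d Hd); intros s Hs Hs2; simpl in Hs2;
    specialize (H1 (t + s)%R); cbv beta in H1; specialize (E (t + s)%R);
    rewrite <- RtoC_minus, Cmod_R in H1; rewrite <- RtoC_minus in E;
    replace (t + s - t)%R with s in * by ring; specialize (H1 Hs2).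
    + rewrite <- re_minus, E, re_scal_r. unfold Rdiv. rewrite Rmult_assoc, Rinv_r, Rmult_1_r, <- re_minus by auto.
      eapply Rle_lt_trans. apply re_le_Cmod. auto.
    + rewrite <- im_minus, E, im_scal_r. unfold Rdiv. rewrite Rmult_assoc, Rinv_r, Rmult_1_r, <- im_minus by auto.
      eapply Rle_lt_trans. apply im_le_Cmod. auto.
Qed.

Lemma rderiv_comp f g t l m :
  cderiv f (g t) l -> rderiv g t m -> rderiv (fun s => f (g s)) t (l * m).
Proof. rewrite cderiv_slope, !rderiv_slope. apply slope_comp. Qed.

Lemma rderiv_cont g t l : rderiv g t l -> ccont dR g t.
Proof. rewrite rderiv_slope. apply slope_cont. Qed.

Lemma rderiv_eq g t l l' : l = l' -> rderiv g t l -> rderiv g t l'.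
Proof. intros ->; auto. Qed.

Lemma rderiv_const c t : rderiv (fun _ => c) t 0.
Proof. split; simpl; apply (is_derive_const (K := R_AbsRing) (V := R_NormedModule)). Qed.

Lemma rderiv_plus g h t l m : rderiv g t l -> rderiv h t m -> rderiv (fun s => g s + h s) t (l + m).
Proof. intros [H1 H2] [H3 H4]. split; apply (is_derive_plus (K := R_AbsRing) (V := R_NormedModule)); auto. Qed.

Lemma rderiv_scal c g t l : rderiv g t l -> rderiv (fun s => c * g s) t (c * l).
Proof.
  intros H. apply (rderiv_comp (fun w => c * w) g t c l); auto.
  eapply cderiv_eq; [|apply cderiv_scal; apply cderiv_id]. ring.
Qed.

Lemma rderiv_RtoC t : rderiv RtoC t 1.
Proof.
  split; simpl. apply (is_derive_id (K := R_AbsRing)).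
  apply (is_derive_const (K := R_AbsRing) (V := R_NormedModule)).
Qed.

(** Componentwise, so that facts about real Riemann integrals transfer directly. *)
Definition cint (g : R -> C) (a b : R) : C :=
  (RInt (fun t => Re (g t)) a b, RInt (fun t => Im (g t)) a b).

Definition rcont (g : R -> C) (a b : R) : Prop :=
  forall t, Rmin a b <= t <= Rmax a b -> ccont dR g t.

Lemma ccont_Re g t : ccont dR g t -> continuous (fun s => Re (g s)) t.
Proof.
  intros H. apply continuity_pt_filterlim. intros eps He. destruct (H eps He) as [d [Hd H1]].
  exists d. split; auto. intros x [_ Hx].
  eapply Rle_lt_trans; [|apply (H1 x); rewrite dR_Rabs; exact Hx].
  change (Rabs (Re (g x) - Re (g t)) <= Cmod (g x - g t)).
  replace (Re (g x) - Re (g t))%R with (Re (g x - g t)). apply re_le_Cmod.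
  apply re_minus.
Qed.

Lemma ccont_Im g t : ccont dR g t -> continuous (fun s => Im (g s)) t.
Proof.
  intros H. apply continuity_pt_filterlim. intros eps He. destruct (H eps He) as [d [Hd H1]].
  exists d. split; auto. intros x [_ Hx].
  eapply Rle_lt_trans; [|apply (H1 x); rewrite dR_Rabs; exact Hx].
  change (Rabs (Im (g x) - Im (g t)) <= Cmod (g x - g t)).
  replace (Im (g x) - Im (g t))%R with (Im (g x - g t)). apply im_le_Cmod.
  apply im_minus.
Qed.

Lemma rcont_ex_Re g a b : rcont g a b -> ex_RInt (fun t => Re (g t)) a b.
Proof. intros H. apply (ex_RInt_continuous (V := R_CompleteNormedModule)). intros. apply ccont_Re. auto. Qed.

Lemma rcont_ex_Im g a b : rcont g a b -> ex_RInt (fun t => Im (g t)) a b.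
Proof. intros H. apply (ex_RInt_continuous (V := R_CompleteNormedModule)). intros. apply ccont_Im. auto. Qed.

Lemma cint_ext g h a b :
  (forall t, Rmin a b <= t <= Rmax a b -> g t = h t) -> cint g a b = cint h a b.
Proof.
  intros E. unfold cint. f_equal; apply RInt_ext; intros; rewrite E; auto; lra.
Qed.

Lemma cint_plus g h a b : rcont g a b -> rcont h a b ->
  cint (fun t => g t + h t) a b = cint g a b + cint h a b.
Proof.
  intros Hg Hh. apply C_eq; simpl.
  - rewrite <- (RInt_plus (V := R_CompleteNormedModule)); auto; apply rcont_ex_Re; auto.
  - rewrite <- (RInt_plus (V := R_CompleteNormedModule)); auto; apply rcont_ex_Im; auto.
Qed.

Lemma cint_scal c g a b : rcont g a b -> cint (fun t => c * g t) a b = c * cint g a b.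
Proof.
  intros Hg. assert (H1 := rcont_ex_Re _ _ _ Hg). assert (H2 := rcont_ex_Im _ _ _ Hg).
  assert (S : forall x : R, forall u : R -> R, ex_RInt u a b -> ex_RInt (fun t => scal x (u t)) a b).
  { intros. apply (ex_RInt_scal (V := R_CompleteNormedModule)). auto. }
  apply C_eq; simpl.
  - rewrite (RInt_ext _ (fun t => minus (scal (Re c) (Re (g t))) (scal (Im c) (Im (g t))))).
    rewrite (RInt_minus (V := R_CompleteNormedModule)); auto.
    rewrite !(RInt_scal (V := R_CompleteNormedModule)); auto.
    intros; reflexivity.
  - rewrite (RInt_ext _ (fun t => plus (scal (Re c) (Im (g t))) (scal (Im c) (Re (g t))))).
    rewrite (RInt_plus (V := R_CompleteNormedModule)); auto.
    rewrite !(RInt_scal (V := R_CompleteNormedModule)); auto.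
    intros; reflexivity.
Qed.

Lemma cint_minus g h a b : rcont g a b -> rcont h a b ->
  cint (fun t => g t - h t) a b = cint g a b - cint h a b.
Proof.
  intros Hg Hh. rewrite (cint_ext _ (fun t => g t + (-1) * h t)) by (intros; ring).
  rewrite cint_plus; auto. rewrite cint_scal; auto. ring.
  intros t Ht. apply ccont_mult. apply ccont_const. auto.
Qed.

Lemma cint_Chasles g a b c : rcont g a b -> rcont g b c ->
  cint g a b + cint g b c = cint g a c.
Proof.
  intros Hg Hh. apply C_eq; simpl.
  - rewrite <- (RInt_Chasles (V := R_CompleteNormedModule) (fun t => Re (g t)) a b c);
    [reflexivity | apply rcont_ex_Re; auto | apply rcont_ex_Re; auto].
  - rewrite <- (RInt_Chasles (V := R_CompleteNormedModule) (fun t => Im (g t)) a b c);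
    [reflexivity | apply rcont_ex_Im; auto | apply rcont_ex_Im; auto].
Qed.

Lemma cint_const c a b : cint (fun _ => c) a b = RtoC (b - a) * c.
Proof.
  unfold cint. rewrite !RInt_const. apply C_eq; simpl; unfold scal; simpl; unfold mult, Re, Im; simpl; ring.
Qed.

(** The factor 2 stems from bounding real and imaginary parts separately; the later estimates
    tolerate it. *)
Lemma cint_bound g a b M : a <= b -> rcont g a b ->
  (forall t, a <= t <= b -> Cmod (g t) <= M) -> Cmod (cint g a b) <= 2 * M * (b - a).
Proof.
  intros Hab Hg HM. eapply Rle_trans. apply Cmod_le_re_im.
  assert (H1 := rcont_ex_Re _ _ _ Hg). assert (H2 := rcont_ex_Im _ _ _ Hg). simpl.
  assert (Rabs (RInt (fun t => Re (g t)) a b) <= (b - a) * M).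
  { apply abs_RInt_le_const; auto. intros. eapply Rle_trans. apply re_le_Cmod. auto. }
  assert (Rabs (RInt (fun t => Im (g t)) a b) <= (b - a) * M).
  { apply abs_RInt_le_const; auto. intros. eapply Rle_trans. apply im_le_Cmod. auto. }
  lra.
Qed.

Lemma cint_FTC g dg a b :
  (forall t, Rmin a b <= t <= Rmax a b -> rderiv g t (dg t)) -> rcont dg a b ->
  cint dg a b = g b - g a.
Proof.
  intros Hd Hc. apply C_eq; simpl.
  - apply is_RInt_unique. apply (is_RInt_derive (V := R_CompleteNormedModule) (fun t => Re (g t))).
    intros; apply Hd; auto. intros; apply ccont_Re; auto.
  - apply is_RInt_unique. apply (is_RInt_derive (V := R_CompleteNormedModule) (fun t => Im (g t))).
    intros; apply Hd; auto. intros; apply ccont_Im; auto.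
Qed.

(** * Goursat's theorem on rectangles *)

Lemma cint_swap g a b : rcont g a b -> cint g b a = - cint g a b.
Proof.
  intros H. apply C_eq; simpl.
  - rewrite <- (opp_RInt_swap (V := R_CompleteNormedModule)). reflexivity. apply rcont_ex_Re; auto.
  - rewrite <- (opp_RInt_swap (V := R_CompleteNormedModule)). reflexivity. apply rcont_ex_Im; auto.
Qed.

Lemma rcont_swap g a b : rcont g a b -> rcont g b a.
Proof. intros H t Ht. apply H. rewrite Rmin_comm, Rmax_comm. auto. Qed.

Lemma cint_bound_abs g a b M : rcont g a b ->
  (forall t, Rmin a b <= t <= Rmax a b -> Cmod (g t) <= M) -> Cmod (cint g a b) <= 2 * M * Rabs (b - a).
Proof.
  intros Hc HM. destruct (Rle_dec a b).
  - rewrite Rabs_right by lra. apply cint_bound; auto. intros. apply HM.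
    rewrite Rmin_left, Rmax_right; auto.
  - rewrite cint_swap, Cmod_opp, Rabs_left by (lra || apply rcont_swap; auto). replace (- (b - a))%R with (a - b)%R by ring.
    apply cint_bound. lra. apply rcont_swap; auto. intros. apply HM.
    rewrite Rmin_right, Rmax_left; lra.
Qed.

Lemma rderiv_hline (y t : R) : rderiv (fun t => (t, y)) t 1.
Proof.
  split; simpl. apply (is_derive_id (K := R_AbsRing)).
  apply (is_derive_const (K := R_AbsRing) (V := R_NormedModule)).
Qed.

Lemma rderiv_vline (x t : R) : rderiv (fun t => (x, t)) t Ci.
Proof.
  split; simpl. apply (is_derive_const (K := R_AbsRing) (V := R_NormedModule)).
  apply (is_derive_id (K := R_AbsRing)).
Qed.

Lemma ccont_hline f x y : ccont dC f (x, y) -> ccont dR (fun t => f (t, y)) x.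
Proof. intros H. apply (ccont_comp dR (fun t => (t, y))); auto. eapply rderiv_cont. apply rderiv_hline. Qed.

Lemma ccont_vline f x y : ccont dC f (x, y) -> ccont dR (fun t => f (x, t)) y.
Proof. intros H. apply (ccont_comp dR (fun t => (x, t))); auto. eapply rderiv_cont. apply rderiv_vline. Qed.

(** The integral of [f(z) dz] along the boundary, counterclockwise: bottom, right, then top and left
    with a minus sign. *)
Definition rect_int (f : C -> C) (x1 x2 y1 y2 : R) : C :=
  cint (fun t => f (t, y1)) x1 x2 + Ci * cint (fun s => f (x2, s)) y1 y2
  - cint (fun t => f (t, y2)) x1 x2 - Ci * cint (fun s => f (x1, s)) y1 y2.

Lemma rect_int_deriv F f x1 x2 y1 y2 :
  (forall z, cderiv F z (f z)) -> (forall z, ccont dC f z) -> rect_int f x1 x2 y1 y2 = 0.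
Proof.
  intros HF Hf.
  assert (A : forall y, cint (fun t => f (t, y)) x1 x2 = F (x2, y) - F (x1, y)).
  { intros y. apply (cint_FTC (fun t => F (t, y))).
    - intros. eapply rderiv_eq; [|apply (rderiv_comp F); [apply HF | apply rderiv_hline]]. cbv beta; ring.
    - intros t _. apply ccont_hline; auto. }
  assert (B : forall x, Ci * cint (fun t => f (x, t)) y1 y2 = F (x, y2) - F (x, y1)).
  { intros x. rewrite <- cint_scal by (intros t _; apply ccont_vline; auto).
    apply (cint_FTC (fun t => F (x, t))).
    - intros. eapply rderiv_eq; [|apply (rderiv_comp F); [apply HF | apply rderiv_vline]]. cbv beta; ring.
    - intros t _. apply ccont_mult. apply ccont_const. apply ccont_vline; auto. }
  unfold rect_int. rewrite !A, !B. ring.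
Qed.

Lemma rect_int_minus f g x1 x2 y1 y2 : x1 <= x2 -> y1 <= y2 ->
  (forall x y, x1 <= x <= x2 -> y1 <= y <= y2 -> ccont dC f (x, y)) ->
  (forall x y, x1 <= x <= x2 -> y1 <= y <= y2 -> ccont dC g (x, y)) ->
  rect_int (fun z => f z - g z) x1 x2 y1 y2 = rect_int f x1 x2 y1 y2 - rect_int g x1 x2 y1 y2.
Proof.
  intros Hx Hy Hf Hg.
  assert (HH : forall u y, y1 <= y <= y2 ->
    (forall x y, x1 <= x <= x2 -> y1 <= y <= y2 -> ccont dC u (x, y)) -> rcont (fun t => u (t, y)) x1 x2).
  { intros u y Hy' H t. rewrite Rmin_left, Rmax_right by auto. intros. apply ccont_hline; auto. }
  assert (HV : forall u x, x1 <= x <= x2 ->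
    (forall x y, x1 <= x <= x2 -> y1 <= y <= y2 -> ccont dC u (x, y)) -> rcont (fun t => u (x, t)) y1 y2).
  { intros u y Hy' H t. rewrite Rmin_left, Rmax_right by auto. intros. apply ccont_vline; auto. }
  unfold rect_int. rewrite !cint_minus by (apply HH || apply HV; auto; lra). ring.
Qed.

Lemma rect_int_bound f x1 x2 y1 y2 M : x1 <= x2 -> y1 <= y2 ->
  (forall x y, x1 <= x <= x2 -> y1 <= y <= y2 -> ccont dC f (x, y)) ->
  (forall x y, x1 <= x <= x2 -> y1 <= y <= y2 -> Cmod (f (x, y)) <= M) ->
  Cmod (rect_int f x1 x2 y1 y2) <= 4 * M * ((x2 - x1) + (y2 - y1)).
Proof.
  intros Hx Hy Hf HM.
  assert (HH : forall y, y1 <= y <= y2 -> Cmod (cint (fun t => f (t, y)) x1 x2) <= 2 * M * (x2 - x1)).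
  { intros y Hy'. apply cint_bound; auto.
    intros t. rewrite Rmin_left, Rmax_right by auto. intros. apply ccont_hline; auto. }
  assert (HV : forall x, x1 <= x <= x2 -> Cmod (Ci * cint (fun t => f (x, t)) y1 y2) <= 2 * M * (y2 - y1)).
  { intros x Hx'. rewrite Cmod_mult, Cmod_Ci, Rmult_1_l. apply cint_bound; auto.
    intros t. rewrite Rmin_left, Rmax_right by auto. intros. apply ccont_vline; auto. }
  assert (A1 := HH y1 ltac:(lra)). assert (A2 := HH y2 ltac:(lra)).
  assert (A3 := HV x1 ltac:(lra)). assert (A4 := HV x2 ltac:(lra)).
  unfold rect_int.
  match goal with |- Cmod (?a + ?b - ?c - ?d) <= _ =>
    assert (B1 := Cmod_minus_le (a + b - c) d);
    assert (B2 := Cmod_minus_le (a + b) c);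
    assert (B3 := Cmod_triangle a b) end. lra.
Qed.

Lemma rect_int_split f x1 xm x2 y1 ym y2 : x1 <= xm <= x2 -> y1 <= ym <= y2 ->
  (forall x y, x1 <= x <= x2 -> y1 <= y <= y2 -> ccont dC f (x, y)) ->
  rect_int f x1 x2 y1 y2 =
  rect_int f x1 xm y1 ym + rect_int f xm x2 y1 ym + rect_int f x1 xm ym y2 + rect_int f xm x2 ym y2.
Proof.
  intros Hx Hy Hf.
  assert (HH : forall y a b, y1 <= y <= y2 -> x1 <= a -> a <= b -> b <= x2 -> rcont (fun t => f (t, y)) a b).
  { intros y a b Hy' H1 H2 H3 t. rewrite Rmin_left, Rmax_right by auto. intros. apply ccont_hline; apply Hf; lra. }
  assert (HV : forall x a b, x1 <= x <= x2 -> y1 <= a -> a <= b -> b <= y2 -> rcont (fun t => f (x, t)) a b).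
  { intros x a b Hy' H1 H2 H3 t. rewrite Rmin_left, Rmax_right by auto. intros. apply ccont_vline; apply Hf; lra. }
  unfold rect_int.
  rewrite <- (cint_Chasles (fun t => f (t, y1)) x1 xm x2) by (apply HH; lra).
  rewrite <- (cint_Chasles (fun t => f (t, y2)) x1 xm x2) by (apply HH; lra).
  rewrite <- (cint_Chasles (fun t => f (x1, t)) y1 ym y2) by (apply HV; lra).
  rewrite <- (cint_Chasles (fun t => f (x2, t)) y1 ym y2) by (apply HV; lra).
  ring.
Qed.

Lemma dependent_choice_seq {A : Type} (P : nat -> A -> Prop) (Rl : nat -> A -> A -> Prop) (a0 : A) :
  P 0%nat a0 -> (forall n a, P n a -> exists b, P (S n) b /\ Rl n a b) ->
  exists u : nat -> A, u 0%nat = a0 /\ (forall n, P n (u n)) /\ (forall n, Rl n (u n) (u (S n))).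
Proof.
  intros H0 Hs.
  set (nxt := fun n (x : {a | P n a}) =>
    constructive_indefinite_description _ (Hs n (proj1_sig x) (proj2_sig x))).
  set (sq := fix sq n : {a | P n a} := match n with
    | O => exist _ a0 H0
    | S m => exist _ (proj1_sig (nxt m (sq m))) (proj1 (proj2_sig (nxt m (sq m)))) end).
  exists (fun n => proj1_sig (sq n)). split; [reflexivity|split].
  - intros n. apply (proj2_sig (sq n)).
  - intros n. simpl. apply (proj2 (proj2_sig (nxt n (sq n)))).
Qed.

(** The supremum of the left end points lies in all the nested intervals. *)
Lemma nested_limit (u : nat -> R) (A : R) : 0 <= A ->
  (forall n, u n <= u (S n) /\ u (S n) + A / 2 ^ (S n) <= u n + A / 2 ^ n) ->
  exists x, forall n, u n <= x <= u n + A / 2 ^ n.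
Proof.
  intros HA Hu.
  assert (Hp : forall n, (0 <= A / 2 ^ n)%R).
  { intros n. apply Rmult_le_pos; auto. left. apply Rinv_0_lt_compat. apply pow_lt. lra. }
  assert (M : forall n k, u n <= u (n + k)%nat /\ u (n + k)%nat + A / 2 ^ (n + k) <= u n + A / 2 ^ n).
  { intros n k. induction k. rewrite Nat.add_0_r. lra.
    rewrite Nat.add_succ_r. destruct (Hu (n + k)%nat). lra. }
  assert (M2 : forall n m, u m <= u n + A / 2 ^ n).
  { intros n m. destruct (Nat.le_ge_cases n m) as [H|H].
    - replace m with (n + (m - n))%nat by lia. destruct (M n (m - n)%nat). generalize (Hp (n + (m - n))%nat). lra.
    - replace n with (m + (n - m))%nat by lia. destruct (M m (n - m)%nat). generalize (Hp (m + (n - m))%nat). lra. }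
  destruct (completeness (fun x => exists n, x = u n)) as [x [H1 H2]].
  - exists (u 0%nat + A / 2 ^ 0)%R. intros y [n ->]. apply M2.
  - exists (u 0%nat), 0%nat. auto.
  - exists x. intros n. split. apply H1. exists n; auto. apply H2. intros y [m ->]. apply M2.
Qed.

(** Bisection: one of the four quarters keeps at least a quarter of the modulus of the integral, so
    a nonzero integral would leave at least [eta / 4^n] on nested rectangles. Near their common
    point the affine approximation has a primitive and integrates to 0, while the error is at most a
    small constant times the squared size, which is also of order [4^(-n)]. *)
Lemma goursat f x1 x2 y1 y2 : x1 <= x2 -> y1 <= y2 ->
  (forall x y, x1 <= x <= x2 -> y1 <= y <= y2 -> exists l, cderiv f (x, y) l) ->
  rect_int f x1 x2 y1 y2 = 0.
Proof.
  intros Hx Hy Hd.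
  assert (Hc : forall x y, x1 <= x <= x2 -> y1 <= y <= y2 -> ccont dC f (x, y)).
  { intros x y H1 H2. destruct (Hd x y H1 H2) as [l Hl]. eapply cderiv_cont; eauto. }
  set (A := (x2 - x1)%R). set (B := (y2 - y1)%R).
  assert (HA : 0 <= A) by (unfold A; lra). assert (HB : 0 <= B) by (unfold B; lra).
  assert (p2 : forall n, (0 < 2 ^ n)%R) by (intros; apply pow_lt; lra).
  assert (Ha : forall E n, (0 <= E)%R -> (0 <= E / 2 ^ n)%R).
  { intros E n HE. apply Rmult_le_pos; auto. left. apply Rinv_0_lt_compat. auto. }
  assert (Hh : forall E n, (E / 2 ^ n = 2 * (E / 2 ^ S n))%R).
  { intros. simpl. field. apply Rgt_not_eq; apply p2. }
  set (J := fun (n : nat) (p : R * R) => rect_int f (fst p) (fst p + A / 2 ^ n) (snd p) (snd p + B / 2 ^ n)).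
  destruct (Ceq_dec (rect_int f x1 x2 y1 y2) 0) as [|Hne]; auto. exfalso.
  set (eta := Cmod (rect_int f x1 x2 y1 y2)).
  assert (Heta : 0 < eta) by (apply Cmod_gt_0; auto).
  set (P := fun n (p : R * R) => x1 <= fst p /\ fst p + A / 2 ^ n <= x2 /\ y1 <= snd p /\ snd p + B / 2 ^ n <= y2
     /\ eta / 4 ^ n <= Cmod (J n p)).
  set (Rl := fun n (p q : R * R) => fst p <= fst q /\ fst q + A / 2 ^ S n <= fst p + A / 2 ^ n
      /\ snd p <= snd q /\ snd q + B / 2 ^ S n <= snd p + B / 2 ^ n).
  assert (Hcmp : (eta / 4 ^ 0 <= Cmod (J 0%nat (x1, y1)))%R).
  { unfold J; simpl. replace (x1 + A / 1)%R with x2 by (unfold A; field).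
    replace (y1 + B / 1)%R with y2 by (unfold B; field). fold eta. lra. }
  destruct (dependent_choice_seq P Rl (x1, y1)) as [u [_ [HP HR]]].
  - unfold P; simpl. repeat split; try lra; try (unfold A; lra); try (unfold B; lra).
  - intros n [x y] (Q1 & Q2 & Q3 & Q4 & Q5). simpl in Q1, Q2, Q3, Q4.
    assert (a0 := Ha A (S n) HA). assert (b0 := Ha B (S n) HB).
    assert (a1 := Hh A n). assert (b1 := Hh B n).
    set (a := (A / 2 ^ S n)%R) in *. set (b := (B / 2 ^ S n)%R) in *.
    assert (E : J n (x, y) = J (S n) (x, y) + J (S n) (x + a, y)%R + J (S n) (x, y + b)%R + J (S n) (x + a, y + b)%R).
    { unfold J; cbn [fst snd]. rewrite a1, b1. fold a b.
      replace (x + 2 * a)%R with (x + a + a)%R by ring. replace (y + 2 * b)%R with (y + b + b)%R by ring.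
      apply rect_int_split; try lra. intros. apply Hc; lra. }
    assert (Q6 : (eta / 4 ^ n = 4 * (eta / 4 ^ S n))%R).
    { simpl. field. apply pow_nonzero; lra. }
    set (e := (eta / 4 ^ S n)%R) in *.
    assert (T : Cmod (J n (x, y)) <= Cmod (J (S n) (x, y)) + Cmod (J (S n) (x + a, y)%R) + Cmod (J (S n) (x, y + b)%R) + Cmod (J (S n) (x + a, y + b)%R)).
    { rewrite E. eapply Rle_trans. apply Cmod_triangle. apply Rplus_le_compat_r.
      eapply Rle_trans. apply Cmod_triangle. apply Rplus_le_compat_r. apply Cmod_triangle. }
    destruct (Rle_dec e (Cmod (J (S n) (x, y)))) as [G|G1];
    [|destruct (Rle_dec e (Cmod (J (S n) (x + a, y)%R))) as [G|G2];
    [|destruct (Rle_dec e (Cmod (J (S n) (x, y + b)%R))) as [G|G3];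
    [|destruct (Rle_dec e (Cmod (J (S n) (x + a, y + b)%R))) as [G|G4]; [|exfalso; lra]]]].
    + exists (x, y). unfold P, Rl; cbn [fst snd]. fold a b e. repeat split; auto; lra.
    + exists (x + a, y)%R. unfold P, Rl; cbn [fst snd]. fold a b e. repeat split; auto; lra.
    + exists (x, y + b)%R. unfold P, Rl; cbn [fst snd]. fold a b e. repeat split; auto; lra.
    + exists (x + a, y + b)%R. unfold P, Rl; cbn [fst snd]. fold a b e. repeat split; auto; lra.
  - destruct (nested_limit (fun n => fst (u n)) A HA) as [x Hxn].
    { intros n. destruct (HR n) as (? & ? & ? & ?). lra. }
    destruct (nested_limit (fun n => snd (u n)) B HB) as [y Hyn].
    { intros n. destruct (HR n) as (? & ? & ? & ?). lra. }
    destruct (HP 0%nat) as (Z1 & Z2 & Z3 & Z4 & _).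
    assert (X0 := Hxn 0%nat). assert (Y0 := Hyn 0%nat). cbv beta in X0, Y0.
    destruct (Hd x y) as [l Hl]. lra. lra.
    (* [D] bounds the half-perimeter, and the added 1 keeps it positive for degenerate rectangles.
       With tolerance [eta / (8 D^2)] the error stays below half of [eta / 4^n]. *)
    set (D := (A + B + 1)%R). assert (HD : 0 < D) by (unfold D; lra).
    assert (He : 0 < eta / (8 * D * D)).
    { apply Rdiv_lt_0_compat; auto. repeat apply Rmult_lt_0_compat; lra. }
    destruct (Hl _ He) as [del [Hdel Hbd]].
    assert (Hn : exists n, (D / 2 ^ n < del)%R).
    { destruct (pow_lt_1_zero (/ 2)) with (y := (del / D)%R) as [N HN].
      rewrite Rabs_right; lra. apply Rdiv_lt_0_compat; auto.
      exists N. specialize (HN N (Nat.le_refl N)). rewrite Rabs_right in HN.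
      2: apply Rle_ge; apply pow_le; lra.
      rewrite pow_inv in HN. apply Rmult_lt_reg_r with (/ D)%R. apply Rinv_0_lt_compat; auto.
      replace (D / 2 ^ N * / D)%R with (/ 2 ^ N)%R. exact HN.
      field. split. lra. apply Rgt_not_eq; apply p2. }
    destruct Hn as [n Hn]. destruct (HP n) as (W1 & W2 & W3 & W4 & W5).
    specialize (Hxn n). specialize (Hyn n). cbv beta in Hxn, Hyn.
    assert (a0 := Ha A n HA). assert (b0 := Ha B n HB).
    assert (Dn : (D / 2 ^ n = A / 2 ^ n + B / 2 ^ n + 1 / 2 ^ n)%R) by (unfold D; field; apply Rgt_not_eq; apply p2).
    assert (c0 : (0 <= 1 / 2 ^ n)%R) by (apply Ha; lra).
    unfold J in W5. set (a := (A / 2 ^ n)%R) in *. set (b := (B / 2 ^ n)%R) in *.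
    set (x0 := fst (u n)) in *. set (y0 := snd (u n)) in *.
    set (g := fun z : C => f (x, y) + l * (z - (x, y))).
    assert (Hg : forall z, ccont dC g z).
    { intros z. unfold g. apply ccont_plus. apply ccont_const. apply ccont_mult. apply ccont_const.
      apply ccont_minus. eapply cderiv_cont. apply cderiv_id. apply ccont_const. }
    assert (G0 : rect_int g x0 (x0 + a) y0 (y0 + b) = 0).
    { apply rect_int_deriv with (F := fun z => f (x, y) * z + (l / 2) * ((z - (x, y)) * (z - (x, y)))); auto.
      intros z. eapply cderiv_eq; [|apply cderiv_plus; [apply cderiv_scal; apply cderiv_id |
        apply cderiv_scal; apply cderiv_mult; apply cderiv_minus; try apply cderiv_id; apply cderiv_const ]].
      unfold g. cbv beta. field. }
    assert (Hpt : forall p q, x0 <= p <= x0 + a -> y0 <= q <= y0 + b -> Cmod ((p, q) - (x, y)) <= a + b).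
    { intros p q Hp Hq. eapply Rle_trans. apply Cmod_le_re_im. simpl.
      apply Rplus_le_compat; apply Rabs_le; lra. }
    assert (Bd : Cmod (rect_int (fun z => f z - g z) x0 (x0 + a) y0 (y0 + b)) <=
       4 * (eta / (8 * D * D) * (a + b)) * ((x0 + a - x0) + (y0 + b - y0))).
    { apply rect_int_bound; try lra.
      - intros. apply ccont_minus; auto. apply Hc; lra.
      - intros p q Hp Hq. assert (Hpq := Hpt p q Hp Hq).
        unfold g. replace (f (p, q) - (f (x, y) + l * ((p, q) - (x, y)))) with (f (p, q) - f (x, y) - l * ((p, q) - (x, y))) by ring.
        eapply Rle_trans. apply Hbd. lra. apply Rmult_le_compat_l; lra. }
    rewrite rect_int_minus in Bd; try lra; auto.
    2: intros; apply Hc; lra.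
    rewrite G0 in Bd. replace (rect_int f x0 (x0 + a) y0 (y0 + b) - 0) with (rect_int f x0 (x0 + a) y0 (y0 + b)) in Bd by ring.
    assert (F4 : (4 ^ n = 2 ^ n * 2 ^ n)%R).
    { rewrite <- Rpow_mult_distr. f_equal; lra. }
    assert (Fin : (eta / 4 ^ n <= eta / (2 * D * D) * ((a + b) * (a + b)))%R).
    { eapply Rle_trans. exact W5. eapply Rle_trans. exact Bd. right. field. lra. }
    assert (ab : (a + b = (A + B) / 2 ^ n)%R) by (unfold a, b; field; apply Rgt_not_eq; apply p2).
    rewrite ab, F4 in Fin.
    assert (Fin2 : (eta <= eta / (2 * D * D) * ((A + B) * (A + B)))%R).
    { apply Rmult_le_reg_r with (/ (2 ^ n * 2 ^ n))%R. apply Rinv_0_lt_compat. apply Rmult_lt_0_compat; auto.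
      eapply Rle_trans. exact Fin. right. field; repeat split; try lra; apply Rgt_not_eq; apply p2. }
    assert ((A + B) * (A + B) <= D * D)%R by (unfold D; nra).
    assert (eta / (2 * D * D) * ((A + B) * (A + B)) <= eta / (2 * D * D) * (D * D))%R.
    { apply Rmult_le_compat_l; auto. left. apply Rdiv_lt_0_compat; auto. repeat apply Rmult_lt_0_compat; lra. }
    replace (eta / (2 * D * D) * (D * D))%R with (eta / 2)%R in * by (field; lra). lra.
Qed.

(** Exchanging the ends of a side only changes the sign. The primitive below needs rectangles in
    every orientation. *)
Lemma goursat_oriented f x1 x2 y1 y2 :
  (forall x y, Rmin x1 x2 <= x <= Rmax x1 x2 -> Rmin y1 y2 <= y <= Rmax y1 y2 -> exists l, cderiv f (x, y) l) ->
  rect_int f x1 x2 y1 y2 = 0.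
Proof.
  intros H.
  assert (Hc : forall x y, Rmin x1 x2 <= x <= Rmax x1 x2 -> Rmin y1 y2 <= y <= Rmax y1 y2 -> ccont dC f (x, y)).
  { intros x y H1 H2. destruct (H x y H1 H2) as [l Hl]. eapply cderiv_cont; eauto. }
  assert (mid : forall a b, Rmin a b <= a <= Rmax a b /\ Rmin a b <= b <= Rmax a b).
  { intros a b. unfold Rmin, Rmax. destruct (Rle_dec a b); lra. }
  assert (X1 : rcont (fun t => f (t, y1)) x1 x2) by (intros t Ht; apply ccont_hline; apply Hc; auto; apply mid).
  assert (X2 : rcont (fun t => f (t, y2)) x1 x2) by (intros t Ht; apply ccont_hline; apply Hc; auto; apply mid).
  assert (Y1 : rcont (fun t => f (x1, t)) y1 y2) by (intros t Ht; apply ccont_vline; apply Hc; auto; apply mid).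
  assert (Y2 : rcont (fun t => f (x2, t)) y1 y2) by (intros t Ht; apply ccont_vline; apply Hc; auto; apply mid).
  assert (SX : rect_int f x2 x1 y1 y2 = - rect_int f x1 x2 y1 y2).
  { unfold rect_int. rewrite !(cint_swap _ x1 x2) by auto. ring. }
  assert (SY : rect_int f x1 x2 y2 y1 = - rect_int f x1 x2 y1 y2).
  { unfold rect_int. rewrite !(cint_swap _ y1 y2) by auto. ring. }
  assert (SXY : rect_int f x2 x1 y2 y1 = rect_int f x1 x2 y1 y2).
  { unfold rect_int. rewrite !(cint_swap _ x1 x2), !(cint_swap _ y1 y2) by auto. ring. }
  assert (op : forall a : C, - a = 0 -> a = 0) by (intros a Ha; replace a with (- - a) by ring; rewrite Ha; ring).
  unfold Rmin, Rmax in H.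
  destruct (Rle_dec x1 x2); destruct (Rle_dec y1 y2).
  - apply goursat; auto.
  - apply op. rewrite <- SY. apply goursat; auto; lra.
  - apply op. rewrite <- SX. apply goursat; auto; lra.
  - rewrite <- SXY. apply goursat; auto; lra.
Qed.

(** * Primitives on discs *)

Definition hol (r : R) (f : C -> C) : Prop := forall z, Cmod z < r -> exists l, cderiv f z l.

Lemma hol_cont r f z : hol r f -> Cmod z < r -> ccont dC f z.
Proof. intros H Hz. destruct (H z Hz) as [l Hl]. eapply cderiv_cont; eauto. Qed.

Lemma Cmod_le_abs (x1 y1 x2 y2 : R) : Rabs x1 <= Rabs x2 -> Rabs y1 <= Rabs y2 -> Cmod (x1, y1) <= Cmod (x2, y2).
Proof.
  intros H1 H2. unfold Cmod; simpl. apply sqrt_le_1_alt.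
  assert (A := Rsqr_le_abs_1 _ _ H1). assert (B := Rsqr_le_abs_1 _ _ H2). unfold Rsqr in *. lra.
Qed.

(** Integrating along the real axis and then vertically stays in the disc, since shrinking a
    coordinate shrinks the modulus. Goursat's theorem moves the horizontal piece between [x] and
    [x'] from height 0 up to height [y], so that the increment involves only two short segments near
    [(x, y)], where [f] is nearly constant. *)
Lemma hol_primitive r f : hol r f -> exists F, forall z, Cmod z < r -> cderiv F z (f z).
Proof.
  intros Hf.
  exists (fun z => cint (fun t => f (t, 0%R)) 0 (Re z) + Ci * cint (fun s => f (Re z, s)) 0 (Im z)).
  intros [x y] Hz eps He.
  destruct (hol_cont _ _ _ Hf Hz (eps / 4)%R) as [d1 [Hd1 Hc]]. lra.
  (* The two short segments stay within [2 h] of [(x, y)], hence the halves. *)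
  exists (Rmin (d1 / 2) ((r - Cmod (x, y)) / 2)). split. apply Rmin_glb_lt; lra.
  intros [x' y'] Hw. 
  assert (W1 := Rlt_le_trans _ _ _ Hw (Rmin_l _ _)).
  assert (W2 := Rlt_le_trans _ _ _ Hw (Rmin_r _ _)).
  set (h := Cmod ((x', y') - (x, y))) in *.
  assert (hx : Rabs (x' - x) <= h) by (apply (re_le_Cmod ((x', y') - (x, y)))).
  assert (hy : Rabs (y' - y) <= h) by (apply (im_le_Cmod ((x', y') - (x, y)))).
  assert (btw : forall a b t, Rmin a b <= t <= Rmax a b -> Rabs (t - a) <= Rabs (b - a)).
  { intros a b t. unfold Rmin, Rmax. destruct (Rle_dec a b); intros;
    unfold Rabs; destruct (Rcase_abs (t - a)), (Rcase_abs (b - a)); lra. }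
  assert (near : forall p q, Cmod ((p, q) - (x, y)) <= Rabs (p - x) + Rabs (q - y)).
  { intros. apply (Cmod_le_re_im ((p, q) - (x, y))). }
  assert (D1 : forall p q, Rmin x x' <= p <= Rmax x x' -> Rmin 0 y <= q <= Rmax 0 y -> Cmod (p, q) < r).
  { intros p q Hp Hq. apply btw in Hp. apply btw in Hq. rewrite !Rminus_0_r in Hq.
    assert (Cmod (x, q) <= Cmod (x, y)) by (apply Cmod_le_abs; lra).
    assert (T := Cmod_triangle (x, q) (RtoC (p - x))). rewrite Cmod_R in T.
    replace ((x, q) + RtoC (p - x)) with ((p, q) : C) in T by (apply C_eq; simpl; ring). lra. }
  assert (D2 : forall p q, Rabs (p - x) <= h -> Rabs (q - y) <= h -> Cmod (p, q) < r).
  { intros p q Hp Hq. assert (T := Cmod_triangle ((p, q) - (x, y)) (x, y)).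
    replace ((p, q) - (x, y) + (x, y)) with ((p, q) : C) in T by (apply C_eq; simpl; ring).
    specialize (near p q). lra. }
  assert (D3 : forall p q, Rabs (p - x) <= h -> Rabs (q - y) <= h -> Cmod (f (p, q) - f (x, y)) < eps / 4).
  { intros p q Hp Hq. apply Hc. unfold dC. specialize (near p q). lra. }
  assert (R1 : rect_int f x x' 0 y = 0).
  { apply goursat_oriented. intros. apply Hf. apply D1; auto. }
  assert (mmx : forall a b t, Rmin a b <= t <= Rmax a b -> Rabs t <= Rmax (Rabs a) (Rabs b)).
  { intros a b t. unfold Rmin, Rmax. destruct (Rle_dec a b), (Rle_dec (Rabs a) (Rabs b));
    unfold Rabs in *; destruct (Rcase_abs a), (Rcase_abs b), (Rcase_abs t); lra. }
  assert (axis : forall p q, Cmod (p, q) < r -> Cmod (p, 0%R) < r).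
  { intros p q. apply Rle_lt_trans. apply Cmod_le_abs. lra. rewrite Rabs_R0. apply Rabs_pos. }
  assert (C1 : forall a, Rabs a <= Rabs x \/ Rabs (a - x) <= h -> Cmod (a, 0%R) < r).
  { intros a [Ha|Ha]. eapply Rle_lt_trans; [|apply (axis _ _ Hz)]. apply Cmod_le_abs; lra.
    apply axis with y. apply D2; auto. rewrite Rminus_diag, Rabs_R0. unfold h; apply Cmod_ge_0. }
  assert (K1 : rcont (fun t => f (t, 0%R)) 0 x).
  { intros t Ht. apply ccont_hline. apply hol_cont with r; auto. apply C1. left.
    apply btw in Ht. rewrite !Rminus_0_r in Ht. auto. }
  assert (K2 : rcont (fun t => f (t, 0%R)) x x').
  { intros t Ht. apply ccont_hline. apply hol_cont with r; auto. apply C1. right.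
    apply btw in Ht. lra. }
  assert (K3 : rcont (fun s => f (x', s)) 0 y).
  { intros t Ht. apply ccont_vline. apply hol_cont with r; auto. apply D1; auto.
    unfold Rmin, Rmax; destruct (Rle_dec x x'); lra. }
  assert (K4 : rcont (fun s => f (x', s)) y y').
  { intros t Ht. apply ccont_vline. apply hol_cont with r; auto. apply D2; auto.
    apply btw in Ht. lra. }
  assert (K5 : rcont (fun t => f (t, y)) x x').
  { intros t Ht. apply ccont_hline. apply hol_cont with r; auto. apply D2. apply btw in Ht. lra.
    rewrite Rminus_diag, Rabs_R0. unfold h; apply Cmod_ge_0. }
  assert (E1 : cint (fun t => f (t, y)) x x' - RtoC (x' - x) * f (x, y) = cint (fun t => f (t, y) - f (x, y)) x x').
  { rewrite cint_minus; auto. rewrite cint_const. ring. intros t _. apply ccont_const. }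
  assert (E2 : cint (fun t => f (x', t)) y y' - RtoC (y' - y) * f (x, y) = cint (fun t => f (x', t) - f (x, y)) y y').
  { rewrite cint_minus; auto. rewrite cint_const. ring. intros t _. apply ccont_const. }
  cbn [Re Im fst snd].
  change (Re (x', y')) with x'. change (Im (x', y')) with y'. change (Re (x, y)) with x. change (Im (x, y)) with y.
  assert (W : ((x', y') : C) - (x, y) = RtoC (x' - x) + Ci * RtoC (y' - y)) by (apply C_eq; simpl; ring).
  rewrite W.
  match goal with |- Cmod ?X <= _ =>
    replace X with (cint (fun t => f (t, y) - f (x, y)) x x' + Ci * cint (fun t => f (x', t) - f (x, y)) y y') end.
  - assert (B1 : Cmod (cint (fun t => f (t, y) - f (x, y)) x x') <= 2 * (eps / 4) * Rabs (x' - x)).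
    { apply cint_bound_abs. intros t Ht. apply ccont_minus; auto. apply ccont_const.
      intros t Ht. left. apply D3. apply btw in Ht. lra. rewrite Rminus_diag, Rabs_R0. unfold h; apply Cmod_ge_0. }
    assert (B2 : Cmod (cint (fun t => f (x', t) - f (x, y)) y y') <= 2 * (eps / 4) * Rabs (y' - y)).
    { apply cint_bound_abs. intros t Ht. apply ccont_minus; auto. apply ccont_const.
      intros t Ht. left. apply D3; auto. apply btw in Ht. lra. }
    eapply Rle_trans. apply Cmod_triangle. rewrite Cmod_mult, Cmod_Ci, Rmult_1_l.
    assert (2 * (eps / 4) * Rabs (x' - x) <= 2 * (eps / 4) * h)%R by (apply Rmult_le_compat_l; lra).
    assert (2 * (eps / 4) * Rabs (y' - y) <= 2 * (eps / 4) * h)%R by (apply Rmult_le_compat_l; lra).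
    lra.
  - rewrite <- E1, <- E2.
    rewrite <- (cint_Chasles _ 0 x x') by auto. rewrite <- (cint_Chasles _ 0 y y') by auto.
    unfold rect_int in R1.
    replace (cint (fun t => f (t, y)) x x') with (cint (fun t => f (t, 0%R)) x x' + Ci * cint (fun s => f (x', s)) 0 y
       - Ci * cint (fun s => f (x, s)) 0 y).
    ring.
    match type of R1 with ?X = _ => replace (cint (fun t => f (t, y)) x x') with (cint (fun t => f (t, y)) x x' + X) end.
    ring. rewrite R1. ring.
Qed.

(** * Cauchy's integral formula on circles *)

Definition circ (rho t : R) : C := ((rho * cos t)%R, (rho * sin t)%R).

Lemma Cmod_circ rho t : 0 <= rho -> Cmod (circ rho t) = rho.
Proof.
  intros H. unfold Cmod, circ; simpl.
  replace (rho * cos t * (rho * cos t * 1) + rho * sin t * (rho * sin t * 1))%R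
    with (rho * rho * (Rsqr (sin t) + Rsqr (cos t)))%R by (unfold Rsqr; ring).
  rewrite sin2_cos2, Rmult_1_r. apply sqrt_square; auto.
Qed.

Lemma circ_period rho : circ rho (2 * PI) = circ rho 0.
Proof. unfold circ. rewrite cos_2PI, sin_2PI, cos_0, sin_0. auto. Qed.

Lemma rderiv_circ rho t : rderiv (circ rho) t (Ci * circ rho t).
Proof.
  split; simpl; apply is_derive_Reals.
  - replace (0 * (rho * cos t) - 1 * (rho * sin t))%R with (rho * - sin t)%R by ring.
    apply (derivable_pt_lim_scal cos). apply derivable_pt_lim_cos.
  - replace (0 * (rho * sin t) + 1 * (rho * cos t))%R with (rho * cos t)%R by ring.
    apply (derivable_pt_lim_scal sin). apply derivable_pt_lim_sin.
Qed.

Lemma ccont_circ rho t : ccont dR (circ rho) t.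
Proof. eapply rderiv_cont. apply rderiv_circ. Qed.

Lemma ccont_fst (g : R -> C) p : ccont dR g (fst p) -> ccont dRR (fun q : R * R => g (fst q)) p.
Proof.
  intros H eps He. destruct (H eps He) as [d [Hd H1]]. exists d. split; auto.
  intros y Hy. apply H1. rewrite dR_Rabs. eapply Rle_lt_trans; [apply Rmax_l | exact Hy].
Qed.

Lemma ccont_snd (g : R -> C) p : ccont dR g (snd p) -> ccont dRR (fun q : R * R => g (snd q)) p.
Proof.
  intros H eps He. destruct (H eps He) as [d [Hd H1]]. exists d. split; auto.
  intros y Hy. apply H1. rewrite dR_Rabs. eapply Rle_lt_trans; [apply Rmax_r | exact Hy].
Qed.

Lemma rderiv_of_real F s l : cderiv F (RtoC s) l -> rderiv (fun x => F (RtoC x)) s l.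
Proof.
  intros H. eapply rderiv_eq; [|apply (rderiv_comp F RtoC s l); [exact H | apply rderiv_RtoC]]. ring.
Qed.

(** Differentiation under the integral sign shows that the integral has derivative 0 in [s]. The
    margin [eta] makes neighbourhoods of the end points 0 and 1 available. *)
Lemma param_const_R (ph dph : R -> R -> R) (eta : R) : 0 < eta ->
  (forall s t, - eta < s < 1 + eta -> is_derive (fun x => ph x t) s (dph s t)) ->
  (forall s t, - eta < s < 1 + eta -> continuity_2d_pt dph s t) ->
  (forall s, - eta < s < 1 + eta -> ex_RInt (ph s) 0 (2 * PI)) ->
  (forall s, 0 <= s <= 1 -> RInt (dph s) 0 (2 * PI) = 0%R) ->
  RInt (ph 0%R) 0 (2 * PI) = RInt (ph 1%R) 0 (2 * PI).
Proof.
  intros He Hd Hc Hi H0.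
  assert (loc : forall s, - eta < s < 1 + eta -> locally s (fun x => - eta < x < 1 + eta)).
  { intros s Hs. assert (Hp : 0 < Rmin (s + eta) (1 + eta - s)) by (apply Rmin_glb_lt; lra).
    exists (mkposreal _ Hp). intros x Hx.
    assert (A : Rabs (x - s) < Rmin (s + eta) (1 + eta - s)) by exact Hx.
    apply Rabs_def2 in A. generalize (Rmin_l (s + eta) (1 + eta - s)) (Rmin_r (s + eta) (1 + eta - s)). lra. }
  assert (D : forall s, - eta < s < 1 + eta ->
     is_derive (fun x => RInt (fun t => ph x t) 0 (2 * PI)) s (RInt (fun t => Derive (fun u => ph u t) s) 0 (2 * PI))).
  { intros s Hs. apply is_derive_RInt_param.
    - apply (filter_imp (fun x => - eta < x < 1 + eta)); auto. intros x Hx t _. exists (dph x t). apply Hd; auto.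
    - intros t _. destruct (loc s Hs) as [d Hdl].
      apply continuity_2d_pt_ext_loc with dph; [|apply Hc; auto].
      exists d. intros u v Hu _. symmetry. apply is_derive_unique. apply Hd. apply Hdl. exact Hu.
    - apply (filter_imp (fun x => - eta < x < 1 + eta)); auto. }
  destruct (MVT_gen (fun x => RInt (fun t => ph x t) 0 (2 * PI)) 0 1
    (fun s => RInt (fun t => Derive (fun u => ph u t) s) 0 (2 * PI))) as [x [Hx E]].
  - rewrite Rmin_left, Rmax_right by lra. intros x Hx. apply D. lra.
  - rewrite Rmin_left, Rmax_right by lra. intros x Hx.
    apply continuity_pt_filterlim. apply (ex_derive_continuous (K := R_AbsRing) (V := R_NormedModule) (fun x => RInt (fun t => ph x t) 0 (2 * PI)) x).
    eexists. apply D. lra.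
  - rewrite Rmin_left, Rmax_right in Hx by lra.
    rewrite (RInt_ext (fun t => Derive (fun u => ph u t) x) (dph x)) in E.
    + rewrite H0 in E by lra. change (RInt (ph 1%R) 0 (2 * PI) - RInt (ph 0%R) 0 (2 * PI) = 0 * (1 - 0))%R in E. lra.
    + intros t _. apply is_derive_unique. apply Hd. lra.
Qed.

Lemma param_const (Psi dPsi : R -> R -> C) (eta : R) : 0 < eta ->
  (forall s t, - eta < s < 1 + eta -> rderiv (fun x => Psi x t) s (dPsi s t)) ->
  (forall s t, - eta < s < 1 + eta -> ccont dRR (fun p => dPsi (fst p) (snd p)) (s, t)) ->
  (forall s t, - eta < s < 1 + eta -> ccont dR (Psi s) t) ->
  (forall s, 0 <= s <= 1 -> cint (dPsi s) 0 (2 * PI) = 0) ->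
  cint (Psi 0%R) 0 (2 * PI) = cint (Psi 1%R) 0 (2 * PI).
Proof.
  intros He Hd Hc Hi H0. apply C_eq; unfold cint; simpl.
  - apply (param_const_R (fun s t => Re (Psi s t)) (fun s t => Re (dPsi s t)) eta); auto.
    + intros s t Hs. apply (proj1 (Hd s t Hs)).
    + intros s t Hs e. destruct (Hc s t Hs e (cond_pos e)) as [d [Hd1 H1]].
      exists (mkposreal d Hd1). intros u v Hu Hv.
      eapply Rle_lt_trans; [|apply (H1 (u, v))]. cbn [fst snd]. rewrite <- re_minus. apply re_le_Cmod.
      apply Rmax_lub_lt; auto.
    + intros s Hs. apply rcont_ex_Re. intros t _. auto.
    + intros s Hs. apply (f_equal Re (H0 s Hs)).
  - apply (param_const_R (fun s t => Im (Psi s t)) (fun s t => Im (dPsi s t)) eta); auto.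
    + intros s t Hs. apply (proj2 (Hd s t Hs)).
    + intros s t Hs e. destruct (Hc s t Hs e (cond_pos e)) as [d [Hd1 H1]].
      exists (mkposreal d Hd1). intros u v Hu Hv.
      eapply Rle_lt_trans; [|apply (H1 (u, v))]. cbn [fst snd]. rewrite <- im_minus. apply im_le_Cmod.
      apply Rmax_lub_lt; auto.
    + intros s Hs. apply rcont_ex_Im. intros t _. auto.
    + intros s Hs. apply (f_equal Im (H0 s Hs)).
Qed.

Lemma circ_neq rho t (w : C) : Cmod w < rho -> circ rho t - w <> 0.
Proof.
  intros H E. apply Ceq_minus in E. subst w. rewrite Cmod_circ in H.
  lra. generalize (Cmod_ge_0 (circ rho t)). lra.
Qed.

Lemma ccont_circ_inv rho t (w : C) : Cmod w < rho -> ccont dR (fun t => / (circ rho t - w)) t.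
Proof.
  intros H. apply ccont_inv. apply circ_neq; auto. apply ccont_minus. apply ccont_circ. apply ccont_const.
Qed.

Lemma ccont_circ_kernel rho t (w : C) : Cmod w < rho -> ccont dR (fun t => circ rho t / (circ rho t - w)) t.
Proof. intros H. apply ccont_mult. apply ccont_circ. apply ccont_circ_inv; auto. Qed.

Lemma cint_circ_deriv (g dg : R -> C) :
  (forall t, rderiv g t (dg t)) -> (forall t, ccont dR dg t) -> g (2 * PI)%R = g 0%R ->
  cint dg 0 (2 * PI) = 0.
Proof.
  intros H1 H2 H3. rewrite (cint_FTC g dg). rewrite H3. ring. auto. intros t _. auto.
Qed.

(** The pole [w] is moved to the centre along [s * w]; at [s = 0] the integrand is the constant
    1. *)
Lemma cint_cauchy_kernel rho (w : C) : Cmod w < rho ->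
  cint (fun t => circ rho t / (circ rho t - w)) 0 (2 * PI) = RtoC (2 * PI).
Proof.
  intros Hw. assert (Hr : 0 < rho) by (generalize (Cmod_ge_0 w); lra).
  set (eta := ((rho - Cmod w) / rho)%R).
  assert (He : 0 < eta) by (apply Rdiv_lt_0_compat; lra).
  assert (Hs : forall s, - eta < s < 1 + eta -> Cmod (RtoC s * w) < rho).
  { intros s Hs. rewrite Cmod_mult, Cmod_R.
    assert (Rabs s < 1 + eta) by (apply Rabs_def1; lra).
    destruct (Req_dec (Cmod w) 0) as [E|E]. rewrite E. lra.
    assert (0 < Cmod w) by (generalize (Cmod_ge_0 w); lra).
    apply Rlt_le_trans with ((1 + eta) * Cmod w)%R. apply Rmult_lt_compat_r; auto.
    unfold eta. replace ((1 + (rho - Cmod w) / rho) * Cmod w)%R with (rho - (rho - Cmod w) * (rho - Cmod w) / rho)%R by (field; lra).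
    assert (0 <= (rho - Cmod w) * (rho - Cmod w) / rho)%R.
    { apply Rmult_le_pos. apply Rmult_le_pos; lra. left; apply Rinv_0_lt_compat; auto. } lra. }
  assert (E := param_const (fun s t => circ rho t * / (circ rho t - RtoC s * w))
    (fun s t => circ rho t * w * (/ (circ rho t - RtoC s * w) * / (circ rho t - RtoC s * w))) eta He).
  assert (cont : forall s t, - eta < s < 1 + eta -> ccont dR (fun t => / (circ rho t - RtoC s * w)) t).
  { intros s t H. apply ccont_circ_inv; auto. }
  transitivity (cint (fun t => circ rho t * / (circ rho t - RtoC 1 * w)) 0 (2 * PI)).
  { apply cint_ext. intros. unfold Cdiv. do 2 f_equal. ring. }
  rewrite <- E.
  - rewrite (cint_ext _ (fun _ => RtoC 1)). rewrite cint_const. rewrite Rminus_0_r. ring.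
    intros t _. replace (circ rho t - 0 * w) with (circ rho t) by ring. apply Cinv_r.
    replace (circ rho t) with (circ rho t - 0) by ring. apply circ_neq. rewrite Cmod_0; auto.
  - intros s t H.
    eapply rderiv_eq; [|apply (rderiv_of_real (fun v => circ rho t * / (circ rho t - v * w)))].
    2: { apply cderiv_scal. apply (cderiv_inv (fun v => circ rho t - v * w)). apply circ_neq; auto.
         apply cderiv_minus. apply cderiv_const. apply cderiv_mult. apply cderiv_id. apply cderiv_const. }
    cbv beta. field. apply circ_neq; auto.
  - intros s t H. 
    assert (Z : ccont dRR (fun p => / (circ rho (snd p) - RtoC (fst p) * w)) (s, t)).
    { apply ccont_inv. apply circ_neq; auto. apply ccont_minus. apply ccont_snd. apply ccont_circ.
      apply ccont_mult. apply ccont_fst. eapply rderiv_cont. apply rderiv_RtoC. apply ccont_const. }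
    apply ccont_mult. apply ccont_mult. apply ccont_snd. apply ccont_circ. apply ccont_const.
    apply ccont_mult; auto.
  - intros s t H. apply ccont_mult. apply ccont_circ. apply cont; auto.
  (* The derivative of the kernel in [s] is also the derivative in [t] of a periodic function, so it
     integrates to 0. *)
  - intros s H. apply cint_circ_deriv with (fun t => (Ci * w) * / (circ rho t - RtoC s * w)).
    + intros t. eapply rderiv_eq; [|apply (rderiv_comp (fun v => (Ci * w) * / (v - RtoC s * w))); [|apply rderiv_circ]].
      2: { apply cderiv_scal. apply (cderiv_inv (fun v => v - RtoC s * w)). apply circ_neq; auto. apply Hs; lra.
           apply cderiv_minus. apply cderiv_id. apply cderiv_const. }
      cbv beta.
      assert (N : circ rho t - RtoC s * w <> 0) by (apply circ_neq; apply Hs; lra).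
      replace (Ci * w * (- (1 - 0) / ((circ rho t - RtoC s * w) * (circ rho t - RtoC s * w))) * (Ci * circ rho t))
        with (- (Ci * Ci) * (circ rho t * w * (/ (circ rho t - RtoC s * w) * / (circ rho t - RtoC s * w)))) by (field; auto).
      replace (Ci * Ci) with (- (1)) by (apply C_eq; simpl; ring). ring.
    + intros t. assert (H1 := cont s t ltac:(lra)). apply ccont_mult. apply ccont_mult. apply ccont_circ. apply ccont_const.
      apply ccont_mult; auto.
    + rewrite circ_period. auto.
Qed.

(** The circle is contracted to [w] along [pt s t], and again the [s]-derivative of the integrand is
    a [t]-derivative of a periodic function. A continuous derivative [f] is assumed because the
    continuity of the derivative of a holomorphic function is only established afterwards. *)
Lemma cauchy_C1 r rho F f (w : C) : rho < r -> Cmod w < rho ->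
  (forall z, Cmod z < r -> cderiv F z (f z)) -> (forall z, Cmod z < r -> ccont dC f z) ->
  cint (fun t => F (circ rho t) * (circ rho t / (circ rho t - w))) 0 (2 * PI) = RtoC (2 * PI) * F w.
Proof.
  intros Hr Hw HF Hf.
  assert (Hrho : 0 < rho) by (generalize (Cmod_ge_0 w); lra).
  set (eta := ((r - rho) / (4 * rho))%R).
  assert (He : 0 < eta) by (apply Rdiv_lt_0_compat; lra).
  assert (eta_r : (2 * eta * rho = (r - rho) / 2)%R) by (unfold eta; field; lra).
  set (pt := fun s t => w + RtoC s * (circ rho t - w)).
  assert (Hs : forall s t, - eta < s < 1 + eta -> Cmod (pt s t) < r).
  { intros s t H. unfold pt.
    replace (w + RtoC s * (circ rho t - w)) with (RtoC (1 - s) * w + RtoC s * circ rho t) by (rewrite RtoC_minus; ring).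
    eapply Rle_lt_trans. apply Cmod_triangle. rewrite !Cmod_mult, !Cmod_R, Cmod_circ by lra.
    assert (Rabs (1 - s) * Cmod w <= Rabs (1 - s) * rho)%R by (apply Rmult_le_compat_l; [apply Rabs_pos | lra]).
    assert (Rabs (1 - s) + Rabs s <= 1 + 2 * eta).
    { unfold Rabs. destruct (Rcase_abs (1 - s)), (Rcase_abs s); lra. }
    assert ((Rabs (1 - s) + Rabs s) * rho <= (1 + 2 * eta) * rho)%R by (apply Rmult_le_compat_r; lra).
    lra. }
  assert (cpt : forall s t, ccont dR (pt s) t).
  { intros. unfold pt. apply ccont_plus. apply ccont_const. apply ccont_mult. apply ccont_const.
    apply ccont_minus. apply ccont_circ. apply ccont_const. }
  assert (ck : forall t, ccont dR (fun t => circ rho t / (circ rho t - w)) t).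
  { intros. apply ccont_circ_kernel; auto. }
  assert (E := param_const (fun s t => F (pt s t) * (circ rho t / (circ rho t - w)))
     (fun s t => f (pt s t) * circ rho t) eta He).
  transitivity (cint (fun t => F (pt 1%R t) * (circ rho t / (circ rho t - w))) 0 (2 * PI)).
  { apply cint_ext. intros t _. do 2 f_equal. unfold pt. ring. }
  rewrite <- E; clear E.
  - rewrite (cint_ext _ (fun t => F w * (circ rho t / (circ rho t - w)))).
    rewrite cint_scal, cint_cauchy_kernel; auto. ring. intros t _; auto.
    intros t _. do 2 f_equal. unfold pt. ring.
  - intros s t H.
    eapply rderiv_eq; [|apply (rderiv_of_real (fun v => F (w + v * (circ rho t - w)) * (circ rho t / (circ rho t - w))))].
    2: { apply cderiv_mult; [|apply cderiv_const]. apply (cderiv_comp F (fun v => w + v * (circ rho t - w))).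
         apply HF. apply Hs; auto.
         apply cderiv_plus. apply cderiv_const. apply cderiv_mult. apply cderiv_id. apply cderiv_const. }
    cbv beta. fold (pt s t). field. apply circ_neq; auto.
  - intros s t H. apply ccont_mult; [|apply ccont_snd; apply ccont_circ].
    apply (ccont_comp dRR (fun p => pt (fst p) (snd p))).
    + unfold pt. apply ccont_plus. apply ccont_const. apply ccont_mult. apply ccont_fst. eapply rderiv_cont. apply rderiv_RtoC.
      apply ccont_minus. apply ccont_snd. apply ccont_circ. apply ccont_const.
    + apply (Hf (pt s t)). apply Hs; auto.
  - intros s t H. apply ccont_mult; auto. apply (ccont_comp dR (pt s)); auto.
    apply (cderiv_cont F _ (f (pt s t))). apply HF. apply Hs; auto.
  - intros s H.
    assert (cd : forall t, ccont dR (fun t => f (pt s t) * circ rho t) t).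
    { intros t. apply ccont_mult; [|apply ccont_circ]. apply (ccont_comp dR (pt s)); auto. apply (Hf (pt s t)). apply Hs; lra. }
    (* The periodic antiderivative [- Ci / s * F (pt s t)] is undefined at [s = 0]; there [pt] is
       constantly [w] and a multiple of [circ] serves instead. *)
    destruct (Req_dec s 0) as [E0|E0].
    + apply cint_circ_deriv with (fun t => - Ci * f w * circ rho t); auto.
      * intros t. eapply rderiv_eq; [|apply rderiv_scal; apply rderiv_circ].
        replace (pt s t) with w by (unfold pt; rewrite E0; ring).
        replace (- Ci * f w * (Ci * circ rho t)) with (- (Ci * Ci) * (f w * circ rho t)) by ring.
        replace (Ci * Ci) with (- (1)) by (apply C_eq; simpl; ring). ring.
      * rewrite circ_period; auto.
    + apply cint_circ_deriv with (fun t => (- Ci / RtoC s) * F (pt s t)); auto.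
      * intros t. eapply rderiv_eq; [|apply rderiv_scal; apply (rderiv_comp F); [apply HF; apply Hs; lra|]].
        2: { unfold pt. apply rderiv_plus. apply rderiv_const. apply rderiv_scal. apply rderiv_plus.
             apply rderiv_circ. apply rderiv_const. }
        cbv beta.
        assert (RtoC s <> 0) by (intros X; apply RtoC_inj in X; auto).
        replace (- Ci / RtoC s * (f (pt s t) * (0 + RtoC s * (Ci * circ rho t + 0)))) with (- (Ci * Ci) * (f (pt s t) * circ rho t)) by (field; auto).
        replace (Ci * Ci) with (- (1)) by (apply C_eq; simpl; ring). ring.
      * unfold pt. rewrite circ_period; auto.
Qed.

(** Here [x], [y] stand for [1/(u - w)], [1/(u - v)] and [h] for [v - w]; the relation
    [y - x = h * x * y] is the resolvent identity. The constant [M] depends only on [m] and [B],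
    which makes the expansion uniform along a circle. *)
Lemma inv_pow_taylor (m : nat) (B : R) : 0 <= B -> exists M : R, 0 <= M /\
  forall x y h : C, Cmod x <= B -> Cmod y <= B -> y - x = h * x * y ->
    Cmod (y ^ m - x ^ m - RtoC (INR m) * h * x ^ S m) <= M * (Cmod h * Cmod h).
Proof.
  intros HB. induction m.
  - exists 0%R. split. lra. intros. change (INR 0) with 0%R.
    replace (y ^ 0 - x ^ 0 - 0 * h * x ^ 1) with (RtoC 0) by (simpl; ring). rewrite Cmod_0. lra.
  - destruct IHm as [M [HM IH]].
    exists (B * M + INR (S m) * (B ^ (S (S m)) * B))%R. split.
    { apply Rplus_le_le_0_compat. apply Rmult_le_pos; auto. apply Rmult_le_pos. apply pos_INR.
      apply Rmult_le_pos; auto. apply pow_le; auto. }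
    intros x y h Hx Hy E.
    assert (Q : y ^ S m - x ^ S m - RtoC (INR (S m)) * h * x ^ S (S m) =
      y * (y ^ m - x ^ m - RtoC (INR m) * h * x ^ S m) + RtoC (INR (S m)) * (h * h) * (x ^ S (S m) * y)).
    { rewrite S_INR, RtoC_plus, !Cpow_S.
      set (N := RtoC (INR m)). set (X := x ^ m). set (Y := y ^ m).
      apply Ceq_minus.
      match goal with |- ?L = RtoC 0 => replace L with ((X + N * h * x * X + h * x * X) * ((y - x) - h * x * y)) by ring end.
      rewrite E. ring. }
    rewrite Q. eapply Rle_trans. apply Cmod_triangle. rewrite !Cmod_mult, Cmod_R, Cmod_pow.
    rewrite (Rabs_right (INR (S m))) by (apply Rle_ge; apply pos_INR).
    specialize (IH x y h Hx Hy E).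
    assert (0 <= Cmod h * Cmod h)%R by (apply Rmult_le_pos; apply Cmod_ge_0).
    rewrite Rmult_plus_distr_r. apply Rplus_le_compat.
    + rewrite Rmult_assoc. apply Rmult_le_compat; auto; apply Cmod_ge_0.
    + rewrite Rmult_assoc. rewrite (Rmult_assoc (INR (S m)) (B ^ S (S m) * B)). apply Rmult_le_compat_l. apply pos_INR.
      rewrite Rmult_comm. apply Rmult_le_compat_r; auto. apply Rmult_le_compat; auto; try apply Cmod_ge_0.
      apply pow_le; apply Cmod_ge_0. apply pow_incr. split; auto. apply Cmod_ge_0.
Qed.

Lemma ccont_Cmod (g : R -> C) t : ccont dR g t -> continuity_pt (fun s => Cmod (g s)) t.
Proof.
  intros H eps He. destruct (H eps He) as [d [Hd H1]]. exists d. split; auto.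
  intros x [_ Hx]. eapply Rle_lt_trans; [|apply (H1 x); rewrite dR_Rabs; exact Hx].
  simpl. unfold Rdist. apply Rabs_le.
  assert (A := Cmod_minus_ge (g x) (g t)). assert (B := Cmod_minus_ge (g t) (g x)).
  rewrite (Cmod_minus_sym (g t)) in B. lra.
Qed.

Lemma ccont_bounded (g : R -> C) a b : a <= b -> rcont g a b ->
  exists M : R, 0 <= M /\ forall t, a <= t <= b -> Cmod (g t) <= M.
Proof.
  intros Hab Hg. destruct (continuity_ab_maj (fun t => Cmod (g t)) a b Hab) as [m [H1 H2]].
  - intros c Hc. apply ccont_Cmod. apply Hg. rewrite Rmin_left, Rmax_right; auto.
  - exists (Cmod (g m)). split. apply Cmod_ge_0. auto.
Qed.

(** The second-order expansion of the kernel is uniform in [t], so it can be integrated. Each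
    application raises the exponent of the kernel by one, which is how holomorphic functions acquire
    further derivatives. *)
Lemma cint_kernel_deriv (ph : R -> C) m rho (w : C) : (forall t, ccont dR ph t) -> Cmod w < rho ->
  cderiv (fun v => cint (fun t => ph t * (/ (circ rho t - v)) ^ m) 0 (2 * PI)) w
    (RtoC (INR m) * cint (fun t => ph t * (/ (circ rho t - w)) ^ S m) 0 (2 * PI)).
Proof.
  intros Hph Hw eps He.
  assert (HPI := PI_RGT_0).
  assert (Hrho : 0 <= rho) by (generalize (Cmod_ge_0 w); lra).
  set (del := ((rho - Cmod w) / 2)%R). assert (Hdel : 0 < del) by (unfold del; lra).
  assert (HB : 0 <= / del) by (left; apply Rinv_0_lt_compat; auto).
  destruct (inv_pow_taylor m (/ del) HB) as [M [HM HT]].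
  destruct (ccont_bounded ph 0 (2 * PI)) as [A [HA HAb]]. lra. intros t _; auto.
  (* The integrated error is [(K - 1) * h^2]; the extra 1 keeps [K] positive. *)
  set (K := (2 * (A * M) * (2 * PI) + 1)%R).
  assert (HK : 0 < K).
  { unfold K. assert (0 <= 2 * (A * M) * (2 * PI))%R. apply Rmult_le_pos; [|lra]. apply Rmult_le_pos. lra.
    apply Rmult_le_pos; auto. lra. }
  exists (Rmin del (eps / K)). split. apply Rmin_glb_lt; auto. apply Rdiv_lt_0_compat; auto.
  intros v Hv.
  assert (V1 := Rlt_le_trans _ _ _ Hv (Rmin_l _ _)).
  assert (V2 := Rlt_le_trans _ _ _ Hv (Rmin_r _ _)).
  assert (Hvr : Cmod v < rho - del).
  { assert (Z := Cmod_minus_ge v w). unfold del in *. lra. }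
  assert (Hvr2 : Cmod v < rho) by lra.
  assert (ck : forall k (u : C) t, Cmod u < rho -> ccont dR (fun t => (/ (circ rho t - u)) ^ k) t).
  { intros k u t Hu. apply ccont_pow. apply ccont_circ_inv; auto. }
  assert (ck2 : forall k (u : C), Cmod u < rho -> rcont (fun t => ph t * (/ (circ rho t - u)) ^ k) 0 (2 * PI)).
  { intros k u Hu t _. apply ccont_mult; auto. }
  assert (inv_bd : forall u t, Cmod u < rho - del -> Cmod (/ (circ rho t - u)) <= / del).
  { intros u t Hu. rewrite Cmod_inv by (apply circ_neq; lra). apply Rinv_le_contravar; auto.
    assert (Z := Cmod_minus_ge (circ rho t) u). rewrite Cmod_circ in Z by auto. lra. }
  match goal with |- Cmod ?X <= _ => replace X with
    (cint (fun t => ph t * (/ (circ rho t - v)) ^ m - ph t * (/ (circ rho t - w)) ^ m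
      - (RtoC (INR m) * (v - w)) * (ph t * (/ (circ rho t - w)) ^ S m)) 0 (2 * PI)) end.
  - eapply Rle_trans. apply cint_bound with (M := (A * (M * (Cmod (v - w) * Cmod (v - w))))%R). lra.
    + intros t _. apply ccont_minus. apply ccont_minus; apply ccont_mult; auto. apply ccont_mult. apply ccont_const.
      apply ccont_mult; auto.
    + intros t Ht. 
      replace (ph t * (/ (circ rho t - v)) ^ m - ph t * (/ (circ rho t - w)) ^ m - (RtoC (INR m) * (v - w)) * (ph t * (/ (circ rho t - w)) ^ S m))
        with (ph t * ((/ (circ rho t - v)) ^ m - (/ (circ rho t - w)) ^ m - RtoC (INR m) * (v - w) * (/ (circ rho t - w)) ^ S m)) by ring.
      rewrite Cmod_mult. apply Rmult_le_compat; try apply Cmod_ge_0. auto.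
      apply HT. apply inv_bd; unfold del; lra. apply inv_bd; auto.
      field. split; apply circ_neq; auto.
    + set (h := Cmod (v - w)) in *. assert (0 <= h) by apply Cmod_ge_0.
      replace (2 * (A * (M * (h * h))) * (2 * PI - 0))%R with ((K - 1) * h * h)%R by (unfold K; ring).
      apply Rmult_le_compat_r; auto.
      apply Rle_trans with (K * h)%R. apply Rmult_le_compat_r; lra.
      apply Rmult_le_reg_r with (/ K)%R. apply Rinv_0_lt_compat; auto.
      replace (K * h * / K)%R with h by (field; lra). left. exact V2.
  - rewrite cint_minus. rewrite cint_minus; auto. rewrite cint_scal; auto. ring.
    intros t _. apply ccont_minus; apply ccont_mult; auto.
    intros t _. apply ccont_mult. apply ccont_const. apply ccont_mult; auto.
Qed.

(** A primitive [F] of [f] has the continuous derivative [f], so the formula for continuously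
    differentiable functions applies to [F]. Differentiating it once represents [f] with a kernel of
    exponent 2, without any knowledge of [f']. *)
Lemma hol_local_kernel r f rho : hol r f -> 0 <= rho < r -> exists ph : R -> C,
  (forall t, ccont dR ph t) /\
  forall w, Cmod w < rho -> f w = cint (fun t => ph t * (/ (circ rho t - w)) ^ 2) 0 (2 * PI).
Proof.
  intros Hf [Hr0 Hr]. assert (HPI := PI_RGT_0).
  destruct (hol_primitive r f Hf) as [F HF].
  assert (N2 : RtoC (2 * PI) <> 0) by (intros X; apply RtoC_inj in X; lra).
  set (ph := fun t => / RtoC (2 * PI) * (F (circ rho t) * circ rho t)).
  assert (cph : forall t, ccont dR ph t).
  { intros t. unfold ph. apply ccont_mult. apply ccont_const. apply ccont_mult; [|apply ccont_circ].
    apply (ccont_comp dR (circ rho)). apply ccont_circ. apply (cderiv_cont F _ (f (circ rho t))). apply HF.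
    rewrite Cmod_circ; auto. }
  assert (E : forall w, Cmod w < rho -> F w = cint (fun t => ph t * (/ (circ rho t - w)) ^ 1) 0 (2 * PI)).
  { intros w Hw.
    assert (cF : forall t, ccont dR (fun t => F (circ rho t) * (circ rho t / (circ rho t - w))) t).
    { intros t. apply ccont_mult. apply (ccont_comp dR (circ rho)). apply ccont_circ.
      apply (cderiv_cont F _ (f (circ rho t))). apply HF. rewrite Cmod_circ; auto.
      apply ccont_circ_kernel; auto. }
    assert (X := cauchy_C1 r rho F f w Hr Hw HF ltac:(intros; apply hol_cont with r; auto)).
    transitivity (/ RtoC (2 * PI) * (RtoC (2 * PI) * F w)). field; auto.
    rewrite <- X, <- cint_scal by (intros t _; auto).
    apply cint_ext. intros t _. unfold ph. rewrite Cpow_1_r. unfold Cdiv. ring. }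
  exists ph. split; auto. intros w Hw.
  assert (D1 := cint_kernel_deriv ph 1 rho w cph Hw).
  apply cderiv_uniq with F w. apply HF; lra.
  eapply cderiv_eq; [|eapply cderiv_local with (r := (rho - Cmod w)%R); [lra| |exact D1]].
  - change (INR 1) with 1%R. ring.
  - intros v Hv. cbv beta. symmetry. apply E. assert (Z := Cmod_minus_ge v w). lra.
Qed.

Lemma hol_cderiv r f z : hol r f -> Cmod z < r -> cderiv f z (C_derive f z).
Proof. intros H Hz. destruct (H z Hz) as [l Hl]. rewrite (cderiv_unique_C _ _ _ Hl). auto. Qed.

(** The kernel of exponent 2 for [f] gives one of exponent 3 for the derivative, which is again
    differentiable. *)
Lemma hol_derive r f : hol r f -> hol r (C_derive f).
Proof.
  intros Hf z Hz. set (rho := ((Cmod z + r) / 2)%R).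
  destruct (hol_local_kernel r f rho Hf) as [ph [cph E]].
  { unfold rho. generalize (Cmod_ge_0 z). lra. }
  eexists. apply cderiv_local with (r := (rho - Cmod z)%R)
    (f := fun v => RtoC (INR 2) * cint (fun t => ph t * (/ (circ rho t - v)) ^ 3) 0 (2 * PI)).
  - unfold rho; lra.
  - intros w Hw. symmetry. apply cderiv_unique_C.
    assert (Hwr : Cmod w < rho) by (assert (Z := Cmod_minus_ge w z); lra).
    apply cderiv_local with (r := (rho - Cmod w)%R) (f := fun v => cint (fun t => ph t * (/ (circ rho t - v)) ^ 2) 0 (2 * PI)).
    lra. intros v Hv. symmetry. apply E. assert (Z := Cmod_minus_ge v w). lra.
    apply cint_kernel_deriv; auto.
  - apply cderiv_scal. apply cint_kernel_deriv; auto. unfold rho; lra.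
Qed.

Lemma hol_circ_cont r f rho t : hol r f -> 0 <= rho < r -> ccont dR (fun t => f (circ rho t)) t.
Proof.
  intros Hf Hr. apply (ccont_comp dR (circ rho)). apply ccont_circ. apply (hol_cont r); auto. rewrite Cmod_circ; lra.
Qed.

Lemma cauchy r rho f (w : C) : hol r f -> rho < r -> Cmod w < rho ->
  cint (fun t => f (circ rho t) * (circ rho t / (circ rho t - w))) 0 (2 * PI) = RtoC (2 * PI) * f w.
Proof.
  intros Hf Hr Hw. apply cauchy_C1 with r (C_derive f); auto.
  - intros. apply hol_cderiv with r; auto.
  - intros. apply hol_cont with r; auto. apply hol_derive; auto.
Qed.

Lemma cauchy_deriv r rho f (w : C) : hol r f -> rho < r -> Cmod w < rho ->
  cint (fun t => f (circ rho t) * (circ rho t * (/ (circ rho t - w)) ^ 2)) 0 (2 * PI) = RtoC (2 * PI) * C_derive f w.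
Proof.
  intros Hf Hr Hw.
  assert (Hrho : 0 <= rho) by (generalize (Cmod_ge_0 w); lra).
  set (ph := fun t => f (circ rho t) * circ rho t).
  assert (cph : forall t, ccont dR ph t).
  { intros t. apply ccont_mult. apply hol_circ_cont with r; auto; lra. apply ccont_circ. }
  assert (D1 := cint_kernel_deriv ph 1 rho w cph Hw).
  transitivity (RtoC (INR 1) * cint (fun t => ph t * (/ (circ rho t - w)) ^ 2) 0 (2 * PI)).
  { change (INR 1) with 1%R. rewrite Cmult_1_l. apply cint_ext. intros. unfold ph. ring. }
  apply cderiv_uniq with (f := fun v => RtoC (2 * PI) * f v) (z := w).
  - apply cderiv_local with (r := (rho - Cmod w)%R) (3 := D1). lra.
    intros v Hv. assert (Hv' : Cmod v < rho) by (assert (Z := Cmod_minus_ge v w); lra).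
    rewrite <- (cauchy r rho f v Hf Hr Hv'). apply cint_ext. intros t _. unfold ph. rewrite Cpow_1_r. unfold Cdiv. ring.
  - apply cderiv_scal. apply hol_cderiv with r; auto. lra.
Qed.

Lemma hol_pow r f n : hol r f -> hol r (fun z => f z ^ n).
Proof. intros Hf z Hz. destruct (Hf z Hz). eexists. apply cderiv_pow; eauto. Qed.

Lemma cauchy_bound r rho f (w : C) M : hol r f -> rho < r -> Cmod w < rho ->
  (forall t, 0 <= t <= 2 * PI -> Cmod (f (circ rho t)) <= M) -> Cmod (f w) <= 2 * (rho / (rho - Cmod w)) * M.
Proof.
  intros Hf Hr Hw HM. assert (HPI := PI_RGT_0).
  assert (Hrho : 0 < rho) by (generalize (Cmod_ge_0 w); lra).
  assert (X := f_equal Cmod (cauchy r rho f w Hf Hr Hw)).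
  rewrite Cmod_mult, Cmod_R, Rabs_right in X by lra.
  assert (B : Cmod (cint (fun t => f (circ rho t) * (circ rho t / (circ rho t - w))) 0 (2 * PI)) <=
    2 * (M * (rho / (rho - Cmod w))) * (2 * PI - 0)).
  { apply cint_bound. lra.
    - intros t _. apply ccont_mult. apply hol_circ_cont with r; auto; lra.
      apply ccont_circ_kernel; auto.
    - intros t Ht. rewrite Cmod_mult, Cmod_div, Cmod_circ by (try lra; apply circ_neq; auto).
      apply Rmult_le_compat. apply Cmod_ge_0. apply Rmult_le_pos. lra. left; apply Rinv_0_lt_compat. apply Cmod_gt_0. apply circ_neq; auto.
      apply HM; auto.
      apply Rmult_le_compat_l. lra. apply Rinv_le_contravar. lra.
      assert (Z := Cmod_minus_ge (circ rho t) w). rewrite Cmod_circ in Z by lra. lra. }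
  rewrite X in B. apply Rmult_le_reg_l with (2 * PI)%R. lra. lra.
Qed.

(* Applying the crude Cauchy bound to the powers of [f] and taking roots removes the constant. *)
Lemma max_principle r rho f (w : C) M : hol r f -> rho < r -> Cmod w < rho ->
  (forall t, 0 <= t <= 2 * PI -> Cmod (f (circ rho t)) <= M) -> Cmod (f w) <= M.
Proof.
  intros Hf Hr Hw HM.
  assert (Hrho : 0 < rho) by (generalize (Cmod_ge_0 w); lra).
  assert (HM0 : 0 <= M).
  { eapply Rle_trans; [|apply (HM 0%R)]. apply Cmod_ge_0. generalize PI_RGT_0; lra. }
  set (K := (2 * (rho / (rho - Cmod w)))%R).
  assert (P : forall n, (Cmod (f w) ^ n <= K * M ^ n)%R).
  { intros n. rewrite <- Cmod_pow. apply (cauchy_bound r rho (fun z => f z ^ n)); auto. apply hol_pow; auto.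
    intros t Ht. rewrite Cmod_pow. apply pow_incr. split. apply Cmod_ge_0. auto. }
  destruct (Rle_dec (Cmod (f w)) M) as [|Hn]; auto. exfalso. apply Rnot_le_lt in Hn.
  destruct (Req_dec M 0) as [E|E].
  - specialize (P 1%nat). rewrite E in *. simpl in P. lra.
  - assert (Hq : 1 < Cmod (f w) / M).
    { apply Rmult_lt_reg_r with M. lra. unfold Rdiv. rewrite Rmult_assoc, Rinv_l by auto. lra. }
    destruct (Pow_x_infinity (Cmod (f w) / M)) with (b := (K + 1)%R) as [N HN].
    rewrite Rabs_right; lra.
    specialize (HN N (Nat.le_refl N)). specialize (P N).
    unfold Rdiv in HN. rewrite Rpow_mult_distr, pow_inv in HN.
    assert (HMN : 0 < M ^ N) by (apply pow_lt; lra).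
    rewrite Rabs_right in HN.
    2: { apply Rle_ge. apply Rmult_le_pos. apply pow_le; apply Cmod_ge_0. left. apply Rinv_0_lt_compat; auto. }
    apply Rge_le in HN. apply Rmult_le_compat_r with (r := (M ^ N)%R) in HN; [|lra].
    rewrite Rmult_assoc, Rinv_l, Rmult_1_r in HN by lra. lra.
Qed.

(** * Entire functions *)

Lemma entire_intro f : (forall z, exists l, cderiv f z l) -> entire f.
Proof. intros H z. apply ex_derive_cderiv. auto. Qed.

Lemma entire_hol r f : entire f -> hol r f.
Proof. intros H z _. apply ex_derive_cderiv. auto. Qed.

Lemma entire_cderiv f z : entire f -> cderiv f z (C_derive f z).
Proof. intros H. apply hol_cderiv with (Cmod z + 1)%R. apply entire_hol; auto. lra. Qed.

Lemma entire_derive f : entire f -> entire (C_derive f).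
Proof.
  intros H. apply entire_intro. intros z. apply (hol_derive (Cmod z + 1)). apply entire_hol; auto. lra.
Qed.

Lemma entire_const c : entire (fun _ => c).
Proof. apply entire_intro. intros. eexists. apply cderiv_const. Qed.

Lemma entire_id : entire (fun z => z).
Proof. apply entire_intro. intros. eexists. apply cderiv_id. Qed.

Lemma entire_plus f g : entire f -> entire g -> entire (fun z => f z + g z).
Proof. intros Hf Hg. apply entire_intro. intros. eexists. apply cderiv_plus; apply entire_cderiv; auto. Qed.

Lemma entire_minus f g : entire f -> entire g -> entire (fun z => f z - g z).
Proof. intros Hf Hg. apply entire_intro. intros. eexists. apply cderiv_minus; apply entire_cderiv; auto. Qed.

Lemma entire_mult f g : entire f -> entire g -> entire (fun z => f z * g z).
Proof. intros Hf Hg. apply entire_intro. intros. eexists. apply cderiv_mult; apply entire_cderiv; auto. Qed.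

Lemma entire_pow f n : entire f -> entire (fun z => f z ^ n).
Proof. intros Hf. apply entire_intro. intros. eexists. apply cderiv_pow; apply entire_cderiv; auto. Qed.

Lemma entire_comp f g : entire f -> entire g -> entire (fun z => f (g z)).
Proof. intros Hf Hg. apply entire_intro. intros. eexists. apply cderiv_comp; apply entire_cderiv; auto. Qed.

Lemma entire_Qprod l : entire (Qprod l).
Proof.
  induction l; simpl. apply entire_const. apply (entire_mult (fun z => z - a) (Qprod l)); auto.
  apply entire_minus. apply entire_id. apply entire_const.
Qed.

Lemma entire_shift f c : entire f -> entire (fun z => f (z + c)).
Proof. intros H. apply (entire_comp f (fun z => z + c)); auto. apply entire_plus. apply entire_id. apply entire_const. Qed.

Lemma entire_max f rho (w : C) M : entire f -> Cmod w <= rho ->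
  (forall z, Cmod z = rho -> Cmod (f z) <= M) -> Cmod (f w) <= M.
Proof.
  intros Hf [Hw|Hw] HM; auto. apply max_principle with (rho + 1)%R rho; auto. apply entire_hol; auto. lra.
  intros t _. apply HM. apply Cmod_circ. generalize (Cmod_ge_0 w); lra.
Qed.

Lemma entire_bounded f rho : entire f -> 0 <= rho -> exists M : R, 0 <= M /\ forall z, Cmod z <= rho -> Cmod (f z) <= M.
Proof.
  intros Hf Hr. assert (HPI := PI_RGT_0).
  destruct (ccont_bounded (fun t => f (circ (rho + 1) t)) 0 (2 * PI)) as [M [HM HB]]. lra.
  { intros t _. apply hol_circ_cont with (rho + 2)%R. apply entire_hol; auto. lra. }
  exists M. split; auto. intros z Hz. apply max_principle with (rho + 2)%R (rho + 1)%R; auto; try lra. apply entire_hol; auto.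
Qed.

(** A removable singularity without power series: subtracting Cauchy's formulas at [w] and at 0
    gives [f w = w * K w], where [K] is a Cauchy-type integral over the unit circle and hence
    differentiable at 0. *)
Lemma entire_div0 f : entire f -> f 0 = 0 -> exists g, entire g /\ forall z, f z = z * g z.
Proof.
  intros Hf H0. assert (HPI := PI_RGT_0).
  assert (N2 : RtoC (2 * PI) <> 0) by (intros X; apply RtoC_inj in X; lra).
  set (K := fun w => cint (fun t => (/ RtoC (2 * PI) * f (circ 1 t)) * (/ (circ 1 t - w)) ^ 1) 0 (2 * PI)).
  assert (Hh : hol 2 f) by (apply entire_hol; auto).
  assert (cf : forall t, ccont dR (fun t => f (circ 1 t)) t).
  { intros t. apply hol_circ_cont with 2%R; auto. lra. }
  assert (E : forall w, Cmod w < 1 -> f w = w * K w).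
  { intros w Hw.
    assert (A := cauchy 2 1 f w Hh ltac:(lra) Hw).
    assert (B := cauchy 2 1 f 0 Hh ltac:(lra) ltac:(rewrite Cmod_0; lra)).
    assert (ck : forall u : C, Cmod u < 1 -> forall t, ccont dR (fun t => circ 1 t / (circ 1 t - u)) t).
    { intros u Hu t. apply ccont_circ_kernel; auto. }
    assert (c0 : Cmod 0 < 1) by (rewrite Cmod_0; lra).
    unfold K. rewrite <- cint_scal.
    transitivity (/ RtoC (2 * PI) * (RtoC (2 * PI) * f w - RtoC (2 * PI) * f 0)).
    { rewrite H0. field; auto. }
    rewrite <- A, <- B, <- cint_minus, <- cint_scal.
    - apply cint_ext. intros t _. rewrite Cpow_1_r. field. split; [|split]; auto.
      apply circ_neq; auto. replace (circ 1 t) with (circ 1 t - 0) by ring. apply circ_neq; auto.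
    - intros t _. apply ccont_minus; apply ccont_mult; auto.
    - intros t _. apply ccont_mult; auto.
    - intros t _. apply ccont_mult; auto.
    - intros t _. apply ccont_mult. apply ccont_mult; auto. apply ccont_const. apply ccont_pow.
      apply ccont_circ_inv; auto. }
  set (g := fun z => if Ceq_dec z 0 then K 0 else f z / z).
  assert (gE : forall z : C, z <> 0 -> g z = f z / z).
  { intros z Hz. unfold g. destruct (Ceq_dec z 0); auto. contradiction. }
  exists g. split.
  - apply entire_intro. intros z. destruct (Ceq_dec z 0) as [->|Hz].
    + eexists. apply cderiv_local with (f := K) (r := 1%R). lra.
      * intros w Hw. unfold g. destruct (Ceq_dec w 0) as [->|Hw0]; auto.
        replace (w - 0) with w in Hw by ring. rewrite (E w Hw). field; auto.
      * apply (cint_kernel_deriv (fun t => / RtoC (2 * PI) * f (circ 1 t)) 1 1 0).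
        intros t. apply ccont_mult; auto. apply ccont_const. rewrite Cmod_0; lra.
    + eexists. apply cderiv_local with (f := fun w => f w * / w) (r := Cmod z). apply Cmod_gt_0; auto.
      * intros w Hw. rewrite gE. reflexivity. intros ->. replace (0 - z) with (- z) in Hw by ring. rewrite Cmod_opp in Hw. lra.
      * apply cderiv_mult. apply entire_cderiv; auto. apply (cderiv_inv (fun w => w)); auto. apply cderiv_id.
  - intros z. destruct (Ceq_dec z 0) as [->|Hz]. rewrite H0. ring. rewrite gE by auto. field; auto.
Qed.

Lemma entire_div f z0 : entire f -> f z0 = 0 -> exists g, entire g /\ forall z, f z = (z - z0) * g z.
Proof.
  intros Hf H0. destruct (entire_div0 (fun z => f (z + z0))) as [g [Hg E]].
  - apply entire_shift; auto.
  - rewrite Cplus_0_l; auto.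
  - exists (fun z => g (z + - z0)). split. apply entire_shift; auto. intros z. specialize (E (z - z0)).
    replace (z - z0 + z0) with z in E by ring. exact E.
Qed.

(** Dividing [f - f 0] by [z] lowers the exponent by one; the base case is Liouville's theorem,
    obtained from the maximum principle for the quotient. *)
Lemma poly_growth f d (K r1 : R) : entire f -> (forall z, r1 <= Cmod z -> Cmod (f z) <= K * Cmod z ^ d) ->
  exists l, forall z, f z = peval l z.
Proof.
  revert f K r1. induction d; intros f K r1 Hf HB.
  - destruct (entire_div0 (fun z => f z - f 0)) as [g [Hg E]].
    apply entire_minus; auto. apply entire_const. ring.
    exists [f 0]. intros z. simpl.
    assert (B : forall w, Cmod (f w) <= K).
    { intros w. apply entire_max with (Rmax (Cmod w) r1); auto. apply Rmax_l.
      intros v Hv. specialize (HB v). rewrite Hv in HB. simpl in HB. rewrite Rmult_1_r in HB. apply HB. apply Rmax_r. }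
    assert (G0 : g z = 0).
    { apply Cmod_eq_0. apply Rle_antisym; [|apply Cmod_ge_0]. apply Rnot_lt_le. intros Hp.
      assert (HK : 0 <= K) by (eapply Rle_trans; [apply Cmod_ge_0 | apply (B 0)]).
      (* Large enough that [Cmod (g z) * rho] exceeds [2 * K + 1], against the bound [2 * K / rho]
         for [g]. *)
      set (rho := (Cmod z + (2 * K + 1) / Cmod (g z) + 1)%R).
      assert (P1 : 0 < (2 * K + 1) / Cmod (g z)) by (apply Rdiv_lt_0_compat; lra).
      assert (Cmod (g z) <= 2 * K / rho).
      { apply entire_max with rho; auto. unfold rho; lra. intros v Hv.
        assert (Hv0 : v <> 0). { apply Cmod_gt_0. rewrite Hv. unfold rho. generalize (Cmod_ge_0 z). lra. }
        assert (Q : g v = (f v - f 0) / v) by (rewrite E; field; auto).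
        rewrite Q, Cmod_div, Hv by auto. apply Rmult_le_compat_r. left. apply Rinv_0_lt_compat. unfold rho. generalize (Cmod_ge_0 z); lra.
        eapply Rle_trans. apply Cmod_minus_le. generalize (B v) (B 0). lra. }
      assert (Hrho : 0 < rho) by (unfold rho; generalize (Cmod_ge_0 z); lra).
      assert (X : (Cmod (g z) * rho <= 2 * K)%R).
      { apply Rmult_le_compat_r with (r := rho) in H; [|lra]. unfold Rdiv in H. rewrite Rmult_assoc, Rinv_l in H by lra. lra. }
      assert (Y : (Cmod (g z) * ((2 * K + 1) / Cmod (g z)) = 2 * K + 1)%R) by (field; lra).
      assert (Cmod (g z) * ((2 * K + 1) / Cmod (g z)) <= Cmod (g z) * rho)%R.
      { apply Rmult_le_compat_l. lra. unfold rho. generalize (Cmod_ge_0 z); lra. }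
      lra. }
    specialize (E z). rewrite G0 in E. replace (f z) with ((f z - f 0) + f 0) by ring. rewrite E. ring.
  - destruct (entire_div0 (fun z => f z - f 0)) as [g [Hg E]].
    apply entire_minus; auto. apply entire_const. ring.
    destruct (IHd g (K + Cmod (f 0))%R (Rmax r1 1)) as [l Hl]; auto.
    + intros z Hz. assert (Z1 := Rle_trans _ _ _ (Rmax_r r1 1) Hz). assert (Z2 := Rle_trans _ _ _ (Rmax_l r1 1) Hz).
      assert (Hv0 : z <> 0) by (apply Cmod_gt_0; lra).
      assert (Q : g z = (f z - f 0) / z) by (rewrite E; field; auto).
      rewrite Q, Cmod_div by auto. apply Rmult_le_reg_r with (Cmod z). lra.
      unfold Rdiv. rewrite Rmult_assoc, Rinv_l, Rmult_1_r by lra.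
      eapply Rle_trans. apply Cmod_minus_le. specialize (HB z Z2). simpl in HB.
      assert (1 <= Cmod z ^ d) by (apply pow_R1_Rle; auto).
      assert (Cmod (f 0) * 1 <= Cmod (f 0) * (Cmod z ^ d * Cmod z))%R.
      { apply Rmult_le_compat_l. apply Cmod_ge_0. nra. }
      lra.
    + exists (f 0 :: l). intros z. simpl. rewrite <- Hl, <- E. ring.
Qed.

(** * Zeros and orders of entire functions *)

Definition nz (u : C -> C) : Prop := exists z, u z <> 0.

Lemma not_nz u : ~ nz u -> forall z, u z = 0.
Proof. intros H z. apply NNPP. intros Hz. apply H. exists z; auto. Qed.

Lemma Qprod_lower l (z : C) (m : R) : 0 <= m -> (forall a, In a l -> m <= Cmod (z - a)) ->
  m ^ length l <= Cmod (Qprod l z).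
Proof.
  intros Hm. induction l; intros H; simpl. rewrite Cmod_1; lra.
  rewrite Cmod_mult. apply Rmult_le_compat; auto. apply pow_le; auto. apply H; left; auto.
  apply IHl. intros; apply H; right; auto.
Qed.

Lemma Qprod_upper l (z : C) (m : R) : (forall a, In a l -> Cmod (z - a) <= m) ->
  Cmod (Qprod l z) <= m ^ length l.
Proof.
  induction l; intros H; simpl. rewrite Cmod_1; lra.
  rewrite Cmod_mult. apply Rmult_le_compat; auto; try apply Cmod_ge_0. apply H; left; auto.
  apply IHl. intros; apply H; right; auto.
Qed.

Lemma Qprod_zero l (a : C) : In a l -> Qprod l a = 0.
Proof. induction l; simpl; intros []. subst. ring. rewrite IHl; auto. ring. Qed.

Lemma Qprod_nonzero l (z : C) : ~ In z l -> Qprod l z <> 0.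
Proof.
  induction l; simpl; intros H. apply C1_nz. apply Cmult_neq_0.
  apply Cminus_eq_contra. intros ->. apply H; auto. apply IHl; auto.
Qed.

Lemma Qprod_zero_inv l (z : C) : Qprod l z = 0 -> In z l.
Proof. intros H. apply NNPP. intros N. apply (Qprod_nonzero _ _ N H). Qed.

Lemma Qprod_repeat (a z : C) n : Qprod (repeat a n) z = (z - a) ^ n.
Proof. induction n; simpl; auto. rewrite IHn; auto. Qed.

(** Every factor [z - a] has modulus at least [4 * R0] on the circle of radius [5 * R0] and at most
    [2 * R0] at [zs]. Hence [N] zeros force [Cmod (u zs) <= M / 2^N], which bounds [N],
    multiplicities included. *)
Lemma zero_count_bound u zs R0 : entire u -> u zs <> 0 -> 0 < R0 -> Cmod zs <= R0 ->
  exists N0 : nat, forall l h, entire h -> (forall a, In a l -> Cmod a <= R0) ->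
    (forall z, u z = Qprod l z * h z) -> (length l <= N0)%nat.
Proof.
  intros Hu Hz HR Hzs. apply Cmod_gt_0 in Hz.
  destruct (entire_bounded u (5 * R0)) as [M [HM HB]]; auto. lra.
  destruct (nfloor_ex (M / Cmod (u zs))) as [N0 HN0].
  { apply Rmult_le_pos; auto. left. apply Rinv_0_lt_compat; auto. }
  exists N0. intros l h Hh Hl E. set (N := length l).
  assert (P4 : 0 < (4 * R0) ^ N) by (apply pow_lt; lra).
  assert (B : Cmod (h zs) <= M / (4 * R0) ^ N).
  { apply entire_max with (5 * R0)%R; auto. lra. intros z Hz'.
    apply Rmult_le_reg_r with ((4 * R0) ^ N)%R; auto. unfold Rdiv. rewrite Rmult_assoc, Rinv_l, Rmult_1_r by lra.
    eapply Rle_trans; [|apply (HB z); lra]. rewrite E, Cmod_mult, Rmult_comm.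
    apply Rmult_le_compat_r. apply Cmod_ge_0. apply Qprod_lower. lra.
    intros a Ha. assert (Z := Cmod_minus_ge z a). specialize (Hl a Ha). lra. }
  assert (B2 : Cmod (Qprod l zs) <= (2 * R0) ^ N).
  { apply Qprod_upper. intros a Ha. eapply Rle_trans. apply Cmod_minus_le. specialize (Hl a Ha). lra. }
  assert (B3 : Cmod (u zs) <= M / 2 ^ N).
  { rewrite E, Cmod_mult. eapply Rle_trans. apply Rmult_le_compat; [apply Cmod_ge_0|apply Cmod_ge_0|exact B2|exact B].
    replace (4 * R0)%R with (2 * (2 * R0))%R by ring. rewrite (Rpow_mult_distr 2 (2 * R0)). right. field.
    split; apply pow_nonzero; lra. }
  assert (P2 : 0 < 2 ^ N) by (apply pow_lt; lra).
  assert (B4 : (2 ^ N <= M / Cmod (u zs))%R).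
  { apply Rmult_le_reg_r with (Cmod (u zs)); auto. unfold Rdiv at 1. rewrite Rmult_assoc, Rinv_l, Rmult_1_r by lra.
    apply Rmult_le_reg_r with (/ 2 ^ N)%R. apply Rinv_0_lt_compat; auto.
    replace (2 ^ N * Cmod (u zs) * / 2 ^ N)%R with (Cmod (u zs)) by (field; lra). exact B3. }
  assert (B5 : (INR N < 2 ^ N)%R).
  { replace 2%R with (INR 2) by (simpl; lra). rewrite <- pow_INR. apply lt_INR. apply Nat.pow_gt_lin_r. lia. }
  assert (INR N < INR N0 + 1)%R by lra. rewrite <- S_INR in H. apply INR_lt in H. lia.
Qed.

(** Zeros are divided out one at a time and [zero_count_bound] makes the process stop. This takes
    the place of the identity theorem: finiteness of zeros on bounded sets and of their orders are
    both read off from it. *)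
Lemma factor_zeros (Z : C -> Prop) R0 u : (forall z, Z z -> Cmod z <= R0) -> entire u -> nz u ->
  exists l h, entire h /\ (forall a, In a l -> Z a) /\ (forall z, u z = Qprod l z * h z) /\ (forall z, Z z -> h z <> 0).
Proof.
  intros HZ Hu [zs Hzs].
  set (R1 := (Rmax (Cmod zs) (Rmax R0 0) + 1)%R).
  assert (Q1 : Cmod zs <= R1) by (unfold R1; generalize (Rmax_l (Cmod zs) (Rmax R0 0)); lra).
  assert (Q2 : R0 <= R1) by (unfold R1; generalize (Rmax_r (Cmod zs) (Rmax R0 0)) (Rmax_l R0 0); lra).
  assert (Q3 : 0 < R1) by (unfold R1; generalize (Rmax_r (Cmod zs) (Rmax R0 0)) (Rmax_r R0 0); lra).
  destruct (zero_count_bound u zs R1) as [N0 HN]; auto.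
  assert (IND : forall k l h, (N0 - length l <= k)%nat -> entire h -> (forall a, In a l -> Z a) ->
    (forall z, u z = Qprod l z * h z) ->
    exists l h, entire h /\ (forall a, In a l -> Z a) /\ (forall z, u z = Qprod l z * h z) /\ (forall z, Z z -> h z <> 0)).
  { induction k; intros l h Hk Hh Hl E;
    (destruct (classic (exists z, Z z /\ h z = 0)) as [[z1 [Hz1 Hh1]]|Hno];
     [|exists l, h; repeat split; auto; intros z Hz Hh0; apply Hno; exists z; auto]);
    destruct (entire_div h z1 Hh Hh1) as [g [Hg Eg]];
    assert (E' : forall z, u z = Qprod (z1 :: l) z * g z) by (intros z; rewrite E, Eg; simpl; ring);
    assert (Hl' : forall a, In a (z1 :: l) -> Z a) by (intros a [<-|Ha]; auto);
    assert (HL : (length (z1 :: l) <= N0)%nat) by (apply (HN _ g); auto; intros a Ha; eapply Rle_trans; [apply HZ; auto | auto]);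
    simpl in HL.
    - lia.
    - apply (IHk (z1 :: l) g); auto. simpl. lia. }
  apply (IND N0 [] u); auto. lia. intros a []. intros z. simpl. ring.
Qed.

Lemma order_at u z0 : entire u -> nz u ->
  exists p g, entire g /\ g z0 <> 0 /\ forall z, u z = (z - z0) ^ p * g z.
Proof.
  intros Hu Hn. destruct (factor_zeros (fun z => z = z0) (Cmod z0) u) as (l & h & Hh & Hl & E & Hnz); auto.
  intros z ->; lra.
  exists (length l), h. split; auto. split; auto. intros z. rewrite E. f_equal.
  rewrite <- Qprod_repeat. f_equal. clear E. induction l; simpl; auto. f_equal. apply Hl; left; auto. apply IHl. intros; apply Hl; right; auto.
Qed.

Lemma ccont_nonzero (g : C -> C) z0 : ccont dC g z0 -> g z0 <> 0 ->
  exists d : R, 0 < d /\ forall w, Cmod (w - z0) < d -> g w <> 0.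
Proof.
  intros H Hn. apply Cmod_gt_0 in Hn. destruct (H _ Hn) as [d [Hd H1]]. exists d. split; auto.
  intros w Hw E. specialize (H1 w Hw). rewrite E in H1. replace (0 - g z0) with (- g z0) in H1 by ring.
  rewrite Cmod_opp in H1. lra.
Qed.

Lemma entire_cont f z : entire f -> ccont dC f z.
Proof. intros H. eapply cderiv_cont. apply entire_cderiv; auto. Qed.

(** Near a point [z0] with [u z0 <> 0] the only possible zero of the product comes from a power of
    [z - z0]. *)
Lemma nz_mult u v : entire u -> entire v -> nz u -> nz v -> nz (fun z => u z * v z).
Proof.
  intros Hu Hv [z0 H0] Nv. destruct (order_at v z0 Hv Nv) as (p & g & Hg & Hg0 & E).
  destruct (ccont_nonzero (fun z => u z * g z) z0) as [d [Hd H1]].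
  apply ccont_mult; apply entire_cont; auto. apply Cmult_neq_0; auto.
  exists (z0 + RtoC (d / 2)). rewrite E.
  assert (A : u (z0 + RtoC (d / 2)) * g (z0 + RtoC (d / 2)) <> 0).
  { apply H1. replace (z0 + RtoC (d / 2) - z0) with (RtoC (d / 2)) by ring. rewrite Cmod_R, Rabs_right; lra. }
  intros X. apply A.
  assert (B : (z0 + RtoC (d / 2) - z0) ^ p <> 0).
  { apply Cpow_nz. replace (z0 + RtoC (d / 2) - z0) with (RtoC (d / 2)) by ring. intros Y. apply RtoC_inj in Y. lra. }
  apply NNPP. intros Nn. apply (Cmult_neq_0 _ _ B Nn). rewrite <- X. ring.
Qed.

(** Divisibility is tested point by point. The value of [V] at [z0] is read from some local
    factorisation at [z0]; off the zeros of [den] it is the ordinary quotient, whichever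
    factorisation is chosen. *)
Lemma entire_quotient num den : entire den -> nz den ->
  (forall z0, exists p n1 d1, entire n1 /\ entire d1 /\ d1 z0 <> 0 /\
     (forall z, den z = (z - z0) ^ p * d1 z) /\ (forall z, num z = (z - z0) ^ p * n1 z)) ->
  exists V, entire V /\ forall z, num z = den z * V z.
Proof.
  intros Hden Nden H.
  set (P := fun (z0 v : C) => exists p n1 d1, entire n1 /\ entire d1 /\ d1 z0 <> 0 /\
     (forall z, den z = (z - z0) ^ p * d1 z) /\ (forall z, num z = (z - z0) ^ p * n1 z) /\ v = n1 z0 / d1 z0).
  assert (H' : forall z0, exists v, P z0 v).
  { intros z0. destruct (H z0) as (p & n1 & d1 & A). exists (n1 z0 / d1 z0), p, n1, d1. tauto. }
  set (V := fun z => proj1_sig (constructive_indefinite_description _ (H' z))).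
  assert (HV : forall z, P z (V z)).
  { intros z. unfold V. apply (proj2_sig (constructive_indefinite_description _ (H' z))). }
  assert (Z0 : forall (z : C) p, (z - z) ^ S p = 0) by (intros; rewrite Cpow_S; ring).
  assert (EV : forall z, den z <> 0 -> V z = num z / den z).
  { intros z Hz. destruct (HV z) as (p & n1 & d1 & A1 & A2 & A3 & A4 & A5 & A6).
    destruct p. rewrite A6, A4, A5. simpl. field. auto.
    exfalso. apply Hz. rewrite A4, Z0. ring. }
  exists V. split.
  - apply entire_intro. intros z0. destruct (HV z0) as (p & n1 & d1 & A1 & A2 & A3 & A4 & A5 & A6).
    destruct (ccont_nonzero d1 z0) as [d [Hd Hd1]]; auto. apply entire_cont; auto.
    eexists. apply cderiv_local with (f := fun z => n1 z * / d1 z) (r := d); auto.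
    + intros w Hw. destruct (Ceq_dec w z0) as [->|Hne]. rewrite A6. reflexivity.
      assert (N1 : d1 w <> 0) by auto.
      assert (N2 : (w - z0) ^ p <> 0) by (apply Cpow_nz; apply Cminus_eq_contra; auto).
      rewrite EV. rewrite A4, A5. field. auto. rewrite A4. apply Cmult_neq_0; auto.
    + apply cderiv_mult. apply entire_cderiv; auto. apply cderiv_inv; auto. apply entire_cderiv; auto.
  - intros z0. destruct (HV z0) as (p & n1 & d1 & A1 & A2 & A3 & A4 & A5 & A6). rewrite A6, A4, A5. field. auto.
Qed.

Lemma C_derive_ext f g z : (forall w, f w = g w) -> entire f -> C_derive f z = C_derive g z.
Proof. intros E Hf. symmetry. apply cderiv_unique_C. apply cderiv_ext with f; auto. apply entire_cderiv; auto. Qed.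

Lemma derive_pow_factor f g z0 p z : entire g -> (forall z, f z = (z - z0) ^ S p * g z) ->
  C_derive f z = (z - z0) ^ p * (RtoC (INR (S p)) * g z + (z - z0) * C_derive g z).
Proof.
  intros Hg E. apply cderiv_unique_C. apply cderiv_ext with (fun z => (z - z0) ^ S p * g z). auto.
  eapply cderiv_eq; [|apply cderiv_mult; [apply (cderiv_pow (fun z => z - z0)); apply cderiv_minus; [apply cderiv_id | apply cderiv_const] | apply entire_cderiv; auto]].
  cbn [pred]. rewrite (Cpow_S _ p). ring.
Qed.

Lemma pow_factor_cancel (g h : C -> C) z0 p : entire g -> entire h ->
  (forall z, (z - z0) ^ p * g z = (z - z0) ^ p * h z) -> forall z, g z = h z.
Proof.
  intros Hg Hh E z. destruct (classic (nz (fun z => g z - h z))) as [N|N].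
  - exfalso. assert (X : nz (fun z => (z - z0) ^ p * (g z - h z))).
    { apply (nz_mult (fun z => (z - z0) ^ p) (fun z => g z - h z)); auto.
      apply (entire_pow (fun z => z - z0)). apply entire_minus. apply entire_id. apply entire_const. apply entire_minus; auto.
      exists (z0 + 1). apply Cpow_nz. replace (z0 + 1 - z0) with (RtoC 1) by ring. apply C1_nz. }
    destruct X as [w Hw]. apply Hw.
    replace ((w - z0) ^ p * (g w - h w)) with ((w - z0) ^ p * g w - (w - z0) ^ p * h w) by ring. rewrite E. ring.
  - assert (X := not_nz _ N z). cbv beta in X. apply Ceq_minus. exact X.
Qed.

(** A vanishing Wronskian means that [N / M] is constant. Poles are avoided by choosing [k] so that
    [K = N - k * M] vanishes at a point where [M] does not. If [K] were not identically zero,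
    [K' M = K M'] would have order [p] on the left and at least [p + 1] on the right there. *)
Lemma wronskian_zero N M : entire N -> entire M -> nz M ->
  (forall z, C_derive N z * M z = N z * C_derive M z) -> exists k : C, forall z, N z = k * M z.
Proof.
  intros HN HM [z0 Hz0] W. exists (N z0 / M z0). set (k := N z0 / M z0).
  set (K := fun z => N z - k * M z).
  assert (HkM : entire (fun z => k * M z)) by (apply (entire_mult (fun _ => k)); auto; apply entire_const).
  assert (HK : entire K) by (apply entire_minus; auto).
  intros z. apply Ceq_minus. change (K z = 0). apply not_nz. intros NK.
  destruct (order_at K z0 HK NK) as (p & g & Hg & Hg0 & E).
  assert (K0 : K z0 = 0) by (unfold K, k; field; auto).
  destruct p.
  { rewrite E in K0. simpl in K0. apply Hg0. rewrite <- K0. ring. }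
  assert (DK : forall z, C_derive K z = C_derive N z - k * C_derive M z).
  { intros w. apply cderiv_unique_C. apply cderiv_minus. apply entire_cderiv; auto. apply cderiv_scal. apply entire_cderiv; auto. }
  assert (WK : forall z, C_derive K z * M z = K z * C_derive M z).
  { intros w. rewrite DK. unfold K.
    replace ((C_derive N w - k * C_derive M w) * M w) with (C_derive N w * M w - k * M w * C_derive M w) by ring.
    rewrite W. ring. }
  assert (F : forall z, (RtoC (INR (S p)) * g z + (z - z0) * C_derive g z) * M z = ((z - z0) * g z) * C_derive M z).
  { apply (pow_factor_cancel (fun z => (RtoC (INR (S p)) * g z + (z - z0) * C_derive g z) * M z) (fun z => ((z - z0) * g z) * C_derive M z) z0 p).
    - apply entire_mult; auto. apply entire_plus. apply entire_mult; auto. apply entire_const.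
      apply entire_mult. apply entire_minus. apply entire_id. apply entire_const. apply entire_derive; auto.
    - apply entire_mult. apply entire_mult; auto. apply entire_minus. apply entire_id. apply entire_const. apply entire_derive; auto.
    - intros w. specialize (WK w). rewrite (derive_pow_factor K g z0 p w Hg E), E, Cpow_S in WK.
      transitivity ((w - z0) ^ p * (RtoC (INR (S p)) * g w + (w - z0) * C_derive g w) * M w). ring.
      rewrite WK. ring. }
  specialize (F z0). replace (z0 - z0) with (RtoC 0) in F by ring.
  assert (RtoC (INR (S p)) <> 0).
  { intros X. apply RtoC_inj in X. revert X. apply not_0_INR. lia. }
  apply (Cmult_neq_0 _ _ (Cmult_neq_0 _ _ H Hg0) Hz0).
  transitivity ((RtoC (INR (S p)) * g z0 + 0 * C_derive g z0) * M z0). ring. rewrite F. ring.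
Qed.

(** * Logarithms, Poisson and Borel-Caratheodory estimates *)

Lemma Cmod_sqr (z : C) : (Cmod z * Cmod z = Re z * Re z + Im z * Im z)%R.
Proof. assert (H := Cmod2_alt z). simpl in H. lra. Qed.

Lemma rderiv_ln_Cmod (g : R -> C) s (l : C) : g s <> 0 -> rderiv g s l ->
  derivable_pt_lim (fun x => ln (Cmod (g x))) s (Re (l / g s)).
Proof.
  intros Hn [H1 H2]. apply is_derive_Reals in H1. apply is_derive_Reals in H2.
  assert (Hp := proj1 (Cmod_gt_0 _) Hn).
  set (q := fun x => (Re (g x) * Re (g x) + Im (g x) * Im (g x))%R).
  assert (Hq : 0 < q s) by (unfold q; rewrite <- Cmod_sqr; apply Rmult_lt_0_compat; auto).
  assert (Dq : derivable_pt_lim q s ((Re l * Re (g s) + Re (g s) * Re l) + (Im l * Im (g s) + Im (g s) * Im l))%R).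
  { apply (derivable_pt_lim_plus (fun x => Re (g x) * Re (g x))%R (fun x => Im (g x) * Im (g x))%R).
    apply (derivable_pt_lim_mult (fun x => Re (g x)) (fun x => Re (g x))); auto.
    apply (derivable_pt_lim_mult (fun x => Im (g x)) (fun x => Im (g x))); auto. }
  assert (Dl := derivable_pt_lim_comp q ln s _ _ Dq (derivable_pt_lim_ln (q s) Hq)).
  assert (Ds := derivable_pt_lim_scal (comp ln q) (/ 2) s _ Dl).
  replace (Re (l / g s)) with (/ 2 * (/ q s * (Re l * Re (g s) + Re (g s) * Re l + (Im l * Im (g s) + Im (g s) * Im l))))%R.
  - intros eps He. destruct (Ds eps He) as [d Hd].
    exists d. intros h Hh Hh2. eapply Rle_lt_trans; [right|exact (Hd h Hh Hh2)].
    assert (E : forall x, (/ 2 * ln (q x))%R = ln (Cmod (g x))).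
    { intros x. unfold q. rewrite <- Cmod_sqr. 
      assert (P := Cmod_ge_0 (g x)). destruct P as [P|P].
      rewrite ln_mult by auto. field.
      (* [ln 0] is 0 by default, so the identity also holds where [g] vanishes and no neighbourhood
         has to be chosen. *)
      rewrite <- P, Rmult_0_l. replace (ln 0) with 0%R. ring.
      unfold ln. destruct (Rlt_dec 0 0) as [X|X]; [exfalso; revert X; apply Rlt_irrefl|reflexivity]. }
    unfold mult_real_fct, comp. rewrite !E. reflexivity.
  - unfold q in Hq |- *. clear - Hq. destruct (g s) as [x y]. destruct l as [a b]. unfold Re, Im in *. cbn [fst snd] in *. simpl.
    field. lra.
Qed.

(** [L] is a primitive of [h'/h] normalised at 0. Along each ray from 0 the difference of [Re L] and
    [ln |h|] has derivative 0. *)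
Lemma hol_log r h : 0 < r -> hol r h -> (forall z, Cmod z < r -> h z <> 0) ->
  exists L, hol r L /\ (forall z, Cmod z < r -> Re (L z) = ln (Cmod (h z)))
    /\ (forall z, Cmod z < r -> C_derive L z = C_derive h z / h z).
Proof.
  intros Hr Hh Hnz.
  destruct (hol_primitive r (fun z => C_derive h z / h z)) as [L0 HL0].
  { intros z Hz. destruct (hol_derive r h Hh z Hz) as [l Hl].
    eexists. apply cderiv_mult. exact Hl. apply cderiv_inv; auto. apply hol_cderiv with r; auto. }
  set (L := fun z => L0 z + (RtoC (ln (Cmod (h 0))) - L0 0)).
  assert (HL : forall z, Cmod z < r -> cderiv L z (C_derive h z / h z)).
  { intros z Hz. eapply cderiv_eq; [|apply cderiv_plus; [apply HL0; auto|apply cderiv_const]]. ring. }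
  exists L. split; [|split].
  - intros z Hz. eexists. apply HL; auto.
  - intros z Hz. set (gam := fun s : R => RtoC s * z).
    assert (Hg : forall s, 0 <= s <= 1 -> Cmod (gam s) < r).
    { intros s Hs. unfold gam. rewrite Cmod_mult, Cmod_R, Rabs_right by lra.
      assert (s * Cmod z <= 1 * Cmod z)%R by (apply Rmult_le_compat_r; [apply Cmod_ge_0|lra]). lra. }
    assert (Dg : forall s, rderiv gam s z).
    { intros s. eapply rderiv_eq; [|apply (rderiv_of_real (fun v => v * z)); apply cderiv_mult; [apply cderiv_id|apply cderiv_const]]. cbv beta; ring. }
    assert (D : forall s, 0 <= s <= 1 -> derivable_pt_lim (fun x => Re (L (gam x)) - ln (Cmod (h (gam x))))%R s 0).
    { intros s Hs. specialize (Hg s Hs).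
      assert (A := rderiv_comp L gam s _ _ (HL _ Hg) (Dg s)).
      assert (B := rderiv_comp h gam s _ _ (hol_cderiv r h _ Hh Hg) (Dg s)).
      apply (rderiv_ln_Cmod (fun s => h (gam s))) in B; auto.
      destruct A as [A _]. apply is_derive_Reals in A.
      replace 0%R with (Re (C_derive h (gam s) / h (gam s) * z) - Re (C_derive h (gam s) * z / h (gam s)))%R.
      apply (derivable_pt_lim_minus (fun x => Re (L (gam x))) (fun x => ln (Cmod (h (gam x))))); auto.
      replace (C_derive h (gam s) * z / h (gam s)) with (C_derive h (gam s) / h (gam s) * z). ring.
      field. auto. }
    destruct (MVT_gen (fun x => Re (L (gam x)) - ln (Cmod (h (gam x))))%R 0 1 (fun _ => 0%R)) as [c [_ E]].
    + rewrite Rmin_left, Rmax_right by lra. intros x Hx. apply is_derive_Reals. apply D. lra.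
    + rewrite Rmin_left, Rmax_right by lra. intros x Hx. apply derivable_continuous_pt. exists 0%R. apply D. lra.
    + cbv beta in E. unfold gam in E. rewrite Cmult_1_l, Cmult_0_l in E.
      assert (Re (L 0) = ln (Cmod (h 0))).
      { unfold L. rewrite re_plus, re_minus. simpl. ring. }
      lra.
  - intros z Hz. apply cderiv_unique_C. auto.
Qed.

Lemma RInt_circ_continuous (g : R -> R) : (forall t, continuous g t) -> ex_RInt g 0 (2 * PI).
Proof. intros H. apply (ex_RInt_continuous (V := R_CompleteNormedModule)). auto. Qed.

Lemma mean_value_Re r rho L : hol r L -> 0 < rho < r ->
  RInt (fun t => Re (L (circ rho t))) 0 (2 * PI) = (2 * PI * Re (L 0))%R.
Proof.
  intros HL Hr.
  assert (A := cauchy r rho L 0 HL ltac:(lra) ltac:(rewrite Cmod_0; lra)).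
  apply (f_equal Re) in A. rewrite re_scal_l in A. rewrite <- A. unfold cint; cbn [Re fst].
  unfold Re at 2. cbn [fst]. apply RInt_ext. intros t _.
  assert (N : circ rho t - 0 <> 0) by (apply circ_neq; rewrite Cmod_0; lra).
  replace (circ rho t - 0) with (circ rho t) in N by ring.
  replace (L (circ rho t) * (circ rho t / (circ rho t - 0))) with (L (circ rho t)). reflexivity.
  replace (circ rho t - 0) with (circ rho t) by ring. field. auto.
Qed.

(* The reflected kernel is holomorphic in the disc and vanishes at 0, so it integrates to 0 against [L]. *)
Lemma cauchy_reflected r rho L (z : C) m : hol r L -> rho < r -> Cmod z < rho ->
  cint (fun t => L (circ rho t) * (circ rho t * / (RtoC (rho * rho) - Cconj z * circ rho t) ^ m)) 0 (2 * PI) = 0.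
Proof.
  intros HL Hr Hz.
  assert (Hrho : 0 < rho) by (generalize (Cmod_ge_0 z); lra).
  (* The reflected kernel has its pole at modulus [rho^2 / |z|]. Replacing [|z|] by the midpoint of
     [|z|] and [rho] keeps the radius beyond [rho] and also covers [z = 0]. *)
  set (r' := Rmin r (rho * rho / (Cmod z + (rho - Cmod z) / 2))).
  assert (Hd : 0 < Cmod z + (rho - Cmod z) / 2) by (generalize (Cmod_ge_0 z); lra).
  assert (Hr' : rho < r').
  { unfold r'. apply Rmin_glb_lt; auto. apply Rmult_lt_reg_r with (Cmod z + (rho - Cmod z) / 2)%R; auto.
    unfold Rdiv at 2. rewrite Rmult_assoc, Rinv_l, Rmult_1_r by lra. apply Rmult_lt_compat_l; lra. }
  assert (Nz : forall v, Cmod v < r' -> RtoC (rho * rho) - Cconj z * v <> 0).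
  { intros v Hv E. assert (E2 : RtoC (rho * rho) = Cconj z * v).
    { apply Ceq_minus. exact E. }
    apply (f_equal Cmod) in E2. rewrite Cmod_R, Cmod_mult, Cmod_conj, Rabs_right in E2 by nra.
    assert (V := Rlt_le_trans _ _ _ Hv (Rmin_r _ _)).
    apply Rmult_lt_compat_r with (r := (Cmod z + (rho - Cmod z) / 2)%R) in V; auto.
    unfold Rdiv at 2 in V. rewrite Rmult_assoc, Rinv_l, Rmult_1_r in V by lra.
    assert (0 <= Cmod v) by apply Cmod_ge_0. nra. }
  set (G := fun v => L v * (v * / (RtoC (rho * rho) - Cconj z * v) ^ m)).
  assert (HG : hol r' G).
  { intros v Hv. destruct (HL v) as [l Hl]. eapply Rlt_le_trans. exact Hv. apply Rmin_l.
    eexists. apply cderiv_mult. exact Hl. apply cderiv_mult. apply cderiv_id.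
    apply (cderiv_inv (fun v => (RtoC (rho * rho) - Cconj z * v) ^ m)). apply Cpow_nz; auto.
    apply (cderiv_pow (fun v => RtoC (rho * rho) - Cconj z * v)). apply cderiv_minus. apply cderiv_const.
    apply cderiv_scal. apply cderiv_id. }
  assert (A := cauchy r' rho G 0 HG Hr' ltac:(rewrite Cmod_0; lra)).
  rewrite (cint_ext _ (fun t => G (circ rho t) * (circ rho t / (circ rho t - 0)))).
  rewrite A. unfold G. ring.
  intros t _. unfold G.
  assert (N : circ rho t - 0 <> 0) by (apply circ_neq; rewrite Cmod_0; lra).
  replace (circ rho t - 0) with (circ rho t) in N by ring.
  replace (circ rho t - 0) with (circ rho t) by ring.
  field. split; auto. apply Cpow_nz. apply Nz. rewrite Cmod_circ; lra.
Qed.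

Lemma circ_conj rho t : circ rho t * Cconj (circ rho t) = RtoC (rho * rho).
Proof.
  unfold circ, Cconj. apply C_eq; simpl; [|ring].
  replace (rho * cos t * (rho * cos t) - rho * sin t * - (rho * sin t))%R with (rho * rho * (Rsqr (sin t) + Rsqr (cos t)))%R by (unfold Rsqr; ring).
  rewrite sin2_cos2. ring.
Qed.

Lemma Cmult_conj_mod (c : C) : c * Cconj c = RtoC (Cmod c * Cmod c).
Proof. rewrite <- Cmod2_conj. f_equal. ring. Qed.

Lemma Cconj_nz (c : C) : c <> 0 -> Cconj c <> 0.
Proof. intros H E. apply Cmod_gt_0 in H. rewrite <- Cmod_conj, E, Cmod_0 in H. lra. Qed.

Lemma circ_reflect_neq rho (z : C) t : 0 < rho -> Cmod z < rho -> RtoC (rho * rho) - Cconj z * circ rho t <> 0.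
Proof.
  intros Hr Hz. rewrite <- (circ_conj rho t).
  replace (circ rho t * Cconj (circ rho t) - Cconj z * circ rho t) with (circ rho t * (Cconj (circ rho t) - Cconj z)) by ring.
  rewrite <- Cminus_conj. apply Cmult_neq_0. apply Cmod_gt_0; rewrite Cmod_circ; lra. apply Cconj_nz. apply circ_neq; auto.
Qed.

Lemma ccont_circ_reflect rho (z : C) m t : 0 < rho -> Cmod z < rho ->
  ccont dR (fun t => circ rho t * / (RtoC (rho * rho) - Cconj z * circ rho t) ^ m) t.
Proof.
  intros Hr Hz. apply ccont_mult. apply ccont_circ. apply ccont_inv. apply Cpow_nz. apply circ_reflect_neq; auto.
  apply ccont_pow. apply ccont_minus. apply ccont_const. apply ccont_mult. apply ccont_const. apply ccont_circ.
Qed.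

(** On the circle [rho^2] is [circ * Cconj circ], so the reflected kernel becomes the reciprocal of
    [Cconj (circ - z)] and the sum is real. *)
Lemma poisson_kernel rho (z : C) t : 0 < rho -> Cmod z < rho ->
  circ rho t / (circ rho t - z) + Cconj z * (circ rho t * / (RtoC (rho * rho) - Cconj z * circ rho t) ^ 1)
  = RtoC ((rho * rho - Cmod z * Cmod z) / (Cmod (circ rho t - z) * Cmod (circ rho t - z))).
Proof.
  intros Hr Hz. assert (N := circ_neq rho t z Hz).
  assert (N0 : circ rho t <> 0) by (apply Cmod_gt_0; rewrite Cmod_circ; lra).
  assert (Np := proj1 (Cmod_gt_0 _) N).
  rewrite RtoC_div by nra. rewrite <- (Cmult_conj_mod (circ rho t - z)).
  rewrite RtoC_minus, <- (Cmult_conj_mod z), <- (circ_conj rho t), Cpow_1_r.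
  assert (N2 := Cconj_nz _ N). rewrite Cminus_conj in *.
  field. split; auto. split; auto. rewrite circ_conj. apply circ_reflect_neq; auto.
Qed.

Lemma poisson r rho L (z : C) : hol r L -> rho < r -> Cmod z < rho ->
  RInt (fun t => (rho * rho - Cmod z * Cmod z) / (Cmod (circ rho t - z) * Cmod (circ rho t - z)) * Re (L (circ rho t)))%R 0 (2 * PI)
  = (2 * PI * Re (L z))%R.
Proof.
  intros HL Hr Hz.
  assert (Hrho : 0 < rho) by (generalize (Cmod_ge_0 z); lra).
  assert (A := cauchy r rho L z HL Hr Hz).
  assert (B := cauchy_reflected r rho L z 1 HL Hr Hz).
  assert (cL : forall t, ccont dR (fun t => L (circ rho t)) t) by (intros; apply hol_circ_cont with r; auto; lra).
  assert (c1 : rcont (fun t => L (circ rho t) * (circ rho t / (circ rho t - z))) 0 (2 * PI)).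
  { intros t _. apply ccont_mult; auto. apply ccont_circ_kernel; auto. }
  assert (c2 : rcont (fun t => L (circ rho t) * (circ rho t * / (RtoC (rho * rho) - Cconj z * circ rho t) ^ 1)) 0 (2 * PI)).
  { intros t _. apply ccont_mult; auto. apply ccont_circ_reflect; auto. }
  assert (S : cint (fun t => RtoC ((rho * rho - Cmod z * Cmod z) / (Cmod (circ rho t - z) * Cmod (circ rho t - z))) * L (circ rho t)) 0 (2 * PI)
     = RtoC (2 * PI) * L z).
  { rewrite <- A. 
    rewrite (cint_ext _ (fun t => L (circ rho t) * (circ rho t / (circ rho t - z)) + Cconj z * (L (circ rho t) * (circ rho t * / (RtoC (rho * rho) - Cconj z * circ rho t) ^ 1)))).
    rewrite cint_plus; auto. rewrite cint_scal; auto. rewrite B. ring.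
    intros t Ht. apply ccont_mult. apply ccont_const. apply c2; auto.
    intros t _. rewrite <- poisson_kernel by auto. ring. }
  apply (f_equal Re) in S. rewrite re_scal_l in S. rewrite <- S. unfold cint. unfold Re at 2. cbn [fst].
  apply RInt_ext. intros t _. rewrite re_scal_l. reflexivity.
Qed.

(** For [|z| <= rho/2] the Poisson kernel lies between 0 and [(rho + |z|)/(rho - |z|) <= 3].
    Majorising by a nonnegative [k] lets the kernel be replaced by 3. *)
Lemma poisson_ineq r rho L (z : C) (k : R -> R) : hol r L -> 0 < rho < r -> Cmod z <= rho / 2 ->
  (forall t, continuous k t) -> (forall t, 0 <= k t) -> (forall t, Re (L (circ rho t)) <= k t) ->
  2 * PI * Re (L z) <= 3 * RInt k 0 (2 * PI).
Proof.
  intros HL Hr Hz Hk Hk0 HLk. assert (HPI := PI_RGT_0).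
  rewrite <- (poisson r rho L z) by (auto; lra).
  change (3 * RInt k 0 (2 * PI))%R with (scal 3%R (RInt k 0 (2 * PI))).
  rewrite <- (RInt_scal (V := R_CompleteNormedModule)) by (apply RInt_circ_continuous; auto).
  assert (Cz := Cmod_ge_0 z).
  assert (Dist : forall t, rho - Cmod z <= Cmod (circ rho t - z)).
  { intros t. assert (Q := Cmod_minus_ge (circ rho t) z). rewrite Cmod_circ in Q by lra. auto. }
  apply RInt_le. lra.
  - apply RInt_circ_continuous. intros t.
    apply (continuous_mult (K := R_AbsRing) (fun t => (rho * rho - Cmod z * Cmod z) / (Cmod (circ rho t - z) * Cmod (circ rho t - z)))%R).
    + apply continuity_pt_filterlim. apply continuity_pt_div. apply continuity_pt_const. intros x y; auto.
      apply continuity_pt_mult; apply ccont_Cmod; apply ccont_minus; try apply ccont_circ; apply ccont_const.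
      specialize (Dist t). nra.
    + apply ccont_Re. apply hol_circ_cont with r; auto; lra.
  - apply RInt_circ_continuous. intros t. apply (continuous_scal_r (K := R_AbsRing) (V := R_NormedModule) 3%R k t). auto.
  - intros t _. change (scal 3%R (k t)) with (3 * k t)%R. specialize (Dist t). specialize (HLk t). specialize (Hk0 t).
    set (d := Cmod (circ rho t - z)) in *. set (m := Cmod z) in *.
    assert (P0 : (0 < d * d)%R) by nra.
    assert (P : (0 <= (rho * rho - m * m) / (d * d) <= 3)%R).
    { split. apply Rmult_le_pos. nra. left. apply Rinv_0_lt_compat; auto.
      apply Rmult_le_reg_r with (d * d)%R; auto. unfold Rdiv. rewrite Rmult_assoc, Rinv_l, Rmult_1_r by lra. nra. }
    apply Rle_trans with ((rho * rho - m * m) / (d * d) * k t)%R. apply Rmult_le_compat_l; lra.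
    apply Rmult_le_compat_r; lra.
Qed.

Lemma cint_bound_int g (k : R -> R) : (forall t, ccont dR g t) -> ex_RInt k 0 (2 * PI) ->
  (forall t, Cmod (g t) <= k t) -> Cmod (cint g 0 (2 * PI)) <= 2 * RInt k 0 (2 * PI).
Proof.
  intros Hg Hk H. assert (HPI := PI_RGT_0). eapply Rle_trans. apply Cmod_le_re_im.
  assert (H1 : ex_RInt (fun t => Re (g t)) 0 (2 * PI)) by (apply rcont_ex_Re; intros t _; auto).
  assert (H2 : ex_RInt (fun t => Im (g t)) 0 (2 * PI)) by (apply rcont_ex_Im; intros t _; auto).
  assert (Rabs (RInt (fun t => Re (g t)) 0 (2 * PI)) <= RInt k 0 (2 * PI)).
  { eapply Rle_trans. apply abs_RInt_le; auto. lra. apply RInt_le; auto. lra.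
    apply (ex_RInt_norm (fun t => Re (g t))); auto.
    intros. eapply Rle_trans. apply re_le_Cmod. auto. }
  assert (Rabs (RInt (fun t => Im (g t)) 0 (2 * PI)) <= RInt k 0 (2 * PI)).
  { eapply Rle_trans. apply abs_RInt_le; auto. lra. apply RInt_le; auto. lra.
    apply (ex_RInt_norm (fun t => Im (g t))); auto.
    intros. eapply Rle_trans. apply im_le_Cmod. auto. }
  unfold cint, Re, Im in *. cbn [fst snd] in *. lra.
Qed.

Lemma RInt_opp_cont (k : R -> R) a b : ex_RInt k a b -> RInt (fun t => - k t)%R a b = (- RInt k a b)%R.
Proof. intros H. apply (RInt_opp (V := R_CompleteNormedModule) k a b H). Qed.

Lemma cint_conj g : (forall t, ccont dR g t) -> cint (fun t => Cconj (g t)) 0 (2 * PI) = Cconj (cint g 0 (2 * PI)).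
Proof.
  intros H. unfold cint, Cconj, Re, Im. cbn [fst snd]. f_equal.
  apply RInt_opp_cont. apply (rcont_ex_Im g). intros t _; auto.
Qed.

Lemma ccont_conj {T} (d : T -> T -> R) (g : T -> C) x : ccont d g x -> ccont d (fun y => Cconj (g y)) x.
Proof.
  intros H eps He. destruct (H eps He) as [e [H1 H2]]. exists e. split; auto. intros y Hy.
  rewrite <- Cminus_conj, Cmod_conj. auto.
Qed.

(** The kernel for the derivative annihilates constants and, by conjugating [cauchy_reflected] with
    [m = 2], also the conjugate of [L]. So [L] may be replaced by [2 * (Re L - K)], which has
    constant sign; the integral of its modulus is then given exactly by the mean value property. *)
Lemma borel_caratheodory r rho L (z : C) K : hol r L -> rho < r -> Cmod z < rho ->
  (forall t, Re (L (circ rho t)) <= K) ->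
  Cmod (C_derive L z) <= 4 * rho / ((rho - Cmod z) * (rho - Cmod z)) * (K - Re (L 0)).
Proof.
  intros HL Hr Hz HK. assert (HPI := PI_RGT_0).
  assert (Hrho : 0 < rho) by (generalize (Cmod_ge_0 z); lra).
  assert (cL : forall t, ccont dR (fun t => L (circ rho t)) t) by (intros; apply hol_circ_cont with r; auto; lra).
  set (ker := fun t => circ rho t * (/ (circ rho t - z)) ^ 2).
  assert (ck : forall t, ccont dR ker t).
  { intros t. apply ccont_mult. apply ccont_circ. apply ccont_pow. apply ccont_circ_inv; auto. }
  assert (A : cint (fun t => L (circ rho t) * ker t) 0 (2 * PI) = RtoC (2 * PI) * C_derive L z)
    by exact (cauchy_deriv r rho L z HL Hr Hz).
  assert (B : cint (fun t => Cconj (L (circ rho t)) * ker t) 0 (2 * PI) = 0).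
  { assert (X := cauchy_reflected r rho L z 2 HL Hr Hz).
    assert (cX : forall t, ccont dR (fun t => L (circ rho t) * (circ rho t * / (RtoC (rho * rho) - Cconj z * circ rho t) ^ 2)) t).
    { intros t. apply ccont_mult; auto. apply ccont_circ_reflect; auto. }
    rewrite (cint_ext _ (fun t => Cconj (RtoC (rho * rho) * (L (circ rho t) * (circ rho t * / (RtoC (rho * rho) - Cconj z * circ rho t) ^ 2))))).
    - rewrite cint_conj by (intros t; apply ccont_mult; auto; apply ccont_const).
      rewrite cint_scal by (intros t _; auto). rewrite X. apply C_eq; simpl; ring.
    - intros t _. rewrite !Cmult_conj. 
      assert (N := circ_neq rho t z Hz).
      assert (N0 : circ rho t <> 0) by (apply Cmod_gt_0; rewrite Cmod_circ; lra).
      rewrite Cinv_conj by (apply Cpow_nz; apply circ_reflect_neq; auto). rewrite Cpow_conj, Cminus_conj, Cmult_conj, Cconj_conj.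
      assert (E : Cconj (RtoC (rho * rho)) = RtoC (rho * rho)) by (apply C_eq; simpl; ring).
      rewrite E, <- (circ_conj rho t). unfold ker.
      assert (N1 := Cconj_nz _ N0).
      simpl. field. repeat split; auto.
      replace (circ rho t * Cconj (circ rho t) - z * Cconj (circ rho t)) with (Cconj (circ rho t) * (circ rho t - z)) by ring.
      apply Cmult_neq_0; auto. }
  assert (D : cint ker 0 (2 * PI) = 0).
  { assert (X := cauchy_deriv r rho (fun _ => RtoC 1) z ltac:(intros v Hv; eexists; apply cderiv_const) Hr Hz).
    rewrite (cderiv_unique_C _ _ _ (cderiv_const 1 z)) in X.
    rewrite (cint_ext _ (fun t => RtoC 1 * (circ rho t * (/ (circ rho t - z)) ^ 2))). rewrite X. ring.
    intros. unfold ker. ring. }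
  assert (S : cint (fun t => RtoC (2 * (Re (L (circ rho t)) - K)) * ker t) 0 (2 * PI) = RtoC (2 * PI) * C_derive L z).
  { rewrite (cint_ext _ (fun t => L (circ rho t) * ker t + (Cconj (L (circ rho t)) * ker t + RtoC (- 2 * K) * ker t))).
    rewrite cint_plus, cint_plus, A, B, cint_scal, D. ring.
    intros t _; auto.
    intros t _; apply ccont_mult; auto. apply ccont_conj; auto.
    intros t _; apply ccont_mult; auto. apply ccont_const.
    intros t _; apply ccont_mult; auto.
    intros t _. apply ccont_plus; apply ccont_mult; auto. apply ccont_conj; auto. apply ccont_const.
    intros t _. rewrite <- !Cmult_plus_distr_r. f_equal.
    destruct (L (circ rho t)) as [x y]. apply C_eq; simpl; ring. }
  set (k := fun t => (2 * rho / ((rho - Cmod z) * (rho - Cmod z)) * (K - Re (L (circ rho t))))%R).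
  assert (kc : forall t, continuous k t).
  { intros t. apply (continuous_scal_r (K := R_AbsRing) (V := R_NormedModule)).
    apply (continuous_minus (K := R_AbsRing) (V := R_NormedModule)). apply continuous_const. apply ccont_Re. auto. }
  assert (cRe : ex_RInt (fun t => Re (L (circ rho t))) 0 (2 * PI)) by (apply RInt_circ_continuous; intros; apply ccont_Re; auto).
  assert (Ik : RInt k 0 (2 * PI) = (2 * rho / ((rho - Cmod z) * (rho - Cmod z)) * (2 * PI * (K - Re (L 0))))%R).
  { unfold k.
    assert (e1 : ex_RInt (fun t => minus K (Re (L (circ rho t)))) 0 (2 * PI)).
    { apply (ex_RInt_minus (V := R_NormedModule)); auto. apply ex_RInt_const. }
    assert (X := RInt_scal (V := R_CompleteNormedModule) (fun t => minus K (Re (L (circ rho t)))) 0 (2 * PI) (2 * rho / ((rho - Cmod z) * (rho - Cmod z)))%R e1).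
    etransitivity. exact X. unfold scal; simpl; unfold mult; simpl. f_equal.
    etransitivity. apply (RInt_minus (V := R_CompleteNormedModule)); auto. apply ex_RInt_const.
    rewrite RInt_const, (mean_value_Re r rho L) by (auto; lra).
    unfold minus, plus, opp, scal; simpl; unfold mult; simpl. ring. }
  assert (Bd := cint_bound_int (fun t => RtoC (2 * (Re (L (circ rho t)) - K)) * ker t) k).
  assert (F : Cmod (RtoC (2 * PI) * C_derive L z) <= 2 * RInt k 0 (2 * PI)).
  { rewrite <- S. apply Bd.
    - intros t. apply ccont_mult; auto.
      apply (ccont_ext dR (fun t => L (circ rho t) + Cconj (L (circ rho t)) + RtoC (- 2 * K))).
      intros s. destruct (L (circ rho s)) as [x y]. apply C_eq; simpl; ring.
      apply ccont_plus. apply ccont_plus; auto. apply ccont_conj; auto. apply ccont_const.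
    - apply RInt_circ_continuous; auto.
    - intros t. unfold k, ker. specialize (HK t). rewrite !Cmod_mult, Cmod_R, Cmod_pow, Cmod_circ, Cmod_inv by (lra || apply circ_neq; auto).
      rewrite Rabs_left1 by lra.
      assert (Q := Cmod_minus_ge (circ rho t) z). rewrite Cmod_circ in Q by lra.
      set (d := Cmod (circ rho t - z)) in *.
      assert (Id : (/ d <= / (rho - Cmod z))%R) by (apply Rinv_le_contravar; lra).
      assert (Id0 : (0 < / d)%R) by (apply Rinv_0_lt_compat; lra).
      unfold Rdiv. rewrite Rinv_mult.
      assert (Id2 : (/ d * / d <= / (rho - Cmod z) * / (rho - Cmod z))%R) by (apply Rmult_le_compat; lra).
      simpl. rewrite Rmult_1_r.
      replace (- (2 * (Re (L (circ rho t)) - K)) * (rho * (/ d * / d)))%R with (2 * rho * (/ d * / d) * (K - Re (L (circ rho t))))%R by ring.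
      apply Rmult_le_compat_r. lra. apply Rmult_le_compat_l. lra. auto. }
  rewrite Cmod_mult, Cmod_R, Rabs_right, Ik in F by lra.
  apply Rmult_le_reg_l with (2 * PI)%R. lra. eapply Rle_trans. exact F. right. unfold Rdiv. ring.
Qed.

(** * Logarithmic derivatives *)

Lemma Qprod_log_derivative l (z : C) (del : R) : 0 < del -> (forall a, In a l -> del <= Cmod (z - a)) ->
  Cmod (C_derive (Qprod l) z) <= Cmod (Qprod l z) * (INR (length l) / del).
Proof.
  intros Hd. induction l; intros H.
  - rewrite (cderiv_unique_C (Qprod []) z 0) by apply cderiv_const. simpl. rewrite Cmod_0, Cmod_1. unfold Rdiv. lra.
  - assert (D : C_derive (Qprod (a :: l)) z = Qprod l z + (z - a) * C_derive (Qprod l) z).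
    { apply cderiv_unique_C. eapply cderiv_eq; [|apply (cderiv_mult (fun w => w - a) (Qprod l));
      [apply cderiv_minus; [apply cderiv_id|apply cderiv_const]|apply entire_cderiv; apply entire_Qprod]]. cbv beta; ring. }
    rewrite D. cbn [Qprod fold_right length]. fold (Qprod l z). rewrite S_INR, Cmod_mult.
    eapply Rle_trans. apply Cmod_triangle. rewrite Cmod_mult.
    assert (Ha := H a (or_introl eq_refl)). specialize (IHl ltac:(intros; apply H; right; auto)).
    set (q := Cmod (Qprod l z)) in *. set (w := Cmod (z - a)) in *. assert (0 <= q) by apply Cmod_ge_0.
    assert (w * Cmod (C_derive (Qprod l) z) <= w * (q * (INR (length l) / del)))%R by (apply Rmult_le_compat_l; lra).
    assert (q * 1 <= q * (w / del))%R.
    { apply Rmult_le_compat_l; auto. apply Rmult_le_reg_r with del; auto. unfold Rdiv. rewrite Rmult_assoc, Rinv_l; lra. }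
    replace (w * q * ((INR (length l) + 1) / del))%R with (w * (q * (INR (length l) / del)) + q * (w / del))%R by (field; lra).
    lra.
Qed.

(** Splitting off the zeros [Z] in the disc of radius [3 * r] leaves a factor [h] that has a
    logarithm there, to which Borel-Caratheodory applies; the factor [Qprod Z] contributes at most
    [1/del] per zero. *)
Lemma log_derivative_bound u r K : entire u -> u 0 <> 0 -> 0 < r ->
  (forall z, Cmod z <= 9 * r -> Cmod (u z) <= exp K) ->
  exists Z : list C, (forall a, In a Z -> u a = 0) /\
    INR (length Z) * ln 2 <= K - ln (Cmod (u 0)) /\
    forall z del, Cmod z <= r -> 0 < del -> (forall a, In a Z -> del <= Cmod (z - a)) ->
      u z <> 0 /\
      Cmod (C_derive u z) <= Cmod (u z) * (INR (length Z) / del + 8 / r * (K - ln (Cmod (u 0)))).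
Proof.
  intros Hu Hu0 Hr HB.
  destruct (factor_zeros (fun z => Cmod z <= 3 * r) (3 * r) u) as (Z & h & Hh & HZ & E & Hnz); auto.
  { exists 0; auto. }
  exists Z. set (N := length Z).
  assert (P6 : 0 < (6 * r) ^ N) by (apply pow_lt; lra).
  assert (P3 : 0 < (3 * r) ^ N) by (apply pow_lt; lra).
  (* The factor [(6 * r)^N] is a lower bound for [Qprod Z] on the circle of radius [9 * r], so [hs]
     is bounded by [exp K] inside. At 0 the product is at most [(3 * r)^N], hence [hs 0] gains a
     factor [2^N] over [u 0]. This gives at once the count of zeros and the lower bound at the
     centre. *)
  set (hs := fun z => RtoC ((6 * r) ^ N) * h z).
  assert (Hhs : entire hs) by (apply (entire_mult (fun _ => RtoC ((6 * r) ^ N))); auto; apply entire_const).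
  assert (Cu0 := proj1 (Cmod_gt_0 _) Hu0).
  assert (up : forall z, Cmod z <= 9 * r -> Cmod (hs z) <= exp K).
  { intros z Hz. apply entire_max with (9 * r)%R; auto. intros w Hw.
    unfold hs. rewrite Cmod_mult, Cmod_R, Rabs_right by lra.
    eapply Rle_trans; [|apply (HB w); lra]. rewrite E, Cmod_mult. apply Rmult_le_compat_r. apply Cmod_ge_0.
    apply Qprod_lower. lra. intros a Ha. assert (X := Cmod_minus_ge w a). specialize (HZ a Ha). cbv beta in HZ. lra. }
  assert (lo : (Cmod (u 0) * 2 ^ N <= Cmod (hs 0))%R).
  { unfold hs. rewrite Cmod_mult, Cmod_R, Rabs_right by lra. rewrite E, Cmod_mult.
    assert (Q : Cmod (Qprod Z 0) <= (3 * r) ^ N).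
    { apply Qprod_upper. intros a Ha. replace (0 - a) with (- a) by ring. rewrite Cmod_opp. apply HZ; auto. }
    replace (6 * r)%R with (2 * (3 * r))%R by ring. rewrite (Rpow_mult_distr 2).
    assert (0 < 2 ^ N) by (apply pow_lt; lra).
    replace (Cmod (Qprod Z 0) * Cmod (h 0) * 2 ^ N)%R with (Cmod (Qprod Z 0) * (2 ^ N * Cmod (h 0)))%R by ring.
    replace (2 ^ N * (3 * r) ^ N * Cmod (h 0))%R with ((3 * r) ^ N * (2 ^ N * Cmod (h 0)))%R by ring.
    apply Rmult_le_compat_r; auto. apply Rmult_le_pos. lra. apply Cmod_ge_0. }
  assert (p2 : 1 <= 2 ^ N) by (apply pow_R1_Rle; lra).
  assert (NB : (INR N * ln 2 <= K - ln (Cmod (u 0)))%R).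
  { assert (X := Rle_trans _ _ _ lo (up 0 ltac:(rewrite Cmod_0; lra))).
    apply ln_le in X; [|apply Rmult_lt_0_compat; lra].
    rewrite ln_exp, ln_mult, ln_pow in X by lra. lra. }
  split; [|split]; auto.
  - intros a Ha. rewrite E, Qprod_zero by auto. ring.
  - intros z del Hz Hdel Hda.
    assert (HzZ : ~ In z Z).
    { intros X. specialize (Hda z X). replace (z - z) with (RtoC 0) in Hda by ring. rewrite Cmod_0 in Hda. lra. }
    assert (nzh : h z <> 0) by (apply Hnz; lra).
    assert (nzQ := Qprod_nonzero Z z HzZ).
    split. rewrite E. apply Cmult_neq_0; auto.
    assert (hs_nz : forall w, Cmod w < 3 * r -> hs w <> 0).
    { intros w Hw. unfold hs. apply Cmult_neq_0. intros X. apply RtoC_inj in X. lra. apply Hnz. lra. }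
    destruct (hol_log (3 * r) hs) as (L & HL & HLr & HLd); auto. lra. apply entire_hol; auto.
    (* With [|z| <= r] and the circle of radius [2 * r], the constant is at most
       [4 * (2 * r) / r^2 = 8 / r]. *)
    assert (BC := borel_caratheodory (3 * r) (2 * r) L z K HL ltac:(lra) ltac:(lra)).
    assert (BC2 : Cmod (C_derive h z / h z) <= 8 / r * (K - ln (Cmod (u 0)))).
    { rewrite HLd in BC by lra.
      assert (Eh : C_derive hs z / hs z = C_derive h z / h z).
      { assert (X : C_derive hs z = RtoC ((6 * r) ^ N) * C_derive h z).
        { apply cderiv_unique_C. apply cderiv_scal. apply entire_cderiv; auto. }
        rewrite X. unfold hs. field. split; auto. intros Y. apply RtoC_inj in Y. lra. }
      rewrite Eh in BC. eapply Rle_trans. apply BC.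
      - intros t. rewrite HLr by (rewrite Cmod_circ; lra). rewrite <- (ln_exp K). apply ln_le.
        apply Cmod_gt_0. apply hs_nz. rewrite Cmod_circ; lra. apply up. rewrite Cmod_circ; lra.
      - rewrite HLr by (rewrite Cmod_0; lra).
        assert (X : ln (Cmod (u 0)) <= ln (Cmod (hs 0))).
        { apply ln_le; auto. eapply Rle_trans; [|exact lo]. rewrite <- (Rmult_1_r (Cmod (u 0))) at 1. apply Rmult_le_compat_l; lra. }
        assert (Y : (ln (Cmod (hs 0)) <= K)%R).
        { rewrite <- (ln_exp K). apply ln_le. apply Cmod_gt_0. apply hs_nz. rewrite Cmod_0; lra. apply up. rewrite Cmod_0; lra. }
        apply Rmult_le_compat. 
        + apply Rmult_le_pos. lra. left. apply Rinv_0_lt_compat. assert (0 < 2 * r - Cmod z) by lra. apply Rmult_lt_0_compat; auto.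
        + lra.
        + apply Rle_trans with (4 * (2 * r) * / (r * r))%R.
          apply Rmult_le_compat_l. lra. apply Rinv_le_contravar. apply Rmult_lt_0_compat; auto. apply Rmult_le_compat; lra.
          right. field. lra.
        + lra. }
    assert (D : C_derive u z = C_derive (Qprod Z) z * h z + Qprod Z z * C_derive h z).
    { apply cderiv_unique_C. apply cderiv_ext with (fun w => Qprod Z w * h w). auto.
      apply cderiv_mult; apply entire_cderiv; auto. apply entire_Qprod. }
    assert (QL := Qprod_log_derivative Z z del Hdel Hda).
    rewrite D, E. rewrite Rmult_plus_distr_l. eapply Rle_trans. apply Cmod_triangle. rewrite !Cmod_mult.
    assert (0 <= Cmod (h z)) by apply Cmod_ge_0. assert (0 <= Cmod (Qprod Z z)) by apply Cmod_ge_0.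
    apply Rplus_le_compat.
    + rewrite (Rmult_comm (Cmod (Qprod Z z)) (Cmod (h z))), Rmult_comm, Rmult_assoc. apply Rmult_le_compat_l; auto.
    + rewrite Rmult_assoc. apply Rmult_le_compat_l; auto.
      replace (C_derive h z) with (h z * (C_derive h z / h z)) by (field; auto). rewrite Cmod_mult. apply Rmult_le_compat_l; auto.
Qed.

(** * Jensen and Poisson inequalities for entire functions *)

(** The denominator of a Blaschke product: [Qprod l / bprod l rho] is the Blaschke product of the
    disc of radius [rho] with zeros [l]. *)
Definition bprod (l : list C) (rho : R) (z : C) : C :=
  fold_right (fun a acc => ((RtoC (rho * rho) - Cconj a * z) / RtoC rho) * acc) 1 l.

(** The right-hand side is nonnegative for [a] and [z] in the closed disc and 0 on the circle, which
    gives both halves of [bprod_ge]. *)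
Lemma Cmod_reflect (rho : R) (a z : C) : 0 < rho ->
  (Cmod ((RtoC (rho * rho) - Cconj a * z) / RtoC rho) ^ 2 - Cmod (z - a) ^ 2
   = (rho ^ 2 - Cmod a ^ 2) * (rho ^ 2 - Cmod z ^ 2) / rho ^ 2)%R.
Proof.
  intros Hr. rewrite Cmod_div by (intros X; apply RtoC_inj in X; lra).
  rewrite Cmod_R, (Rabs_right rho) by lra. unfold Rdiv at 1. rewrite Rpow_mult_distr, pow_inv.
  rewrite !Cmod2_alt. destruct a as [a1 a2], z as [z1 z2]. unfold Cconj. simpl. field. lra.
Qed.

Lemma bprod_entire l rho : entire (bprod l rho).
Proof.
  induction l; simpl. apply entire_const.
  apply (entire_mult (fun z => (RtoC (rho * rho) - Cconj a * z) / RtoC rho) (bprod l rho)); auto.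
  apply (entire_mult (fun z => RtoC (rho * rho) - Cconj a * z) (fun _ => / RtoC rho)). 2: apply entire_const.
  apply (entire_minus (fun _ => RtoC (rho * rho)) (fun z => Cconj a * z)). apply entire_const.
  apply (entire_mult (fun _ => Cconj a) (fun z => z)). apply entire_const. apply entire_id.
Qed.

Lemma bprod_ge l rho (z : C) : 0 < rho -> Cmod z <= rho -> (forall a, In a l -> Cmod a <= rho) ->
  Cmod (Qprod l z) <= Cmod (bprod l rho z) /\ (Cmod z = rho -> Cmod (Qprod l z) = Cmod (bprod l rho z)).
Proof.
  intros Hr Hz. induction l; intros Hl; simpl. split; auto; lra.
  rewrite !Cmod_mult.
  destruct IHl as [I1 I2]. intros; apply Hl; right; auto.
  assert (Ha := Hl a (or_introl eq_refl)).
  assert (X := Cmod_reflect rho a z Hr).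
  set (b := Cmod ((RtoC (rho * rho) - Cconj a * z) / RtoC rho)) in *.
  assert (b0 : 0 <= b) by apply Cmod_ge_0. assert (c0 := Cmod_ge_0 (z - a)).
  assert (a0 := Cmod_ge_0 a). assert (z0 := Cmod_ge_0 z).
  split.
  - apply Rmult_le_compat; auto; try apply Cmod_ge_0.
    assert (P : (0 <= (rho ^ 2 - Cmod a ^ 2) * (rho ^ 2 - Cmod z ^ 2) / rho ^ 2)%R).
    { apply Rmult_le_pos. apply Rmult_le_pos; simpl; nra. left. apply Rinv_0_lt_compat. apply pow_lt; auto. }
    apply Rnot_lt_le. intros Q. simpl in *. nra.
  - intros Ez. rewrite <- I2 by auto. f_equal. rewrite Ez in X.
    replace (rho ^ 2 - rho ^ 2)%R with 0%R in X by ring. rewrite Rmult_0_r in X. unfold Rdiv in X. rewrite Rmult_0_l in X.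
    apply Rsqr_inj; auto. unfold Rsqr. simpl in X. lra.
Qed.

Lemma bprod_nonzero l rho : 0 < rho -> (forall a, In a l -> Cmod a < rho) ->
  exists r, rho < r /\ forall z, Cmod z < r -> bprod l rho z <> 0.
Proof.
  intros Hr. induction l; intros Hl; simpl.
  - exists (rho + 1)%R. split. lra. intros. apply C1_nz.
  - destruct IHl as [r [Hr1 Hnz]]. intros; apply Hl; right; auto.
    assert (Ha := Hl a (or_introl eq_refl)). assert (a0 := Cmod_ge_0 a).
    set (m := ((Cmod a + rho) / 2)%R). assert (Hm : 0 < m) by (unfold m; lra).
    exists (Rmin r (rho * rho / m)). split.
    + apply Rmin_glb_lt; auto. apply Rmult_lt_reg_r with m; auto. unfold Rdiv. rewrite Rmult_assoc, Rinv_l, Rmult_1_r by lra.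
      apply Rmult_lt_compat_l; auto. unfold m; lra.
    + intros z Hz. apply Cmult_neq_0.
      * assert (V := Rlt_le_trans _ _ _ Hz (Rmin_r _ _)). intros E.
        assert (E2 : RtoC (rho * rho) = Cconj a * z).
        { apply Ceq_minus. assert (RtoC rho <> 0) by (intros X; apply RtoC_inj in X; lra).
          replace (RtoC (rho * rho) - Cconj a * z) with ((RtoC (rho * rho) - Cconj a * z) / RtoC rho * RtoC rho) by (field; auto).
          rewrite E. ring. }
        apply (f_equal Cmod) in E2. rewrite Cmod_R, Cmod_mult, Cmod_conj, Rabs_right in E2 by nra.
        apply Rmult_lt_compat_r with (r := m) in V; auto.
        unfold Rdiv in V. rewrite Rmult_assoc, Rinv_l, Rmult_1_r in V by lra.
        assert (0 <= Cmod z) by apply Cmod_ge_0. unfold m in V. nra.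
      * apply Hnz. eapply Rlt_le_trans. exact Hz. apply Rmin_l.
Qed.

(** Replacing the zeros of [f] in the disc by their reflections gives a function without zeros near
    the closed disc, equal to [f] in modulus on the circle and at least as large inside. Its
    logarithm yields Jensen's and Poisson's inequalities without logarithmic singularities. *)
Lemma blaschke_log f rho : entire f -> nz f -> 0 < rho -> (forall z, Cmod z = rho -> f z <> 0) ->
  exists L r, rho < r /\ hol r L /\ (forall t, Re (L (circ rho t)) = ln (Cmod (f (circ rho t)))) /\
    forall z, Cmod z <= rho -> f z <> 0 -> ln (Cmod (f z)) <= Re (L z).
Proof.
  intros Hf Nf Hr Hc.
  destruct (factor_zeros (fun z => Cmod z <= rho) rho f) as (l & h & Hh & Hl & E & Hnz); auto.
  assert (Hl2 : forall a, In a l -> Cmod a < rho).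
  { intros a Ha. destruct (Hl a Ha) as [X|X]; auto. exfalso. apply (Hc a X). rewrite E, Qprod_zero by auto. ring. }
  (* The remaining zeros in the larger disc are finite in number and lie strictly outside the closed
     disc of radius [rho], so a slightly larger disc avoids them all. *)
  destruct (factor_zeros (fun z => Cmod z <= 2 * rho) (2 * rho) h) as (l2 & h2 & Hh2 & Hl2' & E2 & Hnz2); auto.
  { exists 0. apply Hnz. rewrite Cmod_0. lra. }
  assert (R2 : exists r, rho < r /\ forall a, In a l2 -> r <= Cmod a).
  { assert (Q : forall a, In a l2 -> rho < Cmod a).
    { intros a Ha. apply Rnot_le_lt. intros X. apply (Hnz a X). rewrite E2, Qprod_zero by auto. ring. }
    clear - Q. induction l2. exists (rho + 1)%R. split. lra. intros a [].
    destruct IHl2 as [r [H1 H2]]. intros; apply Q; right; auto.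
    exists (Rmin r (Cmod a)). split. apply Rmin_glb_lt; auto. apply Q; left; auto.
    intros b [<-|Hb]. apply Rmin_r. eapply Rle_trans. apply Rmin_l. auto. }
  destruct R2 as [r2 [Hr2 Hr2']].
  destruct (bprod_nonzero l rho Hr Hl2) as [r3 [Hr3 Hnz3]].
  set (r := Rmin (Rmin r2 r3) (2 * rho)).
  assert (Hrr : rho < r) by (repeat apply Rmin_glb_lt; lra).
  set (ht := fun z => h z * bprod l rho z).
  assert (Hht : entire ht) by (apply entire_mult; auto; apply bprod_entire).
  assert (htnz : forall z, Cmod z < r -> ht z <> 0).
  { intros z Hz. unfold r in Hz.
    assert (Z1 := Rlt_le_trans _ _ _ Hz (Rmin_r _ _)). assert (Z2 := Rlt_le_trans _ _ _ Hz (Rmin_l _ _)).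
    assert (Z3 := Rlt_le_trans _ _ _ Z2 (Rmin_l _ _)). assert (Z4 := Rlt_le_trans _ _ _ Z2 (Rmin_r _ _)).
    apply Cmult_neq_0; auto. rewrite E2. apply Cmult_neq_0. apply Qprod_nonzero. intros X. apply Hr2' in X. lra. apply Hnz2. lra. }
  destruct (hol_log r ht) as (L & HL & HLr & _); auto. lra. apply entire_hol; auto.
  exists L, r. split; auto. split; auto.
  assert (Hl3 : forall a, In a l -> Cmod a <= rho) by (intros a Ha; left; auto).
  split.
  - intros t. rewrite HLr by (rewrite Cmod_circ; lra). f_equal. unfold ht. rewrite E, !Cmod_mult.
    destruct (bprod_ge l rho (circ rho t)) as [_ B]; auto. rewrite Cmod_circ; lra. rewrite B. ring. apply Cmod_circ; lra.
  - intros z Hz Hfz. rewrite HLr by lra. apply ln_le. apply Cmod_gt_0; auto.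
    unfold ht. rewrite E, !Cmod_mult, Rmult_comm. apply Rmult_le_compat_l. apply Cmod_ge_0.
    apply bprod_ge; auto.
Qed.

Lemma continuous_ln_Cmod (g : R -> C) t : ccont dR g t -> g t <> 0 -> continuous (fun t => ln (Cmod (g t))) t.
Proof.
  intros H Hn. apply continuity_pt_filterlim.
  apply (continuity_pt_comp (fun t => Cmod (g t)) ln). apply ccont_Cmod; auto.
  apply derivable_continuous_pt. exists (/ Cmod (g t))%R. apply derivable_pt_lim_ln. apply Cmod_gt_0; auto.
Qed.

Lemma circ_entire_cont f rho t : entire f -> 0 <= rho -> ccont dR (fun t => f (circ rho t)) t.
Proof. intros Hf Hr. apply hol_circ_cont with (rho + 1)%R. apply entire_hol; auto. lra. Qed.

(* Jensen's inequality for [V] and Poisson's for [f], played against each other on one circle. *)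
Lemma growth_from_circle f V rho S : entire f -> entire V -> nz f -> V 0 <> 0 -> 0 < rho ->
  (forall z, Cmod z = rho -> f z <> 0 /\ V z <> 0 /\ Cmod (V z) * (1 + Cmod (f z)) <= exp S) ->
  forall z, Cmod z <= rho / 2 -> Cmod (f z) <= exp (3 * (S - ln (Cmod (V 0)))).
Proof.
  intros Hf HV Nf NV Hr H z Hz. assert (HPI := PI_RGT_0).
  destruct (Ceq_dec (f z) 0) as [E|Hfz]. { rewrite E, Cmod_0. left; apply exp_pos. }
  destruct (blaschke_log f rho) as (L & r & Hrr & HL & HL1 & HL2); auto.
  { intros w Hw. apply (H w Hw). }
  destruct (blaschke_log V rho) as (M & r' & Hrr' & HM & HM1 & HM2); auto.
  { exists 0; auto. } { intros w Hw. apply (H w Hw). }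
  assert (J : (2 * PI * ln (Cmod (V 0)) <= RInt (fun t => ln (Cmod (V (circ rho t)))) 0 (2 * PI))%R).
  { assert (X := mean_value_Re r' rho M HM ltac:(lra)).
    rewrite (RInt_ext _ (fun t => ln (Cmod (V (circ rho t))))) in X by (intros; apply HM1).
    rewrite X. apply Rmult_le_compat_l. lra. apply HM2; auto. rewrite Cmod_0; lra. }
  (* The term [1 +] in the hypothesis makes this majorant nonnegative, as [poisson_ineq]
     requires. *)
  set (k := fun t => minus S (ln (Cmod (V (circ rho t))))).
  assert (cV : forall t, continuous (fun t => ln (Cmod (V (circ rho t)))) t).
  { intros t. apply (continuous_ln_Cmod (fun t => V (circ rho t))). apply circ_entire_cont; auto; lra. apply H. apply Cmod_circ; lra. }
  assert (kb : forall t, ln (1 + Cmod (f (circ rho t))) <= k t).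
  { intros t. destruct (H (circ rho t)) as (H1 & H2 & H3). apply Cmod_circ; lra.
    apply Cmod_gt_0 in H2. assert (f0 := Cmod_ge_0 (f (circ rho t))).
    apply ln_le in H3; [|apply Rmult_lt_0_compat; lra]. rewrite ln_exp, ln_mult in H3 by lra.
    unfold k, minus, plus, opp; simpl. lra. }
  assert (P := poisson_ineq r rho L z k HL ltac:(lra) Hz).
  assert (PP : (2 * PI * Re (L z) <= 3 * RInt k 0 (2 * PI))%R).
  { apply P.
    - intros t. apply (continuous_minus (K := R_AbsRing) (V := R_NormedModule)). apply continuous_const. auto.
    - intros t. eapply Rle_trans; [|apply kb]. rewrite <- ln_1. apply ln_le. lra. generalize (Cmod_ge_0 (f (circ rho t))); lra.
    - intros t. eapply Rle_trans; [|apply kb]. rewrite HL1. apply ln_le. apply Cmod_gt_0. apply H. apply Cmod_circ; lra. lra. }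
  assert (Ik : RInt k 0 (2 * PI) = (2 * PI * S - RInt (fun t => ln (Cmod (V (circ rho t)))) 0 (2 * PI))%R).
  { unfold k. etransitivity. apply (RInt_minus (V := R_CompleteNormedModule)). apply ex_RInt_const. apply RInt_circ_continuous; auto.
    rewrite RInt_const. unfold minus, plus, opp, scal; simpl; unfold mult; simpl. ring. }
  assert (Lz := HL2 z ltac:(lra) Hfz).
  assert (X : (ln (Cmod (f z)) <= 3 * (S - ln (Cmod (V 0))))%R).
  { apply Rmult_le_reg_l with (2 * PI)%R. lra.
    apply Rmult_le_compat_l with (r := (2 * PI)%R) in Lz; lra. }
  rewrite <- (exp_ln (Cmod (f z))) by (apply Cmod_gt_0; auto). destruct X as [X|X]. left; apply exp_increasing; auto. rewrite X; lra.
Qed.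

(** The classical comparison [log M(rho/2) <= 3 T(rho)], here for circles free of zeros. *)
Lemma growth_from_char f rho : entire f -> nz f -> 0 < rho -> (forall z, Cmod z = rho -> f z <> 0) ->
  forall z, Cmod z <= rho / 2 -> Cmod (f z) <= exp (3 * char_entire f rho).
Proof.
  intros Hf Nf Hr Hc z Hz. assert (HPI := PI_RGT_0).
  destruct (Ceq_dec (f z) 0) as [E|Hfz]. { rewrite E, Cmod_0. left; apply exp_pos. }
  destruct (blaschke_log f rho) as (L & r & Hrr & HL & HL1 & HL2); auto.
  set (k := fun t => logp (Cmod (f (circ rho t)))).
  assert (P : (2 * PI * Re (L z) <= 3 * RInt k 0 (2 * PI))%R).
  { apply (poisson_ineq r rho L z k HL); auto.
    - intros t. unfold k, logp.
      apply continuous_ext with (fun t => (/ 2 * (ln (Cmod (f (circ rho t))) + Rabs (ln (Cmod (f (circ rho t))))))%R).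
      { intros x. unfold Rmax, Rabs. destruct (Rle_dec 0 (ln (Cmod (f (circ rho x))))), (Rcase_abs (ln (Cmod (f (circ rho x))))); lra. }
      assert (c : continuous (fun t => ln (Cmod (f (circ rho t)))) t).
      { apply (continuous_ln_Cmod (fun t => f (circ rho t))). apply circ_entire_cont; auto; lra. apply Hc. apply Cmod_circ; lra. }
      apply (continuous_scal_r (K := R_AbsRing) (V := R_NormedModule)). apply (continuous_plus (K := R_AbsRing) (V := R_NormedModule)); auto.
      apply (continuous_comp (fun t => ln (Cmod (f (circ rho t)))) Rabs); auto. apply continuous_Rabs.
    - intros t. apply Rmax_l.
    - intros t. rewrite HL1. apply Rmax_r. }
  assert (Lz := HL2 z ltac:(lra) Hfz).
  assert (X : (ln (Cmod (f z)) <= 3 * char_entire f rho)%R).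
  { unfold char_entire. change (fun t => logp (Cmod (f (rho * cos t, rho * sin t)%R))) with k.
    apply Rmult_le_reg_l with (2 * PI)%R. lra.
    replace (2 * PI * (3 * (/ (2 * PI) * RInt k 0 (2 * PI))))%R with (3 * RInt k 0 (2 * PI))%R by (field; lra).
    apply Rmult_le_compat_l with (r := (2 * PI)%R) in Lz; lra. }
  rewrite <- (exp_ln (Cmod (f z))) by (apply Cmod_gt_0; auto). destruct X as [X|X]. left; apply exp_increasing; auto. rewrite X; lra.
Qed.

(** * Growth of entire functions controlled by logarithmic derivatives *)

Lemma avoid_list (Y : list R) a b : a < b -> exists x, a < x < b /\ ~ In x Y.
Proof.
  intros Hab.
  assert (H : exists c d, a <= c /\ c < d /\ d <= b /\ forall y, In y Y -> ~ (c < y < d)).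
  { induction Y as [|y Y IH]. exists a, b. repeat split; try lra. intros y [].
    destruct IH as (c & d & H1 & H2 & H3 & H4).
    destruct (Rle_dec y ((c + d) / 2)).
    - exists ((c + d) / 2)%R, d. repeat split; try lra. intros x [<-|Hx] Q. lra. apply (H4 x Hx). lra.
    - exists c, ((c + d) / 2)%R. repeat split; try lra. intros x [<-|Hx] Q. lra. apply (H4 x Hx). lra. }
  destruct H as (c & d & H1 & H2 & H3 & H4). exists ((c + d) / 2)%R. split. lra.
  intros X. apply (H4 _ X). lra.
Qed.

(** Pigeonhole: of [N + 1] candidates with spacing [s], each element of [X] is closer than [s/2] to
    at most one, so some candidate is at distance at least [s/2] from all of [X]. *)
Lemma good_radius (X Y : list R) (r : R) : 0 < r -> exists rho, r <= rho <= 2 * r /\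
  (forall x, In x X -> r / (4 * (INR (length X) + 1)) <= Rabs (rho - x)) /\ ~ In rho Y.
Proof.
  intros Hr. set (N := length X). set (s := (r / (INR N + 1))%R).
  assert (HN := pos_INR N).
  assert (Hs : 0 < s) by (apply Rdiv_lt_0_compat; lra).
  set (c := fun k : nat => (r + INR k * s)%R).
  assert (Hk : exists k, (k <= N)%nat /\ forall x, In x X -> s / 2 <= Rabs (c k - x)).
  { apply NNPP. intros Hno.
    assert (H : forall k, exists x, (k <= N)%nat -> In x X /\ Rabs (c k - x) < s / 2).
    { intros k. destruct (classic (k <= N)%nat) as [Hk|Hk]; [|exists 0%R; tauto].
      apply NNPP. intros Q. apply Hno. exists k. split; auto. intros x Hx. apply Rnot_lt_le. intros P. apply Q. exists x; auto. }
    set (g := fun k => proj1_sig (constructive_indefinite_description _ (H k))).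
    assert (Hg : forall k, (k <= N)%nat -> In (g k) X /\ Rabs (c k - g k) < s / 2).
    { intros k. unfold g. apply (proj2_sig (constructive_indefinite_description _ (H k))). }
    assert (ND : NoDup (map g (seq 0 (S N)))).
    { assert (inj : forall i j, (i < j <= N)%nat -> g i <> g j).
      { intros i j Hij E. destruct (Hg i ltac:(lia)) as [_ A]. destruct (Hg j ltac:(lia)) as [_ B]. rewrite E in A.
        apply Rabs_def2 in A. apply Rabs_def2 in B. unfold c in *.
        assert (Q : INR i + 1 <= INR j) by (rewrite <- S_INR; apply le_INR; lia).
        assert ((INR i + 1) * s <= INR j * s)%R by (apply Rmult_le_compat_r; lra). lra. }
      apply NoDup_nth with (d := g 0%nat). rewrite length_map, length_seq. intros i j Hi Hj E.
      rewrite !map_nth, !seq_nth in E by auto. simpl in E.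
      destruct (Nat.lt_trichotomy i j) as [L|[L|L]]; auto; exfalso.
      apply (inj i j); auto; lia. apply (inj j i); auto; lia. }
    assert (I : incl (map g (seq 0 (S N))) X).
    { intros x Hx. apply in_map_iff in Hx. destruct Hx as [k [<- Hk]]. apply in_seq in Hk. apply Hg. lia. }
    assert (L := NoDup_incl_length ND I). rewrite length_map, length_seq in L. fold N in L. lia. }
  destruct Hk as [k [Hk HkX]].
  (* Half of the margin [s/2] is spent on avoiding the points of [Y], from which no quantitative
     distance is required. *)
  destruct (avoid_list Y (c k) (c k + s / 4)) as [rho [Hrho HY]]. lra.
  assert (Hck : r <= c k <= 2 * r - s).
  { unfold c. assert (INR k <= INR N) by (apply le_INR; auto).
    assert (0 <= INR k * s)%R by (apply Rmult_le_pos; [apply pos_INR|lra]).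
    assert (INR k * s <= INR N * s)%R by (apply Rmult_le_compat_r; lra).
    assert (INR N * s = r - s)%R by (unfold s; field; lra). lra. }
  exists rho. split. lra. split; auto.
  intros x Hx. specialize (HkX x Hx).
  replace (r / (4 * (INR N + 1)))%R with (s / 4)%R by (unfold s; field; lra).
  assert (T := Rabs_triang (rho - x) (c k - rho)). replace (rho - x + (c k - rho))%R with (c k - x)%R in T by ring.
  assert (Rabs (c k - rho) <= s / 4) by (apply Rabs_le; lra). lra.
Qed.

Definition bounded_by (f : C -> C) (r M : R) : Prop := forall z, Cmod z <= r -> Cmod (f z) <= M.

(** The logarithm of the maximum modulus of [u] is at most linear in that of [f], at a radius
    enlarged by a constant. A shift of the radius is what translates and derivatives cost, and
    shifts add up under composition of the rules. *)
Definition dominated (f u : C -> C) : Prop :=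
  exists A d : R, 1 <= A /\ 0 <= d /\
    forall r K, 1 <= r -> 1 <= K -> bounded_by f (r + d) (exp K) -> bounded_by u r (exp (A * K)).

(** The lists of zeros of all the [u] are concatenated, so a single separation condition controls
    all logarithmic derivatives at once. *)
Lemma log_derivatives_bound f us :
  (forall u, In u us -> entire u /\ u 0 <> 0 /\ dominated f u) ->
  exists c r1 : R, 1 <= c /\ 1 <= r1 /\ forall r K, r1 <= r -> 1 <= K -> bounded_by f (72 * r) (exp K) ->
    exists Z : list C, INR (length Z) <= c * K /\
      forall z del, Cmod z <= 4 * r -> 0 < del -> (forall a, In a Z -> del <= Cmod (z - a)) ->
        forall u, In u us -> u z <> 0 /\ Cmod (C_derive u z) <= (c * K / del + c * K) * Cmod (u z).
Proof.
  assert (L2 : 0 < ln 2) by (rewrite <- ln_1; apply ln_increasing; lra).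
  assert (L2' : ln 2 < 1).
  { rewrite <- (ln_exp 1). apply ln_increasing. lra. assert (X := exp_ineq1 1). lra. }
  induction us as [|u us IH]; intros H.
  - exists 1%R, 1%R. repeat split; try lra. intros. exists []. split. simpl. lra. intros ? ? ? ? ? ? [].
  - destruct IH as (c & r1 & Hc & Hr1 & IH). intros; apply H; right; auto.
    destruct (H u (or_introl eq_refl)) as (Hu & Hu0 & (A & d & HA & Hd & Hdom)).
    set (b := (A + Rabs (ln (Cmod (u 0))))%R).
    assert (Hb : 1 <= b) by (unfold b; generalize (Rabs_pos (ln (Cmod (u 0)))); lra).
    exists (c + 2 * b / ln 2)%R, (r1 + d)%R.
    assert (b2 : 2 * b <= 2 * b / ln 2).
    { apply Rmult_le_reg_r with (ln 2); auto. replace (2 * b / ln 2 * ln 2)%R with (2 * b)%R by (field; lra). nra. }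
    split. lra. split. lra.
    intros r K Hr HK HB.
    destruct (IH r K ltac:(lra) HK HB) as (Z & HZ & HZb).
    (* The logarithmic derivative on radius [4 * r] needs [u] up to [36 * r]. The shift [d] is at
       most [r], so [72 * r] leaves ample room for it. *)
    assert (HuB : bounded_by u (9 * (4 * r)) (exp (A * K))).
    { apply Hdom; auto. lra. intros z Hz. apply HB. lra. }
    destruct (log_derivative_bound u (4 * r) (A * K) Hu Hu0 ltac:(lra) HuB) as (Zu & _ & HZu & HZub).
    assert (Kb : (A * K - ln (Cmod (u 0)) <= b * K)%R).
    { unfold b. rewrite Rmult_plus_distr_r. assert (X := Rle_abs (- ln (Cmod (u 0)))). rewrite Rabs_Ropp in X.
      assert (Rabs (ln (Cmod (u 0))) * 1 <= Rabs (ln (Cmod (u 0))) * K)%R by (apply Rmult_le_compat_l; [apply Rabs_pos|lra]). lra. }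
    assert (HZu2 : (INR (length Zu) <= b / ln 2 * K)%R).
    { apply Rmult_le_reg_r with (ln 2); auto. replace (b / ln 2 * K * ln 2)%R with (b * K)%R by (field; lra). lra. }
    assert (bl : b / ln 2 <= 2 * b / ln 2).
    { unfold Rdiv. apply Rmult_le_compat_r. left; apply Rinv_0_lt_compat; auto. lra. }
    assert (blK : (b / ln 2 * K <= 2 * b / ln 2 * K)%R) by (apply Rmult_le_compat_r; lra).
    exists (Z ++ Zu). split.
    { rewrite length_app, plus_INR. lra. }
    intros z del Hz Hdel Hda v [<-|Hv].
    + destruct (HZub z del Hz Hdel) as [N D]. { intros a Ha. apply Hda. apply in_or_app; auto. }
      split; auto. eapply Rle_trans. exact D. rewrite Rmult_comm. apply Rmult_le_compat_r. apply Cmod_ge_0.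
      apply Rplus_le_compat.
      * apply Rmult_le_compat_r. left; apply Rinv_0_lt_compat; auto.
        eapply Rle_trans. exact HZu2. rewrite Rmult_plus_distr_r. assert (0 <= c * K)%R by nra. lra.
      * assert (8 / (4 * r) <= 2).
        { apply Rmult_le_reg_r with (4 * r)%R. lra. unfold Rdiv. rewrite Rmult_assoc, Rinv_l; lra. }
        assert (8 / (4 * r) * (A * K - ln (Cmod (u 0))) <= 2 * (b * K))%R.
        { apply Rmult_le_compat; auto. left; apply Rdiv_lt_0_compat; lra.
          assert (0 <= INR (length Zu) * ln 2)%R by (apply Rmult_le_pos; [apply pos_INR|lra]). lra. }
        assert (2 * b * K <= 2 * b / ln 2 * K)%R by (apply Rmult_le_compat_r; lra).
        assert (0 <= c * K)%R by nra. lra.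
    + destruct (HZb z del Hz Hdel) with (u := v) as [N D]; auto. { intros a Ha. apply Hda. apply in_or_app; auto. }
      split; auto. eapply Rle_trans. exact D. apply Rmult_le_compat_r. apply Cmod_ge_0.
      assert (c * K <= (c + 2 * b / ln 2) * K)%R by (apply Rmult_le_compat_r; lra).
      apply Rplus_le_compat; auto. apply Rmult_le_compat_r; auto. left; apply Rinv_0_lt_compat; auto.
Qed.

Lemma zero_moduli f r : entire f -> nz f -> exists Y : list R, forall z, Cmod z <= r -> f z = 0 -> In (Cmod z) Y.
Proof.
  intros Hf Nf. destruct (factor_zeros (fun z => Cmod z <= r) r f) as (l & h & Hh & Hl & E & Hnz); auto.
  exists (map Cmod l). intros z Hz E0. apply in_map. apply Qprod_zero_inv.
  rewrite E in E0. apply NNPP. intros X. apply (Cmult_neq_0 _ _ X (Hnz z Hz) E0).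
Qed.

(** Some circle of radius between [2 * r] and [4 * r] keeps a distance of order [r / (N + 1)] from
    the [N = O(K)] exceptional points. On it the logarithmic derivatives are [O(K^2)], and
    [growth_from_circle] turns this power into the logarithm of [K]. *)
Lemma log_growth_centered f us V (C0 : R) (p : nat) : entire f -> nz f -> entire V -> V 0 <> 0 ->
  (forall u, In u us -> entire u /\ u 0 <> 0 /\ dominated f u) ->
  (forall z L, 1 <= L -> (forall u, In u us -> u z <> 0 /\ Cmod (C_derive u z) <= L * Cmod (u z)) ->
     Cmod (V z) * (1 + Cmod (f z)) <= exp C0 * L ^ p) ->
  exists A r1 : R, 0 <= A /\ 1 <= r1 /\ forall r K, r1 <= r -> 1 <= K -> bounded_by f (72 * r) (exp K) ->
    bounded_by f r (exp (A * (1 + ln K))).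
Proof.
  intros Hf Nf HV NV Hus Hineq.
  destruct (log_derivatives_bound f us Hus) as (c & r1 & Hc & Hr1 & HL).
  set (B := (Rabs C0 + INR p * ln (5 * c * c) + Rabs (ln (Cmod (V 0))))%R).
  assert (lnc : 0 <= ln (5 * c * c)). { rewrite <- ln_1. apply ln_le. lra. nra. }
  assert (Hp := pos_INR p).
  assert (B0 : 0 <= B).
  { unfold B. generalize (Rabs_pos C0) (Rabs_pos (ln (Cmod (V 0)))) (Rmult_le_pos _ _ Hp lnc). lra. }
  exists (3 * (B + 2 * INR p))%R, r1. split. lra. split. lra.
  intros r K Hr HK HB z Hz.
  destruct (HL r K Hr HK HB) as (Z & HZ & HZb).
  destruct (zero_moduli f (4 * r) Hf Nf) as [Y1 HY1].
  destruct (zero_moduli V (4 * r) HV) as [Y2 HY2]. exists 0; auto.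
  destruct (good_radius (map Cmod Z) (Y1 ++ Y2) (2 * r)) as (rho & Hrho & Hsep & Hav). lra.
  rewrite length_map in Hsep. set (N := INR (length Z)) in *.
  assert (N0 : 0 <= N) by apply pos_INR.
  set (del := (2 * r / (4 * (N + 1)))%R) in *.
  assert (Hdel : 0 < del) by (apply Rdiv_lt_0_compat; lra).
  assert (cK : 1 <= c * K) by nra.
  assert (idel : / del <= 4 * (c * K)).
  { unfold del, Rdiv. rewrite Rinv_mult, Rinv_inv. apply Rle_trans with (/ 2 * (4 * (N + 1)))%R.
    apply Rmult_le_compat_r. lra. apply Rinv_le_contravar; lra. lra. }
  (* Since [1/del <= 4 * c * K], the first summand is at most [4 * (c * K)^2] and the second at most
     [(c * K)^2]. *)
  set (L := (5 * c * c * (K * K))%R).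
  assert (HLe : c * K / del + c * K <= L).
  { unfold L. assert (c * K / del <= c * K * (4 * (c * K)))%R by (apply Rmult_le_compat_l; lra).
    assert (c * K * 1 <= c * K * (c * K))%R by (apply Rmult_le_compat_l; lra). lra. }
  assert (L1 : 1 <= L). { assert (0 <= c * K / del)%R by (apply Rmult_le_pos; [lra|left; apply Rinv_0_lt_compat; auto]). lra. }
  assert (lnK : 0 <= ln K) by (rewrite <- ln_1; apply ln_le; lra).
  assert (EL : (ln L = ln (5 * c * c) + 2 * ln K)%R).
  { unfold L. rewrite !ln_mult; try lra; try nra. }
  eapply Rle_trans. apply (growth_from_circle f V rho (C0 + INR p * ln L)); auto; try lra.
  - intros w Hw. split; [|split].
    + intros E. apply Hav. apply in_or_app. left. rewrite <- Hw. apply HY1; auto. lra.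
    + intros E. apply Hav. apply in_or_app. right. rewrite <- Hw. apply HY2; auto. lra.
    + rewrite exp_plus. replace (exp (INR p * ln L)) with (L ^ p)%R.
      * apply Hineq; auto. intros u Hu. destruct (HZb w del) with (u := u) as [Q1 Q2]; auto. lra.
        { intros a Ha. eapply Rle_trans. apply (Hsep (Cmod a)). apply in_map; auto. rewrite <- Hw.
          apply Rabs_le. assert (X1 := Cmod_minus_ge w a). assert (X2 := Cmod_minus_ge a w). rewrite (Cmod_minus_sym a) in X2. lra. }
        split; auto. eapply Rle_trans. exact Q2. apply Rmult_le_compat_r; auto. apply Cmod_ge_0.
      * rewrite <- ln_pow by lra. rewrite exp_ln; auto. apply pow_lt; lra.
  - rewrite EL.
    assert (Q : (3 * (C0 + INR p * (ln (5 * c * c) + 2 * ln K) - ln (Cmod (V 0))) <= 3 * (B + 2 * INR p) * (1 + ln K))%R).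
    { assert (X1 := Rle_abs C0). assert (X2 := Rle_abs (- ln (Cmod (V 0)))). rewrite Rabs_Ropp in X2.
      assert (0 <= B * ln K)%R by (apply Rmult_le_pos; auto).
      unfold B in *. nra. }
    destruct Q as [Q|Q]. left; apply exp_increasing; auto. rewrite Q; lra.
Qed.

Lemma common_nonzero us : (forall u, In u us -> entire u /\ nz u) -> exists z, forall u, In u us -> u z <> 0.
Proof.
  intros H. set (P := fun l z => fold_right (fun (u : C -> C) acc => u z * acc) 1 l).
  assert (Q : entire (P us) /\ nz (P us)).
  { induction us as [|u us IH]. split. apply entire_const. exists 0. apply C1_nz.
    destruct IH as [I1 I2]. intros; apply H; right; auto. destruct (H u (or_introl eq_refl)).
    split. apply (entire_mult u (P us)); auto. apply (nz_mult u (P us)); auto. }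
  destruct Q as [_ [z Hz]]. exists z. clear H. induction us as [|u us IH]; intros v []. subst.
  intros E. apply Hz. simpl. rewrite E. ring.
  apply IH; auto. intros E. apply Hz. simpl. change (u z * P us z = 0). rewrite E. ring.
Qed.

Lemma C_derive_shift u z0 z : entire u -> C_derive (fun w => u (w + z0)) z = C_derive u (z + z0).
Proof.
  intros H. apply cderiv_unique_C. eapply cderiv_eq; [|apply (cderiv_comp u (fun w => w + z0));
    [apply entire_cderiv; auto | apply cderiv_plus; [apply cderiv_id | apply cderiv_const]]]. ring.
Qed.

(** The centred version needs [V] and all the [u] to be nonzero at the origin; a translation to a
    common nonzero point [z0] achieves this. *)
Lemma log_growth f us V (C0 : R) (p : nat) : entire f -> nz f -> entire V -> nz V ->
  (forall u, In u us -> entire u /\ nz u /\ dominated f u) ->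
  (forall z L, 1 <= L -> (forall u, In u us -> u z <> 0 /\ Cmod (C_derive u z) <= L * Cmod (u z)) ->
     Cmod (V z) * (1 + Cmod (f z)) <= exp C0 * L ^ p) ->
  exists A r1 : R, 0 <= A /\ 1 <= r1 /\ forall r K, r1 <= r -> 1 <= K -> bounded_by f (288 * r) (exp K) ->
    bounded_by f r (exp (A * (1 + ln K))).
Proof.
  intros Hf Nf HV NV Hus Hineq.
  destruct (common_nonzero (V :: us)) as [z0 Hz0].
  { intros u [<-|Hu]; auto. destruct (Hus u Hu) as (? & ? & ?); auto. }
  set (sh := fun (u : C -> C) z => u (z + z0)).
  assert (m0 := Cmod_ge_0 z0).
  destruct (log_growth_centered (sh f) (map sh us) (sh V) C0 p) as (A & r1 & HA & Hr1 & HG).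
  - apply entire_shift; auto.
  - destruct Nf as [w Hw]. exists (w - z0). unfold sh. replace (w - z0 + z0) with w by ring. auto.
  - apply entire_shift; auto.
  - unfold sh. rewrite Cplus_0_l. apply Hz0. left; auto.
  - intros v Hv. apply in_map_iff in Hv. destruct Hv as [u [<- Hu]]. destruct (Hus u Hu) as (H1 & H2 & (B & d & HB & Hd & Hdom)).
    split. apply entire_shift; auto. split. unfold sh. rewrite Cplus_0_l. apply Hz0. right; auto.
    exists B, (d + 2 * Cmod z0)%R. split; auto. split. lra. intros r K Hr HK Hb z Hz.
    apply (Hdom (r + Cmod z0)%R K); auto. lra.
    + intros w Hw. specialize (Hb (w - z0)). unfold sh in Hb. replace (w - z0 + z0) with w in Hb by ring.
      apply Hb. eapply Rle_trans. apply Cmod_minus_le. lra.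
    + eapply Rle_trans. apply Cmod_triangle. lra.
  - intros z L HL1 HL. apply Hineq; auto. intros u Hu. destruct (HL (sh u)) as [X1 X2]. apply in_map; auto.
    split; auto. unfold sh in X2. rewrite C_derive_shift in X2; auto. apply Hus; auto.
  - exists A, (r1 + Cmod z0)%R. split; auto. split. lra. intros r K Hr HK Hb z Hz.
    (* Translating by [z0] costs at most [r] in the radius, absorbed by one doubling before and one
       after the factor 72: hence [288 = 72 * 2 * 2]. *)
    assert (X := HG (2 * r)%R K ltac:(lra) HK).
    assert (Y : bounded_by (sh f) (72 * (2 * r)) (exp K)).
    { intros w Hw. apply Hb. eapply Rle_trans. apply Cmod_triangle. lra. }
    specialize (X Y (z - z0)). unfold sh in X. replace (z - z0 + z0) with z in X by ring.
    apply X. eapply Rle_trans. apply Cmod_minus_le. lra.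
Qed.

(** * From the hyper-order to polynomial growth *)

Lemma hyper_order_char f : Rbar_lt (hyper_order_entire f) 1 ->
  exists r1 : R, forall r, r1 <= r -> char_entire f r <= exp r.
Proof.
  intros H. unfold hyper_order_entire in H.
  set (E := fun y => exists r0 : R, Lub_Rbar (fun x => exists r : R, r0 <= r /\ x = (ln (ln (char_entire f r)) / ln r)%R) = Finite y) in H.
  assert (X : exists y, y < 1 /\ E y).
  { apply NNPP. intros Q. destruct (Glb_Rbar_correct E) as [_ G].
    assert (Z : Rbar_le 1 (Glb_Rbar E)).
    { apply G. intros y Hy. simpl. apply Rnot_lt_le. intros P. apply Q. exists y; auto. }
    apply (Rbar_lt_not_le _ _ H Z). }
  destruct X as (y & Hy & r0 & Hl).
  exists (Rmax r0 2). intros r Hr.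
  assert (R0 := Rle_trans _ _ _ (Rmax_l r0 2) Hr). assert (R2 := Rle_trans _ _ _ (Rmax_r r0 2) Hr).
  assert (lnr : 0 < ln r) by (rewrite <- ln_1; apply ln_increasing; lra).
  assert (Q : (ln (ln (char_entire f r)) / ln r <= y)%R).
  { destruct (Lub_Rbar_correct (fun x => exists r : R, r0 <= r /\ x = (ln (ln (char_entire f r)) / ln r)%R)) as [U _].
    rewrite Hl in U. apply (U _ (ex_intro _ r (conj R0 eq_refl))). }
  set (T := char_entire f r) in *.
  assert (er : 1 <= exp r). { assert (Z := exp_ineq1_le r). lra. }
  (* For [T <= 1] the value [ln (ln T)] is a default without information, but the claim is immediate
     because [exp r >= 1]. *)
  destruct (Rle_dec T 1) as [|HT]. lra. apply Rnot_le_lt in HT.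
  assert (lT : 0 < ln T) by (rewrite <- ln_1; apply ln_increasing; lra).
  assert (llT : ln (ln T) < ln r).
  { apply Rmult_lt_reg_r with (/ ln r)%R. apply Rinv_0_lt_compat; auto. rewrite Rinv_r by lra. unfold Rdiv in Q. lra. }
  apply ln_lt_inv in llT; auto; [|lra]. rewrite <- (exp_ln T) by lra. left. apply exp_increasing; auto.
Qed.

Lemma hyper_order_growth f : entire f -> nz f -> Rbar_lt (hyper_order_entire f) 1 ->
  exists r1 : R, 1 <= r1 /\ forall r, r1 <= r -> bounded_by f r (exp (exp (4 * r + 2))).
Proof.
  intros Hf Nf H. destruct (hyper_order_char f H) as [r0 Hr0].
  exists (Rmax r0 1). split. apply Rmax_r. intros r Hr z Hz.
  assert (R0 := Rle_trans _ _ _ (Rmax_l r0 1) Hr). assert (R2 := Rle_trans _ _ _ (Rmax_r r0 1) Hr).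
  destruct (zero_moduli f (4 * r) Hf Nf) as [Y HY].
  destruct (avoid_list Y (2 * r) (4 * r)) as (rho & Hrho & Hav). lra.
  eapply Rle_trans. apply (growth_from_char f rho); auto; try lra.
  intros w Hw E. apply Hav. rewrite <- Hw. apply HY; auto. lra.
  assert (X := Hr0 rho ltac:(lra)).
  (* Uses [rho < 4 * r] and [3 <= exp 2]. *)
  assert (Q : 3 * char_entire f rho <= exp (4 * r + 2)).
  { rewrite exp_plus. assert (exp rho <= exp (4 * r)) by (left; apply exp_increasing; lra).
    assert (E2 := exp_ineq1 2 ltac:(lra)). assert (0 < exp (4 * r)) by apply exp_pos. nra. }
  destruct Q as [Q|Q]. left; apply exp_increasing; auto. rewrite Q; lra.
Qed.

(** The comparison of [log_growth] is inserted twice: the double exponential bound becomes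
    exponential in [r], and that one becomes a power of [r]. *)
Lemma log_growth_polynomial f us V (C0 : R) (p : nat) : entire f -> nz f -> Rbar_lt (hyper_order_entire f) 1 ->
  entire V -> nz V ->
  (forall u, In u us -> entire u /\ nz u /\ dominated f u) ->
  (forall z L, 1 <= L -> (forall u, In u us -> u z <> 0 /\ Cmod (C_derive u z) <= L * Cmod (u z)) ->
     Cmod (V z) * (1 + Cmod (f z)) <= exp C0 * L ^ p) ->
  exists l, forall z, f z = peval l z.
Proof.
  intros Hf Nf Hh HV NV Hus Hineq.
  destruct (log_growth f us V C0 p) as (A & r1 & HA & Hr1 & HG); auto.
  destruct (hyper_order_growth f Hf Nf Hh) as (r2 & Hr2 & HH).
  (* The first insertion gives [A * (1 + (4 * 288 * r + 2))]; for [r >= 1] this is at most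
     [1155 * A * r], so 1200 leaves room. *)
  set (B := (A * 1200)%R).
  assert (S1 : forall r, r1 <= r -> r2 <= r -> bounded_by f r (exp (B * r + 1))).
  { intros r X1 X2 z Hz. eapply Rle_trans. apply (HG r (exp (4 * (288 * r) + 2)) X1); auto.
    assert (Z := exp_ineq1_le (4 * (288 * r) + 2)). lra. apply HH. lra.
    rewrite ln_exp. assert (Q : (A * (1 + (4 * (288 * r) + 2)) < B * r + 1)%R) by (unfold B; nra).
    left; apply exp_increasing; auto. }
  assert (B0 : 0 <= B) by (unfold B; lra).
  destruct (nfloor_ex A HA) as [d0 Hd0].
  assert (Hd : A <= INR (S d0)) by (rewrite S_INR; lra).
  set (d := S d0) in *.
  set (Q := (B * 288 + 1)%R). assert (Q1 : 1 <= Q) by (unfold Q; lra).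
  apply (poly_growth f d (exp A * Q ^ d) (r1 + r2)%R); auto.
  intros z Hz. set (r := Cmod z) in *.
  (* Second insertion, with the exponential bound just obtained: the modulus is at most [exp A]
     times the power [A] of a linear function of [r], and [d] rounds [A] up to an integer degree. *)
  assert (X := HG r (B * (288 * r) + 1)%R ltac:(lra)).
  eapply Rle_trans. apply (X ltac:(nra)). apply S1; lra. unfold r; lra.
  rewrite Rmult_plus_distr_l, Rmult_1_r, exp_plus, Rmult_assoc, <- Rpow_mult_distr.
  apply Rmult_le_compat_l. left; apply exp_pos.
  assert (Y : B * (288 * r) + 1 <= Q * r) by (unfold Q; nra).
  assert (Y1 : 1 <= B * (288 * r) + 1) by nra.
  assert (Qr : 1 <= Q * r) by lra.
  assert (lnq : 0 <= ln (Q * r)) by (rewrite <- ln_1; apply ln_le; lra).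
  apply Rle_trans with (exp (INR d * ln (Q * r))).
  - assert (W : (A * ln (B * (288 * r) + 1) <= INR d * ln (Q * r))%R).
    { apply Rle_trans with (A * ln (Q * r))%R. apply Rmult_le_compat_l; auto. apply ln_le; lra. apply Rmult_le_compat_r; auto. }
    destruct W as [W|W]. left; apply exp_increasing; auto. rewrite W; lra.
  - rewrite <- ln_pow by lra. rewrite exp_ln. lra. apply pow_lt; lra.
Qed.

(* Closure properties of domination *)
Create HintDb ent.
#[local] Hint Resolve entire_const entire_id entire_plus entire_minus entire_mult entire_pow entire_Qprod entire_derive : ent.

Lemma exp_le_mono x y : x <= y -> exp x <= exp y.
Proof. intros [H|H]. left; apply exp_increasing; auto. rewrite H; lra. Qed.

Lemma dominated_refl f : dominated f f.
Proof.
  exists 1%R, 0%R. repeat split; try lra. intros r K Hr HK H z Hz. rewrite Rmult_1_l. apply H. lra.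
Qed.

Lemma dominated_const f c : dominated f (fun _ => c).
Proof.
  exists (1 + Cmod c)%R, 0%R. assert (H := Cmod_ge_0 c). repeat split; try lra. intros r K Hr HK _ z _.
  eapply Rle_trans; [|apply exp_ineq1_le]. nra.
Qed.

Lemma dominated_mult f u v : dominated f u -> dominated f v -> dominated f (fun z => u z * v z).
Proof.
  intros (A & d & HA & Hd & Hu) (B & e & HB & He & Hv). exists (A + B)%R, (d + e)%R. repeat split; try lra.
  intros r K Hr HK H z Hz. rewrite Cmod_mult, Rmult_plus_distr_r, exp_plus.
  apply Rmult_le_compat; try apply Cmod_ge_0.
  - apply (Hu r K); auto. intros w Hw. apply H. lra.
  - apply (Hv r K); auto. intros w Hw. apply H. lra.
Qed.

Lemma dominated_minus f u v : dominated f u -> dominated f v -> dominated f (fun z => u z - v z).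
Proof.
  intros (A & d & HA & Hd & Hu) (B & e & HB & He & Hv). exists (A + B + 1)%R, (d + e)%R. repeat split; try lra.
  intros r K Hr HK H z Hz. eapply Rle_trans. apply Cmod_minus_le.
  assert (X : Cmod (u z) <= exp (A * K)). { apply (Hu r K); auto. intros w Hw. apply H. lra. }
  assert (Y : Cmod (v z) <= exp (B * K)). { apply (Hv r K); auto. intros w Hw. apply H. lra. }
  assert (exp (A * K) <= exp ((A + B) * K)) by (apply exp_le_mono; nra).
  assert (exp (B * K) <= exp ((A + B) * K)) by (apply exp_le_mono; nra).
  replace ((A + B + 1) * K)%R with ((A + B) * K + K)%R by ring. rewrite exp_plus.
  assert (2 <= exp K) by (eapply Rle_trans; [|apply exp_ineq1_le]; lra).
  assert (0 < exp ((A + B) * K)) by apply exp_pos. nra.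
Qed.

Lemma dominated_shift f u c : dominated f u -> dominated f (fun z => u (z + c)).
Proof.
  intros (A & d & HA & Hd & Hu). exists A, (d + Cmod c)%R. assert (H0 := Cmod_ge_0 c). repeat split; try lra.
  intros r K Hr HK H z Hz. apply (Hu (r + Cmod c)%R K); auto. lra. intros w Hw. apply H; lra.
  eapply Rle_trans. apply Cmod_triangle. lra.
Qed.

(** The derivative is the value at 0 of the entire difference quotient, which the maximum principle
    bounds on the unit circle. *)
Lemma derive_bound u (z : C) M : entire u -> (forall w, Cmod w <= Cmod z + 1 -> Cmod (u w) <= M) ->
  Cmod (C_derive u z) <= 2 * M.
Proof.
  intros Hu HM.
  destruct (entire_div0 (fun w => u (w + z) - u z)) as [g [Hg E]].
  { apply entire_minus. apply entire_shift; auto. apply entire_const. }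
  { rewrite Cplus_0_l. ring. }
  assert (D : C_derive u z = g 0).
  { replace z with (0 + z) at 1 by ring. rewrite <- C_derive_shift by auto.
    apply cderiv_unique_C. apply cderiv_ext with (fun w => w * g w + u z).
    intros w. rewrite <- E. ring.
    eapply cderiv_eq; [|apply cderiv_plus; [apply cderiv_mult; [apply cderiv_id|apply entire_cderiv; auto]|apply cderiv_const]].
    cbv beta. ring. }
  rewrite D. apply entire_max with 1%R; auto. rewrite Cmod_0; lra.
  intros w Hw. assert (Hw0 : w <> 0) by (apply Cmod_gt_0; lra).
  assert (Q : g w = (u (w + z) - u z) / w) by (rewrite E; field; auto).
  rewrite Q, Cmod_div, Hw by auto. unfold Rdiv. rewrite Rinv_1, Rmult_1_r.
  eapply Rle_trans. apply Cmod_minus_le.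
  assert (Cmod (u (w + z)) <= M). { apply HM. eapply Rle_trans. apply Cmod_triangle. lra. }
  assert (Cmod (u z) <= M) by (apply HM; lra). lra.
Qed.

Lemma dominated_derive f u : entire u -> dominated f u -> dominated f (C_derive u).
Proof.
  intros Hu (A & d & HA & Hd & Hdom). exists (A + 1)%R, (d + 1)%R. repeat split; try lra.
  intros r K Hr HK H z Hz. eapply Rle_trans. apply (derive_bound u z (exp (A * K))); auto.
  intros w Hw. apply (Hdom (r + 1)%R K); auto. lra. intros v Hv. apply H. lra. lra.
  rewrite Rmult_plus_distr_r, exp_plus, Rmult_1_l.
  assert (2 <= exp K) by (eapply Rle_trans; [|apply exp_ineq1_le]; lra).
  assert (0 < exp (A * K)) by apply exp_pos. nra.
Qed.

Lemma dominated_Qprod f u l : dominated f u -> dominated f (fun z => Qprod l (u z)).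
Proof.
  intros H. induction l; simpl. apply dominated_const.
  apply (dominated_mult f (fun z => u z - a) (fun z => Qprod l (u z))); auto.
  apply dominated_minus; auto. apply dominated_const.
Qed.

(** * Separation of the roots *)

Lemma list_bound (l : list C) : exists M : R, 0 <= M /\ forall x, In x l -> Cmod x <= M.
Proof.
  induction l as [|a l [M [HM H]]]. exists 0%R. split. lra. intros x [].
  exists (Cmod a + M)%R. assert (A := Cmod_ge_0 a). split. lra. intros x [<-|Hx]. lra. specialize (H x Hx). lra.
Qed.

Lemma list_sep1 (x : C) (l : list C) : exists s : R, 0 < s /\ forall y, In y l -> y <> x -> s <= Cmod (x - y).
Proof.
  induction l as [|a l [s [Hs H]]]. exists 1%R. split. lra. intros y [].
  destruct (Ceq_dec a x) as [->|Hne].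
  - exists s. split; auto. intros y [<-|Hy] Hn; auto. contradiction.
  - exists (Rmin s (Cmod (x - a))). split. apply Rmin_glb_lt; auto. apply Cmod_gt_0. apply Cminus_eq_contra; auto.
    intros y [<-|Hy] Hn. apply Rmin_r. eapply Rle_trans. apply Rmin_l. auto.
Qed.

Lemma list_sep (l l' : list C) : exists s : R, 0 < s /\ forall x y, In x l -> In y l' -> y <> x -> s <= Cmod (x - y).
Proof.
  induction l as [|a l [s [Hs H]]]. exists 1%R. split. lra. intros x y [].
  destruct (list_sep1 a l') as [s' [Hs' H']]. exists (Rmin s s'). split. apply Rmin_glb_lt; auto.
  intros x y [<-|Hx] Hy Hn. eapply Rle_trans. apply Rmin_r. auto. eapply Rle_trans. apply Rmin_l. auto.
Qed.

Lemma Qprod_split l1 x l2 (w : C) : Qprod (l1 ++ x :: l2) w = (w - x) * Qprod (l1 ++ l2) w.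
Proof. induction l1; simpl; auto. unfold Qprod in *. simpl. rewrite IHl1. ring. Qed.

(** If a root lies within [c0 * (1 + |w|)] of [w], then [1 + |w| <= 4/3 * (1 + M)], and [c0] is so
    small that the separation [s] of the roots exceeds twice that distance: no other root is as
    close. If no root is that close, any of them can be singled out. *)
Lemma nearest_root (a : list C) : NoDup a -> a <> [] -> exists c0 : R, 0 < c0 /\
  forall w, exists x l1 l2, a = l1 ++ x :: l2 /\ forall b, In b (l1 ++ l2) -> c0 * (1 + Cmod w) <= Cmod (w - b).
Proof.
  intros ND Ne. destruct (list_bound a) as [M [HM HMb]]. destruct (list_sep a a) as [s [Hs Hsep]].
  set (c0 := Rmin (/ 4) (s / (4 * (1 + M)))).
  assert (H1 : c0 <= / 4) by apply Rmin_l.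
  assert (H2 : c0 * (4 * (1 + M)) <= s).
  { apply Rle_trans with (s / (4 * (1 + M)) * (4 * (1 + M)))%R. apply Rmult_le_compat_r. lra. apply Rmin_r. right. field. lra. }
  assert (H0 : 0 < c0). { apply Rmin_glb_lt. lra. apply Rdiv_lt_0_compat; lra. }
  exists c0. split; auto. intros w.
  destruct (classic (exists x, In x a /\ Cmod (w - x) < c0 * (1 + Cmod w))) as [[x [Hx Hc]]|Hno].
  - destruct (in_split x a Hx) as (l1 & l2 & E). exists x, l1, l2. split; auto. intros b Hb.
    assert (Hba : In b a). { rewrite E. apply in_app_or in Hb. apply in_or_app. simpl. tauto. }
    assert (Hne : b <> x). { intros ->. rewrite E in ND. apply NoDup_remove_2 in ND. contradiction. }
    assert (S := Hsep x b Hx Hba Hne). assert (Mx := HMb x Hx).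
    assert (T1 := Cmod_tri3 x w b). rewrite (Cmod_minus_sym x w) in T1.
    assert (T2 := Cmod_minus_ge w x). assert (W := Cmod_ge_0 w). nra.
  - destruct a as [|x l]. contradiction. exists x, [], l. split; auto. intros b Hb. apply Rnot_lt_le. intros Q. apply Hno.
    exists b. split; auto. right; auto.
Qed.

Lemma Qprod_factor_upper (l : list C) : exists c1 : R, 1 <= c1 /\ forall w b, In b l -> Cmod (w - b) <= c1 * (1 + Cmod w).
Proof.
  destruct (list_bound l) as [M [HM H]]. exists (1 + M)%R. split. lra. intros w b Hb.
  eapply Rle_trans. apply Cmod_minus_le. specialize (H b Hb). assert (W := Cmod_ge_0 w). nra.
Qed.

(* The nearest root carries the logarithmic derivative while the other [n - 1] factors have full size. *)
Lemma root_estimate (a ld : list C) : NoDup a -> (2 * length ld + 2 < length a)%nat -> exists C1 : R, 1 <= C1 /\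
  forall w w1 L, 0 <= L -> (forall b, In b a -> Cmod w1 <= L * Cmod (w - b)) ->
    (Cmod (Qprod ld w) * Cmod w1) ^ 2 * (1 + Cmod w) <= C1 * L ^ 2 * Cmod (Qprod a w).
Proof.
  intros ND Hn. set (k := length ld) in *.
  destruct (nearest_root a ND) as [c0 [Hc0 Hnear]]. { intros ->. simpl in Hn. lia. }
  destruct (Qprod_factor_upper (ld ++ a)) as [c1 [Hc1 Hup]].
  set (n1 := pred (length a)). assert (Hn1 : (2 * k + 2 <= n1)%nat) by (unfold n1; lia).
  assert (p0 : 0 < c0 ^ n1) by (apply pow_lt; auto).
  exists (1 + (c1 ^ k) ^ 2 * c1 / c0 ^ n1)%R. split.
  { assert (0 <= (c1 ^ k) ^ 2 * c1 / c0 ^ n1)%R. { apply Rmult_le_pos. apply Rmult_le_pos. apply pow_le. apply pow_le. lra. lra. left; apply Rinv_0_lt_compat; auto. } lra. }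
  intros w w1 L HL Hw1. set (A := (1 + Cmod w)%R). assert (HA : 1 <= A) by (unfold A; generalize (Cmod_ge_0 w); lra).
  destruct (Hnear w) as (x & l1 & l2 & E & Hb). fold A in Hb.
  assert (Hx : In x a) by (rewrite E; apply in_or_app; right; left; auto).
  assert (Q : c0 ^ n1 * A ^ n1 * Cmod (w - x) <= Cmod (Qprod a w)).
  { rewrite E, Qprod_split, Cmod_mult, Rmult_comm. apply Rmult_le_compat_l. apply Cmod_ge_0.
    rewrite <- Rpow_mult_distr. replace n1 with (length (l1 ++ l2)). apply Qprod_lower; auto. nra.
    unfold n1. rewrite E, !length_app. simpl. lia. }
  assert (Qt : Cmod (Qprod ld w) <= c1 ^ k * A ^ k).
  { rewrite <- Rpow_mult_distr. apply Qprod_upper. intros b Hb'. apply Hup. apply in_or_app; auto. }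
  assert (W1 := Hw1 x Hx). assert (Wx : Cmod (w - x) <= c1 * A) by (apply Hup; apply in_or_app; auto).
  set (d := Cmod (w - x)) in *. assert (d0 : 0 <= d) by apply Cmod_ge_0.
  assert (S1 : Cmod (Qprod ld w) * Cmod w1 <= (c1 ^ k * A ^ k) * (L * d)).
  { apply Rmult_le_compat; auto; apply Cmod_ge_0. }
  assert (pk : 0 <= c1 ^ k * A ^ k) by (apply Rmult_le_pos; apply pow_le; lra).
  apply Rle_trans with (((c1 ^ k * A ^ k) * (L * d)) ^ 2 * A)%R.
  { apply Rmult_le_compat_r. lra. apply pow_incr. split; auto. apply Rmult_le_pos; apply Cmod_ge_0. }
  assert (PA : A ^ (2 * k + 2) <= A ^ n1) by (apply Rle_pow; auto).
  assert (EA : (A ^ (2 * k + 2) = (A ^ k) ^ 2 * A * A)%R).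
  { rewrite pow_add, Nat.mul_comm, pow_mult. simpl. ring. }
  (* The exponent [2 * k + 2] arises here: the square of [Qprod ld] gives [2 * k], the factor
     [1 + |w|] gives 1, and one of the two factors [d] is estimated by [c1 * A]. The other [d] is
     kept as the small factor of [Qprod a]. *)
  replace ((c1 ^ k * A ^ k * (L * d)) ^ 2 * A)%R with ((c1 ^ k) ^ 2 * L ^ 2 * ((A ^ k) ^ 2 * A) * d * d)%R by ring.
  apply Rle_trans with ((c1 ^ k) ^ 2 * L ^ 2 * ((A ^ k) ^ 2 * A) * d * (c1 * A))%R.
  { apply Rmult_le_compat_l; auto. apply Rmult_le_pos; auto. apply Rmult_le_pos. apply Rmult_le_pos; apply pow_le. apply pow_le; lra. auto.
    apply Rmult_le_pos. apply pow_le; apply pow_le; lra. lra. }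
  replace ((c1 ^ k) ^ 2 * L ^ 2 * ((A ^ k) ^ 2 * A) * d * (c1 * A))%R with ((c1 ^ k) ^ 2 * L ^ 2 * d * c1 * A ^ (2 * k + 2))%R by (rewrite EA; ring).
  assert (c2 : 0 <= (c1 ^ k) ^ 2) by (apply pow_le; apply pow_le; lra).
  assert (L2 : 0 <= L ^ 2) by (apply pow_le; auto).
  apply Rle_trans with ((c1 ^ k) ^ 2 * L ^ 2 * d * c1 * A ^ n1)%R.
  { apply Rmult_le_compat_l; auto. apply Rmult_le_pos; [apply Rmult_le_pos; [apply Rmult_le_pos|]|]; auto; lra. }
  apply Rle_trans with ((c1 ^ k) ^ 2 * c1 / c0 ^ n1 * L ^ 2 * (c0 ^ n1 * A ^ n1 * d))%R.
  { right. field. lra. }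
  apply Rmult_le_compat; auto.
  - apply Rmult_le_pos; auto. apply Rmult_le_pos. apply Rmult_le_pos; lra. left; apply Rinv_0_lt_compat; auto.
  - apply Rmult_le_pos; auto. apply Rmult_le_pos. lra. apply pow_le; lra.
  - apply Rmult_le_compat_r; auto. lra.
Qed.

(** * Divisibility by powers of [z - z0] *)

(** Order at least [m]; the zero function vanishes to every order, so no case distinction is needed
    in sums. *)
Definition vanishes (z0 : C) (m : nat) (u : C -> C) : Prop :=
  exists w, entire w /\ forall z, u z = (z - z0) ^ m * w z.

Lemma vanishes_weaken z0 m m' u : (m' <= m)%nat -> vanishes z0 m u -> vanishes z0 m' u.
Proof.
  intros H (w & Hw & E). exists (fun z => (z - z0) ^ (m - m') * w z). split. auto 10 with ent.
  intros z. rewrite E. replace m with (m' + (m - m'))%nat at 1 by lia. rewrite Cpow_add_r. ring.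
Qed.

Lemma vanishes_mult z0 m m' u v : vanishes z0 m u -> vanishes z0 m' v -> vanishes z0 (m + m') (fun z => u z * v z).
Proof.
  intros (w & Hw & E) (w' & Hw' & E'). exists (fun z => w z * w' z). split. auto with ent.
  intros z. rewrite E, E', Cpow_add_r. ring.
Qed.

Lemma vanishes_mult_r z0 m u v : entire v -> vanishes z0 m u -> vanishes z0 m (fun z => u z * v z).
Proof.
  intros Hv (w & Hw & E). exists (fun z => w z * v z). split. auto with ent. intros z. rewrite E. ring.
Qed.

Lemma vanishes_mult_l z0 m u v : entire u -> vanishes z0 m v -> vanishes z0 m (fun z => u z * v z).
Proof.
  intros Hv (w & Hw & E). exists (fun z => u z * w z). split. auto with ent. intros z. rewrite E. ring.
Qed.

Lemma vanishes_minus z0 m u v : vanishes z0 m u -> vanishes z0 m v -> vanishes z0 m (fun z => u z - v z).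
Proof.
  intros (w & Hw & E) (w' & Hw' & E'). exists (fun z => w z - w' z). split. auto with ent.
  intros z. rewrite E, E'. ring.
Qed.

Lemma vanishes_ext z0 m u v : (forall z, u z = v z) -> vanishes z0 m u -> vanishes z0 m v.
Proof. intros H (w & Hw & E). exists w. split; auto. intros. rewrite <- H; auto. Qed.

Lemma vanishes_derive z0 m u : vanishes z0 (S m) u -> vanishes z0 m (C_derive u).
Proof.
  intros (w & Hw & E). exists (fun z => RtoC (INR (S m)) * w z + (z - z0) * C_derive w z). split. auto 10 with ent.
  intros z. apply derive_pow_factor; auto.
Qed.

Lemma vanishes_cancel z0 m q u : entire q -> entire u -> q z0 <> 0 -> vanishes z0 m (fun z => q z * u z) -> vanishes z0 m u.
Proof.
  intros Hq Hu Hq0 (w & Hw & E).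
  destruct (classic (nz u)) as [N|N].
  2: { exists (fun _ => RtoC 0). split. apply entire_const. intros z. rewrite (not_nz _ N z). ring. }
  destruct (order_at u z0 Hu N) as (p & g & Hg & Hg0 & Eg).
  destruct (Nat.le_gt_cases m p) as [L|L].
  { apply vanishes_weaken with p; auto. exists g; auto. }
  exfalso.
  assert (X : forall z, q z * g z = (z - z0) ^ (m - p) * w z).
  { apply (pow_factor_cancel (fun z => q z * g z) (fun z => (z - z0) ^ (m - p) * w z) z0 p); auto 10 with ent.
    intros z. specialize (E z). cbv beta in E. rewrite Eg in E. replace m with (p + (m - p))%nat in E at 1 by lia.
    rewrite Cpow_add_r in E. transitivity (q z * ((z - z0) ^ p * g z)). ring. rewrite E. ring. }
  specialize (X z0). replace (m - p)%nat with (S (m - p - 1)) in X by lia. rewrite Cpow_S in X.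
  apply (Cmult_neq_0 _ _ Hq0 Hg0). rewrite X. ring.
Qed.

(** Stated for a local identity with merely continuous cofactors, because the cofactor in
    [zero_order] is controlled only near the point. *)
Lemma order_unique (f g : C -> C) z0 s m (eps : R) : 0 < eps -> ccont dC f z0 -> ccont dC g z0 ->
  f z0 <> 0 -> g z0 <> 0 ->
  (forall z, Cmod (z - z0) < eps -> (z - z0) ^ s * f z = (z - z0) ^ m * g z) -> s = m.
Proof.
  assert (W : forall (f g : C -> C) s m, 0 < eps -> ccont dC f z0 -> ccont dC g z0 -> f z0 <> 0 ->
    (forall z, Cmod (z - z0) < eps -> (z - z0) ^ s * f z = (z - z0) ^ m * g z) -> ~ (s < m)%nat).
  { clear. intros f g s m He Hf Hg Nf E Hlt.
    destruct (ccont_nonzero (fun z => f z - (z - z0) ^ (m - s) * g z) z0) as [d [Hd H]].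
    - apply ccont_minus; auto. apply ccont_mult; auto. apply (ccont_pow dC (fun z => z - z0)). apply ccont_minus.
      apply entire_cont. apply entire_id. apply ccont_const.
    - replace (m - s)%nat with (S (m - s - 1)) by lia. rewrite Cpow_S.
      replace (f z0 - (z0 - z0) * (z0 - z0) ^ (m - s - 1) * g z0) with (f z0) by ring. auto.
    - set (h := (Rmin d eps / 2)%R). assert (Hm : 0 < Rmin d eps) by (apply Rmin_glb_lt; auto).
      assert (h0 : 0 < h) by (unfold h; lra).
      assert (h1 : Cmod (z0 + RtoC h - z0) = h).
      { replace (z0 + RtoC h - z0) with (RtoC h) by ring. rewrite Cmod_R, Rabs_right; lra. }
      assert (Nh : z0 + RtoC h - z0 <> 0) by (apply Cmod_gt_0; lra).
      apply (H (z0 + RtoC h)). rewrite h1. unfold h. generalize (Rmin_l d eps). lra.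
      specialize (E (z0 + RtoC h)). rewrite h1 in E. specialize (E ltac:(unfold h; generalize (Rmin_r d eps); lra)).
      set (t := z0 + RtoC h - z0) in *. replace m with (s + (m - s))%nat in E at 1 by lia. rewrite Cpow_add_r in E.
      assert (Ns : t ^ s <> 0) by (apply Cpow_nz; auto).
      replace (f (z0 + RtoC h)) with (/ t ^ s * (t ^ s * f (z0 + RtoC h))) by (field; auto). rewrite E. field. auto. }
  intros He Hf Hg Nf Ng E.
  assert (A := W f g s m He Hf Hg Nf E).
  assert (B := W g f m s He Hg Hf Ng (fun z Hz => eq_sym (E z Hz))). lia.
Qed.

Lemma derive_zero_const f : entire f -> (forall z, C_derive f z = 0) -> exists c, forall z, f z = c.
Proof.
  intros Hf H. destruct (wronskian_zero f (fun _ => RtoC 1)) as [k Hk]; auto with ent.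
  exists 0. apply C1_nz.
  intros z. rewrite H, (cderiv_unique_C _ _ _ (cderiv_const 1 z)). ring.
  exists k. intros z. rewrite Hk. ring.
Qed.

Lemma exists_not_in (l : list C) : exists z, ~ In z l.
Proof.
  destruct (avoid_list (map Re l) 0 1) as [x [_ Hx]]. lra.
  exists (RtoC x). intros H. apply Hx. apply (in_map Re) in H. exact H.
Qed.

(** * Compositions with the polynomial *)

Lemma derive_comp Q f z : entire Q -> entire f -> C_derive (fun z => Q (f z)) z = C_derive Q (f z) * C_derive f z.
Proof. intros. apply cderiv_unique_C. apply cderiv_comp; apply entire_cderiv; auto. Qed.

Lemma derive2_comp Q f z : entire Q -> entire f -> C_derive (C_derive (fun z => Q (f z))) z =
  C_derive (C_derive Q) (f z) * (C_derive f z * C_derive f z) + C_derive Q (f z) * C_derive (C_derive f) z.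
Proof.
  intros HQ Hf. apply cderiv_unique_C. apply cderiv_ext with (fun z => C_derive Q (f z) * C_derive f z).
  intros w. symmetry. apply derive_comp; auto.
  eapply cderiv_eq; [|apply cderiv_mult; [apply (cderiv_comp (C_derive Q) f); apply entire_cderiv; auto with ent | apply entire_cderiv; auto with ent]].
  cbv beta. ring.
Qed.

(** At a zero of [Q'] the quotient [Q''/Q'] has a simple pole, which the factor of [Qprod ld] at
    that point removes. *)
Lemma critical_quotient Q ld : entire Q -> nz (C_derive Q) -> (forall z, C_derive Q z = 0 -> In z ld) ->
  exists S, entire S /\ forall z, C_derive (C_derive Q) z * Qprod ld z = C_derive Q z * S z.
Proof.
  intros HQ NQ Hld.
  apply (entire_quotient (fun z => C_derive (C_derive Q) z * Qprod ld z)); auto with ent.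
  intros z0. destruct (order_at (C_derive Q) z0) as (p & g & Hg & Hg0 & E); auto with ent.
  destruct p.
  - exists 0%nat, (fun z => C_derive (C_derive Q) z * Qprod ld z), g. repeat split; auto with ent. intros z. simpl. ring.
  - assert (Hz : In z0 ld). { apply Hld. rewrite E, Cpow_S. ring. }
    destruct (entire_div (Qprod ld) z0 (entire_Qprod ld) (Qprod_zero ld z0 Hz)) as [q [Hq Eq]].
    exists (S p), (fun z => (RtoC (INR (S p)) * g z + (z - z0) * C_derive g z) * q z), g.
    repeat split; auto 10 with ent. intros z. rewrite (derive_pow_factor (C_derive Q) g z0 p z Hg E), Eq, Cpow_S. ring.
Qed.

(** The roots in [a] are distinct, so at a zero of [Qprod a (f z)] only the factor with root [f z0]
    vanishes and carries the whole order. This turns the sharing hypothesis into a statement on the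
    orders of [F] and [G]. *)
Lemma root_point_order a f z0 p F' m : NoDup a -> entire f -> (forall b, nz (fun z => f z - b)) ->
  entire F' -> F' z0 <> 0 -> (forall z, Qprod a (f z) = (z - z0) ^ p * F' z) -> (1 <= m)%nat ->
  ((exists x, In x a /\ zero_order (fun w => f w - x) z0 m) <-> p = m).
Proof.
  intros ND Hf Nf HF' NF' E Hm.
  assert (key : forall x, In x a -> f z0 = x -> exists g, entire g /\ g z0 <> 0 /\ forall z, f z - x = (z - z0) ^ p * g z).
  { intros x Hx Ex. destruct (in_split x a Hx) as (l1 & l2 & Ea).
    destruct (order_at (fun z => f z - x) z0) as (s & g & Hg & Hg0 & Eg); auto with ent.
    assert (Nr : Qprod (l1 ++ l2) (f z0) <> 0).
    { apply Qprod_nonzero. rewrite Ex. rewrite Ea in ND. apply NoDup_remove_2; auto. }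
    assert (Hr : entire (fun z => Qprod (l1 ++ l2) (f z))) by (apply entire_comp; auto with ent).
    assert (S : s = p).
    { apply (order_unique (fun z => g z * Qprod (l1 ++ l2) (f z)) F' z0 s p 1); auto; try lra.
      apply entire_cont; auto with ent. apply entire_cont; auto. apply Cmult_neq_0; auto.
      intros z _. rewrite <- E, Ea, Qprod_split, Eg. ring. }
    subst s. exists g; auto. }
  split.
  - intros (x & Hx & _ & eps & g & Hloc & Hg0).
    assert (Hz0 : Cmod (z0 - z0) < eps). { replace (z0 - z0) with (RtoC 0) by ring. rewrite Cmod_0. apply cond_pos. }
    assert (Ex : f z0 = x).
    { apply Ceq_minus. destruct (Hloc z0 Hz0) as [_ X]. rewrite X. replace m with (S (m - 1)) by lia.
      rewrite Cpow_S. ring. }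
    destruct (key x Hx Ex) as (h & Hh & Hh0 & Eh).
    apply (order_unique h g z0 p m eps); auto. apply cond_pos. apply entire_cont; auto.
    destruct (Hloc z0 Hz0) as [X _]. apply ex_derive_cderiv in X. destruct X as [l X]. eapply cderiv_cont; eauto.
    intros z Hz. rewrite <- Eh. apply Hloc; auto.
  - intros <-. assert (Hz : Qprod a (f z0) = 0).
    { rewrite E. replace p with (S (p - 1)) by lia. rewrite Cpow_S. ring. }
    apply Qprod_zero_inv in Hz. destruct (key (f z0) Hz eq_refl) as (h & Hh & Hh0 & Eh).
    exists (f z0). split; auto. split; auto. exists (mkposreal 1 Rlt_0_1), h. split; auto.
Qed.

(** * The auxiliary function *)

(** Divided by [F F'] this is [F''/F' - 2 F'/F], the logarithmic derivative of [F'/F^2]. *)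
Definition bracket (F : C -> C) (z : C) : C :=
  C_derive (C_derive F) z * F z - 2 * (C_derive F z * C_derive F z).

Lemma bracket_entire F : entire F -> entire (bracket F).
Proof. intros. unfold bracket. auto 10 with ent. Qed.

Lemma bracket_vanishes F z0 p : vanishes z0 (S (S p)) F -> vanishes z0 (2 * p + 2) (bracket F).
Proof.
  intros H. assert (H1 := vanishes_derive _ _ _ H). assert (H2 := vanishes_derive _ _ _ H1).
  apply vanishes_minus.
  - apply vanishes_weaken with (p + S (S p))%nat. lia. apply vanishes_mult; auto.
  - apply vanishes_mult_l. apply entire_const. apply vanishes_weaken with (S p + S p)%nat. lia. apply vanishes_mult; auto.
Qed.

Lemma mult_derive_vanishes F z0 p : vanishes z0 (S p) F -> vanishes z0 (2 * p + 1) (fun z => F z * C_derive F z).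
Proof.
  intros H. assert (H1 := vanishes_derive _ _ _ H).
  apply vanishes_weaken with (S p + p)%nat. lia. apply vanishes_mult; auto.
Qed.

(** This is [H F F' G G'], that is [H] with its denominators cleared. *)
Definition cross (F G : C -> C) (z : C) : C :=
  bracket F z * (G z * C_derive G z) - bracket G z * (F z * C_derive F z).

Lemma cross_vanishes F G z0 p q : vanishes z0 (S (S p)) F -> vanishes z0 (S (S q)) G ->
  vanishes z0 (2 * p + 2 * q + 5) (cross F G).
Proof.
  intros HF HG. apply vanishes_minus.
  - apply vanishes_weaken with ((2 * p + 2) + (2 * S q + 1))%nat. lia. apply vanishes_mult.
    apply bracket_vanishes; auto. apply mult_derive_vanishes; auto.
  - apply vanishes_weaken with ((2 * q + 2) + (2 * S p + 1))%nat. lia. apply vanishes_mult.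
    apply bracket_vanishes; auto. apply mult_derive_vanishes; auto.
Qed.

(* At a common zero of order 1 or 2 the leading terms of the two products cancel. *)
Lemma cross_vanishes_simple F G z0 u v : entire u -> entire v ->
  (forall z, F z = (z - z0) ^ 1 * u z) -> (forall z, G z = (z - z0) ^ 1 * v z) -> vanishes z0 3 (cross F G).
Proof.
  assert (D : forall F u, entire u -> (forall z, F z = (z - z0) ^ 1 * u z) ->
    (forall z, C_derive F z = u z + (z - z0) * C_derive u z) /\
    (forall z, C_derive (C_derive F) z = 2 * C_derive u z + (z - z0) * C_derive (C_derive u) z)).
  { clear. intros F u Hu E.
    assert (A : forall z, C_derive F z = u z + (z - z0) * C_derive u z).
    { intros z. rewrite (derive_pow_factor F u z0 0 z Hu E). simpl. ring. }
    split; auto. intros z. apply cderiv_unique_C. apply cderiv_ext with (fun z => u z + (z - z0) * C_derive u z). auto.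
    eapply cderiv_eq; [|apply cderiv_plus; [apply entire_cderiv; auto | apply cderiv_mult;
      [apply cderiv_minus; [apply cderiv_id|apply cderiv_const] | apply entire_cderiv; auto with ent]]]. cbv beta. ring. }
  intros Hu Hv EF EG. destruct (D F u Hu EF) as [F1 F2]. destruct (D G v Hv EG) as [G1 G2].
  (* One has [bracket F = - 2 u F' + (z - z0)^2 bu]. Because [F = (z - z0) u], the first parts
     cancel exactly in [cross], leaving [(z - z0)^2 (bu G G' - bv F F')], whose bracket supplies one
     more factor [z - z0]. *)
  set (bu := fun z => u z * C_derive (C_derive u) z - 2 * (C_derive u z * C_derive u z)).
  set (bv := fun z => v z * C_derive (C_derive v) z - 2 * (C_derive v z * C_derive v z)).
  assert (Hbu : entire bu) by (unfold bu; auto 10 with ent). assert (Hbv : entire bv) by (unfold bv; auto 10 with ent).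
  exists (fun z => (bu z * (v z * v z) - bv z * (u z * u z)) + (z - z0) * (bu z * (v z * C_derive v z) - bv z * (u z * C_derive u z))).
  split. auto 12 with ent.
  intros z. unfold cross, bracket, bu, bv. rewrite F1, F2, G1, G2, EF, EG. simpl. ring.
Qed.

Lemma cross_vanishes_double F G z0 u v : entire u -> entire v ->
  (forall z, F z = (z - z0) ^ 2 * u z) -> (forall z, G z = (z - z0) ^ 2 * v z) -> vanishes z0 6 (cross F G).
Proof.
  assert (D : forall F u, entire u -> (forall z, F z = (z - z0) ^ 2 * u z) ->
    (forall z, C_derive F z = (z - z0) * (2 * u z + (z - z0) * C_derive u z)) /\
    (forall z, C_derive (C_derive F) z = 2 * u z + 4 * (z - z0) * C_derive u z + (z - z0) * (z - z0) * C_derive (C_derive u) z)).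
  { clear. intros F u Hu E.
    assert (A : forall z, C_derive F z = (z - z0) * (2 * u z + (z - z0) * C_derive u z)).
    { intros z. rewrite (derive_pow_factor F u z0 1 z Hu E). simpl. rewrite RtoC_plus. ring. }
    split; auto. intros z. apply cderiv_unique_C. apply cderiv_ext with (fun z => (z - z0) * (2 * u z + (z - z0) * C_derive u z)). auto.
    assert (T : cderiv (fun z => z - z0) z (1 - 0)) by (apply cderiv_minus; [apply cderiv_id|apply cderiv_const]).
    eapply cderiv_eq; [|apply cderiv_mult; [exact T | apply cderiv_plus; [apply cderiv_scal; apply entire_cderiv; auto | apply cderiv_mult;
      [exact T | apply entire_cderiv; auto with ent]]]]. cbv beta. ring. }
  intros Hu Hv EF EG. destruct (D F u Hu EF) as [F1 F2]. destruct (D G v Hv EG) as [G1 G2].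
  (* Here [bracket F] starts with [- 6 (z - z0)^2 u^2] and [F F'] with [2 (z - z0)^3 u^2], so in
     [cross] the terms of order 5 cancel. Order 6 is exactly what two zeros of order 2 require. *)
  set (bu := fun z => u z * C_derive (C_derive u) z - 2 * (C_derive u z * C_derive u z)).
  set (bv := fun z => v z * C_derive (C_derive v) z - 2 * (C_derive v z * C_derive v z)).
  assert (Hbu : entire bu) by (unfold bu; auto 10 with ent). assert (Hbv : entire bv) by (unfold bv; auto 10 with ent).
  exists (fun z => 2 * (u z * v z) * (u z * C_derive v z - v z * C_derive u z)
     + (z - z0) * (2 * (bu z * (v z * v z) - bv z * (u z * u z)))
     + (z - z0) * (z - z0) * (bu z * (v z * C_derive v z) - bv z * (u z * C_derive u z))).
  split. auto 12 with ent.
  intros z. unfold cross, bracket, bu, bv. rewrite F1, F2, G1, G2, EF, EG. simpl. ring.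
Qed.

Section Auxiliary.
Context (F G Yf Yg Kf Kg qf qg tf tg : C -> C).
Hypotheses (HF : entire F) (HG : entire G) (HYf : entire Yf) (HYg : entire Yg) (HKf : entire Kf) (HKg : entire Kg).
Hypotheses (Hqf : entire qf) (Hqg : entire qg) (Htf : entire tf) (Htg : entire tg).
Hypothesis EYf : forall z, qf z * Yf z = tf z * bracket F z.
Hypothesis EYg : forall z, qg z * Yg z = tg z * bracket G z.
Hypothesis EKf : forall z, qf z * Kf z = C_derive F z * tf z.
Hypothesis EKg : forall z, qg z * Kg z = C_derive G z * tg z.

(** In the application [qf = Q'(f)], [tf = T(f)], [Kf = T(f) f'] and
    [Yf = T(f) * bracket F / Q'(f)]. Then [auxf] is [H T(f) f' T(g) g' F G], written without the
    denominators [Q'(f)] and [Q'(g)]. *)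
Definition auxf (z : C) : C := Yf z * G z * Kg z - Yg z * F z * Kf z.

Lemma auxf_cross z : qf z * qg z * auxf z = tf z * tg z * cross F G z.
Proof.
  unfold auxf, cross.
  transitivity ((qf z * Yf z) * G z * (qg z * Kg z) - (qg z * Yg z) * F z * (qf z * Kf z)). ring.
  rewrite EYf, EYg, EKf, EKg. ring.
Qed.

Lemma auxf_entire : entire auxf.
Proof. unfold auxf. auto 10 with ent. Qed.

Lemma auxf_vanishes_both z0 m : qf z0 <> 0 -> qg z0 <> 0 -> vanishes z0 m (cross F G) -> vanishes z0 m auxf.
Proof.
  intros N1 N2 H. apply vanishes_cancel with (fun z => qf z * qg z); auto with ent. apply auxf_entire.
  apply Cmult_neq_0; auto.
  apply vanishes_ext with (fun z => tf z * tg z * cross F G z). intros; symmetry; apply auxf_cross.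
  apply vanishes_mult_l; auto with ent.
Qed.

(** At a zero of [F] alone, [g] may take a critical value of its own there and [qg z0] may be 0; so
    the relation is multiplied by [qf] only. *)
Lemma auxf_vanishes_left z0 p : qf z0 <> 0 -> vanishes z0 (S (S p)) F -> vanishes z0 (2 * p + 2) auxf.
Proof.
  intros N1 H. apply vanishes_cancel with qf; auto. apply auxf_entire.
  apply vanishes_ext with (fun z => bracket F z * (tf z * G z * Kg z) - (F z * C_derive F z) * (tf z * Yg z)).
  { intros z. unfold auxf.
    transitivity ((tf z * bracket F z) * G z * Kg z - Yg z * F z * (C_derive F z * tf z)). ring.
    rewrite <- EYf, <- EKf. ring. }
  apply vanishes_minus; apply vanishes_mult_r; auto with ent. apply bracket_vanishes; auto.
  apply vanishes_weaken with (2 * S p + 1)%nat. lia. apply mult_derive_vanishes; auto.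
Qed.

Lemma auxf_vanishes_right z0 p : qg z0 <> 0 -> vanishes z0 (S (S p)) G -> vanishes z0 (2 * p + 2) auxf.
Proof.
  intros N1 H. apply vanishes_cancel with qg; auto. apply auxf_entire.
  apply vanishes_ext with (fun z => (G z * C_derive G z) * (tg z * Yf z) - bracket G z * (tg z * F z * Kf z)).
  { intros z. unfold auxf.
    transitivity (Yf z * G z * (C_derive G z * tg z) - (tg z * bracket G z) * F z * Kf z). ring.
    rewrite <- EYg, <- EKg. ring. }
  apply vanishes_minus; apply vanishes_mult_r; auto with ent.
  apply vanishes_weaken with (2 * S p + 1)%nat. lia. apply mult_derive_vanishes; auto.
  apply bracket_vanishes; auto.
Qed.

Lemma auxf_order z0 p q u v : entire u -> entire v ->
  (forall z, F z = (z - z0) ^ p * u z) -> (forall z, G z = (z - z0) ^ q * v z) ->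
  ((1 <= p)%nat -> qf z0 <> 0) -> ((1 <= q)%nat -> qg z0 <> 0) ->
  (forall m, (1 <= m <= 3)%nat -> (p = m <-> q = m)) ->
  exists m, (3 * (p + q) <= 2 * m)%nat /\ vanishes z0 m auxf.
Proof.
  intros Hu Hv EF EG Nf Ng Hsh.
  assert (H1 := Hsh 1%nat ltac:(lia)). assert (H2 := Hsh 2%nat ltac:(lia)). assert (H3 := Hsh 3%nat ltac:(lia)).
  assert (VF : vanishes z0 p F) by (exists u; auto). assert (VG : vanishes z0 q G) by (exists v; auto).
  destruct (Nat.eq_dec p 0) as [P0|P0]; [destruct (Nat.eq_dec q 0) as [Q0|Q0]|destruct (Nat.eq_dec q 0) as [Q0|Q0]].
  - exists 0%nat. split. lia. exists auxf. split. apply auxf_entire. intros; simpl; ring.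
  (* Sharing rules out [q = 1, 2, 3], and [2 * (2 * q - 2) >= 3 * q] holds from [q = 4] on. *)
  - exists (2 * (q - 2) + 2)%nat. split. lia. apply auxf_vanishes_right. apply Ng; lia. replace (S (S (q - 2))) with q by lia; auto.
  - exists (2 * (p - 2) + 2)%nat. split. lia. apply auxf_vanishes_left. apply Nf; lia. replace (S (S (p - 2))) with p by lia; auto.
  - assert (N1 : qf z0 <> 0) by (apply Nf; lia). assert (N2 : qg z0 <> 0) by (apply Ng; lia).
    destruct (Nat.eq_dec p 1) as [P1|P1]; [|destruct (Nat.eq_dec p 2) as [P2|P2]].
    + assert (Q1 : q = 1%nat) by tauto. subst p q. exists 3%nat. split. lia. apply auxf_vanishes_both; auto.
      apply cross_vanishes_simple with u v; auto.
    + assert (Q1 : q = 2%nat) by tauto. subst p q. exists 6%nat. split. lia. apply auxf_vanishes_both; auto.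
      apply cross_vanishes_double with u v; auto.
    (* Now [p] and [q] are both at least 3, and [2 * (2 * p + 2 * q - 3) >= 3 * (p + q)] amounts to
       [p + q >= 6]; no cancellation is used. *)
    + exists (2 * (p - 2) + 2 * (q - 2) + 5)%nat. split. lia. apply auxf_vanishes_both; auto.
      apply cross_vanishes. replace (S (S (p - 2))) with p by lia; auto. replace (S (S (q - 2))) with q by lia; auto.
Qed.

Lemma auxf_quotient : nz F -> nz G ->
  (forall z0 p q u v, entire u -> entire v -> u z0 <> 0 -> v z0 <> 0 ->
    (forall z, F z = (z - z0) ^ p * u z) -> (forall z, G z = (z - z0) ^ q * v z) ->
    ((1 <= p)%nat -> qf z0 <> 0) /\ ((1 <= q)%nat -> qg z0 <> 0) /\
    (forall m, (1 <= m <= 3)%nat -> (p = m <-> q = m))) ->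
  exists V, entire V /\ forall z, auxf z ^ 2 = (F z * G z) ^ 3 * V z.
Proof.
  intros NF NG H.
  apply (entire_quotient (fun z => auxf z ^ 2) (fun z => (F z * G z) ^ 3)).
  - apply entire_pow. auto with ent.
  - destruct (nz_mult F G) as [w Hw]; auto. exists w. apply Cpow_nz; auto.
  - intros z0. destruct (order_at F z0 HF NF) as (p & u & Hu & Hu0 & EF). destruct (order_at G z0 HG NG) as (q & v & Hv & Hv0 & EG).
    destruct (H z0 p q u v Hu Hv Hu0 Hv0 EF EG) as (A & B & D).
    destruct (auxf_order z0 p q u v) as (m & Hm & w & Hw & Ew); auto.
    exists (3 * (p + q))%nat, (fun z => (z - z0) ^ (2 * m - 3 * (p + q)) * w z ^ 2), (fun z => (u z * v z) ^ 3).
    split. auto 10 with ent. split. apply entire_pow; auto with ent. split. apply Cpow_nz; apply Cmult_neq_0; auto. split.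
    + intros z. rewrite EF, EG. rewrite !Cpow_mult_l, (Nat.mul_comm 3), Cpow_mult_r, Cpow_add_r, Cpow_mult_l. ring.
    + intros z. rewrite Ew, Cmult_assoc, <- Cpow_add_r. replace (3 * (p + q) + (2 * m - 3 * (p + q)))%nat with (m * 2)%nat by lia.
      rewrite Cpow_mult_l, Cpow_mult_r. ring.
Qed.

End Auxiliary.

(** The two logarithmic derivatives turn the bracket into a multiple of [F1 * F0], and [F1 = q * f1]
    supplies the factor [q] that cancels against the one in front of [Y]. *)
Lemma side_bound (L : R) (Y t q f1 F0 F1 F2 : C) : 0 <= L ->
  q * Y = t * (F2 * F0 - 2 * (F1 * F1)) -> F1 = q * f1 -> q <> 0 ->
  Cmod F1 <= L * Cmod F0 -> Cmod F2 <= L * Cmod F1 -> Cmod Y <= 3 * L * (Cmod t * Cmod f1 * Cmod F0).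
Proof.
  intros HL EY EF Nq B1 B2. apply Cmod_gt_0 in Nq.
  assert (X : Cmod (F2 * F0 - 2 * (F1 * F1)) <= 3 * L * (Cmod F1 * Cmod F0)).
  { eapply Rle_trans. apply Cmod_minus_le. rewrite !Cmod_mult, Cmod_R, Rabs_right by lra.
    assert (Cmod F2 * Cmod F0 <= L * Cmod F1 * Cmod F0)%R by (apply Rmult_le_compat_r; auto; apply Cmod_ge_0).
    assert (Cmod F1 * Cmod F1 <= Cmod F1 * (L * Cmod F0))%R by (apply Rmult_le_compat_l; auto; apply Cmod_ge_0). lra. }
  apply Rmult_le_reg_l with (Cmod q); auto. rewrite <- Cmod_mult, EY, Cmod_mult.
  rewrite EF, Cmod_mult in X.
  apply Rle_trans with (Cmod t * (3 * L * (Cmod q * Cmod f1 * Cmod F0)))%R. rewrite EF. apply Rmult_le_compat_l; auto; apply Cmod_ge_0.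
  right; ring.
Qed.

(** * Polynomials with a single root; exceptional values *)

Lemma Qprod_growth (l : list C) (tau : C) : exists K : R, 0 <= K /\
  forall z, 1 <= Cmod z -> Cmod (Qprod l z - tau) <= K * Cmod z ^ length l.
Proof.
  destruct (Qprod_factor_upper l) as [c1 [Hc1 H]]. exists ((2 * c1) ^ length l + Cmod tau)%R.
  assert (P : 0 <= (2 * c1) ^ length l) by (apply pow_le; lra). assert (T := Cmod_ge_0 tau).
  split. lra. intros z Hz. eapply Rle_trans. apply Cmod_minus_le.
  assert (X : Cmod (Qprod l z) <= (2 * c1 * Cmod z) ^ length l).
  { apply Qprod_upper. intros b Hb. eapply Rle_trans. apply H; auto. nra. }
  rewrite Rpow_mult_distr in X. assert (1 <= Cmod z ^ length l) by (apply pow_R1_Rle; auto). nra.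
Qed.

(** Without zeros the bound of [log_derivative_bound] reduces to its second term, of order
    [ln r / r], which tends to 0. This plays the part of the fundamental theorem of algebra. *)
Lemma zero_free_poly_growth h d (K r1 : R) : entire h -> (forall z, h z <> 0) -> 0 <= K ->
  (forall z, r1 <= Cmod z -> Cmod (h z) <= K * Cmod z ^ d) -> forall z, C_derive h z = 0.
Proof.
  intros Hh Nh HK HB z.
  set (c := (ln (K + 1) - ln (Cmod (h 0)))%R).
  assert (lnK : 0 <= ln (K + 1)) by (rewrite <- ln_1; apply ln_le; lra).
  assert (main : forall s, 1 <= s -> Rabs r1 <= s -> Cmod z <= s ->
     Cmod (C_derive h z) <= Cmod (h z) * (8 * (Rabs c + INR d * 6) / s)).
  { intros s S1 S2 S3. set (r := (s * s)%R). assert (Hr : s <= r) by (unfold r; nra).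
    assert (bd : forall w, Cmod w <= 9 * r -> Cmod (h w) <= exp (ln (K + 1) + INR d * ln (9 * r))).
    { intros w Hw. rewrite exp_plus, exp_ln, <- ln_pow, exp_ln by (try apply pow_lt; lra).
      apply entire_max with (9 * r)%R; auto. intros v Hv. eapply Rle_trans. apply HB. rewrite Hv.
      assert (X := Rle_abs r1). lra. rewrite Hv. apply Rmult_le_compat_r. apply pow_le; lra. lra. }
    destruct (log_derivative_bound h r (ln (K + 1) + INR d * ln (9 * r)) Hh (Nh 0) ltac:(lra) bd) as (Z & HZ & _ & H).
    assert (EZ : Z = []). { destruct Z as [|a Z]; auto. exfalso. apply (Nh a). apply HZ. left; auto. }
    subst Z. destruct (H z 1%R ltac:(lra) ltac:(lra)) as [_ D]. intros a [].
    eapply Rle_trans. exact D. apply Rmult_le_compat_l. apply Cmod_ge_0.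
    simpl length. change (INR 0) with 0%R. unfold Rdiv at 1. rewrite Rmult_0_l, Rplus_0_l.
    assert (L9 : ln (9 * r) <= 6 * s).
    { replace (9 * r)%R with ((3 * s) * (3 * s))%R by (unfold r; ring). rewrite ln_mult by lra.
      assert (Q : ln (3 * s) <= 3 * s).
      { rewrite <- (ln_exp (3 * s)) at 2. apply ln_le. lra. assert (X := exp_ineq1_le (3 * s)). lra. }
      lra. }
    assert (d0 := pos_INR d). assert (c1 := Rle_abs c). assert (c0 := Rabs_pos c).
    apply Rle_trans with (8 / r * (Rabs c * s + INR d * (6 * s)))%R.
    - apply Rmult_le_compat_l. left; apply Rdiv_lt_0_compat; lra. unfold c in *.
      assert (INR d * ln (9 * r) <= INR d * (6 * s))%R by (apply Rmult_le_compat_l; auto).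
      assert (Rabs (ln (K + 1) - ln (Cmod (h 0))) * 1 <= Rabs (ln (K + 1) - ln (Cmod (h 0))) * s)%R by (apply Rmult_le_compat_l; auto). lra.
    - right. unfold r. field. lra. }
  apply Cmod_eq_0. apply Rle_antisym; [|apply Cmod_ge_0]. apply Rnot_lt_le. intros Hp.
  set (B := (Cmod (h z) * (8 * (Rabs c + INR d * 6)))%R).
  assert (B0 : 0 <= B).
  { unfold B. apply Rmult_le_pos. apply Cmod_ge_0. assert (X := Rabs_pos c). assert (Y := pos_INR d). lra. }
  set (s := (1 + Rabs r1 + Cmod z + (B + 1) / Cmod (C_derive h z))%R).
  assert (P1 : 0 < (B + 1) / Cmod (C_derive h z)) by (apply Rdiv_lt_0_compat; lra).
  assert (X1 := Rabs_pos r1). assert (X2 := Cmod_ge_0 z).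
  assert (M := main s ltac:(unfold s; lra) ltac:(unfold s; lra) ltac:(unfold s; lra)).
  assert (s0 : 0 < s) by (unfold s; lra).
  assert (M2 : (Cmod (C_derive h z) * s <= B)%R).
  { apply Rmult_le_compat_r with (r := s) in M; [|lra]. eapply Rle_trans. exact M. right. unfold B. field. lra. }
  assert (M3 : (Cmod (C_derive h z) * ((B + 1) / Cmod (C_derive h z)) <= Cmod (C_derive h z) * s)%R).
  { apply Rmult_le_compat_l. lra. unfold s; lra. }
  replace (Cmod (C_derive h z) * ((B + 1) / Cmod (C_derive h z)))%R with (B + 1)%R in M3 by (field; lra). lra.
Qed.

(** With at most one root, [Q - tau] is [(z - b)^N] times a zero-free function of polynomial growth,
    hence times a constant, and [Q'] could vanish at [b] only, or everywhere. *)
Lemma two_roots (a ld : list C) (tau : C) : NoDup ld -> (2 <= length ld)%nat ->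
  (forall z, C_derive (Qprod a) z = 0 <-> In z ld) ->
  exists b1 b2, b1 <> b2 /\ Qprod a b1 = tau /\ Qprod a b2 = tau.
Proof.
  intros ND Hk Hld. apply NNPP. intros Hno.
  set (u := fun z => Qprod a z - tau).
  assert (Hu : entire u) by (unfold u; auto with ent).
  assert (Du : forall z, C_derive u z = C_derive (Qprod a) z).
  { intros z. apply cderiv_unique_C. eapply cderiv_eq; [|apply cderiv_minus; [apply entire_cderiv; auto with ent|apply cderiv_const]]. ring. }
  destruct (exists_not_in ld) as [w0 Hw0].
  assert (Nu : nz u).
  { apply NNPP. intros N. apply Hw0. apply Hld. rewrite <- Du. apply cderiv_unique_C.
    apply cderiv_ext with (fun _ => RtoC 0). intros; symmetry; apply not_nz; auto. apply cderiv_const. }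
  destruct (Qprod_growth a tau) as [K [HK Hg]].
  assert (X : exists b N h, entire h /\ (forall z, h z <> 0) /\ forall z, u z = (z - b) ^ N * h z).
  { destruct (classic (exists b, u b = 0)) as [[b Hb]|Hn].
    - destruct (order_at u b Hu Nu) as (N & h & Hh & Hh0 & E). exists b, N, h. split; auto. split; auto.
      intros z Hz. destruct (Ceq_dec z b) as [->|Hne]; auto.
      apply Hno. exists z, b. split; auto. split; apply Ceq_minus. change (u z = 0). rewrite E, Hz. ring. exact Hb.
    - exists 0, 0%nat, u. split; auto. split. intros z Hz. apply Hn. exists z; auto. intros z. simpl. ring. }
  destruct X as (b & N & h & Hh & Nh & E).
  assert (Dh : forall z, C_derive h z = 0).
  { apply (zero_free_poly_growth h (length a) K (Cmod b + 1)); auto.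
    intros z Hz. assert (b0 := Cmod_ge_0 b). eapply Rle_trans; [|apply Hg; lra]. fold (u z). rewrite E, Cmod_mult, Cmod_pow.
    rewrite <- (Rmult_1_l (Cmod (h z))) at 1. apply Rmult_le_compat_r. apply Cmod_ge_0. apply pow_R1_Rle.
    assert (Q := Cmod_minus_ge z b). lra. }
  destruct N.
  (* For [N = 0] the polynomial would be constant, making even [w0] a critical point. *)
  - apply Hw0. apply Hld. rewrite <- Du.
    rewrite <- (Dh w0). apply C_derive_ext; auto. intros w. rewrite E. simpl. ring.
  - assert (only : forall z, In z ld -> z = b).
    { intros z Hz. apply Hld in Hz. rewrite <- Du, (derive_pow_factor u h b N z Hh E), Dh in Hz.
      apply NNPP. intros Hne. apply (Cmult_neq_0 ((z - b) ^ N) (RtoC (INR (S N)) * h z)).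
      apply Cpow_nz. apply Cminus_eq_contra; auto. apply Cmult_neq_0; auto.
      intros Y. apply RtoC_inj in Y. revert Y. apply not_0_INR. lia.
      rewrite <- Hz. ring. }
    destruct ld as [|x [|y ld]]; simpl in Hk; try lia.
    inversion ND; subst. apply H1. left. rewrite (only x), (only y); simpl; auto.
Qed.

Lemma picard_growth f b1 b2 : entire f -> Rbar_lt (hyper_order_entire f) 1 -> b1 <> b2 ->
  (forall b, nz (fun z => f z - b)) ->
  (forall z, f z <> b1) -> (forall z, f z <> b2) -> exists l, forall z, f z = peval l z.
Proof.
  intros Hf Hh Hb Nf N1 N2.
  assert (M1 : forall z, f z - b1 <> 0) by (intros; apply Cminus_eq_contra; auto).
  assert (M2 : forall z, f z - b2 <> 0) by (intros; apply Cminus_eq_contra; auto).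
  destruct (nearest_root [b1; b2]) as [c0 [Hc0 Hnear]].
  { constructor. intros [X|[]]; auto. constructor. intros []. constructor. } discriminate.
  set (V := fun z => C_derive f z * / ((f z - b1) * (f z - b2))).
  assert (NF : nz f). { destruct (Nf 0) as [z Hz]. exists z. intros X. apply Hz. rewrite X. ring. }
  (* Here [p = 1] and [C0 = - ln c0]: one factor of the denominator is cancelled by the bound [L] on
     its logarithmic derivative, and the other is at least [c0 * (1 + |f|)] by [nearest_root]. *)
  apply (log_growth_polynomial f [(fun z => f z - b1); (fun z => f z - b2)] V (- ln c0) 1); auto.
  - unfold V. apply entire_mult. auto with ent. apply entire_intro. intros z. eexists. apply (cderiv_inv (fun z => (f z - b1) * (f z - b2))).
    apply Cmult_neq_0; auto. apply entire_cderiv. auto 10 with ent.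
  - apply NNPP. intros Q. destruct (derive_zero_const f Hf) as [c Hc].
    { intros z. assert (X := not_nz _ Q z). unfold V in X. apply NNPP. intros Y.
      assert (I : / ((f z - b1) * (f z - b2)) <> 0).
      { assert (P := Cmult_neq_0 _ _ (M1 z) (M2 z)). intros Z. apply C1_nz. rewrite <- (Cinv_r _ P), Z. ring. }
      apply (Cmult_neq_0 _ _ Y I X). }
    destruct (Nf c) as [z Hz]. apply Hz. rewrite Hc. ring.
  - intros u [<-|[<-|[]]]; (split; [auto with ent|]; split; [apply Nf|]; apply dominated_minus; [apply dominated_refl|apply dominated_const]).
  - intros z L HL H.
    assert (D : forall b, C_derive (fun z => f z - b) z = C_derive f z).
    { intros b. apply cderiv_unique_C. eapply cderiv_eq; [|apply cderiv_minus; [apply entire_cderiv; auto with ent|apply cderiv_const]]. ring. }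
    assert (Hx : forall x, In x [b1; b2] -> Cmod (C_derive f z) <= L * Cmod (f z - x)).
    { intros x [<-|[<-|[]]].
      rewrite <- (D b1). apply (H (fun z => f z - b1)). left; auto.
      rewrite <- (D b2). apply (H (fun z => f z - b2)). right; left; auto. }
    destruct (Hnear (f z)) as (x & l1 & l2 & E & Hs).
    assert (Q : Qprod [b1; b2] (f z) = (f z - b1) * (f z - b2)) by (simpl; ring).
    rewrite E, Qprod_split in Q.
    unfold V. rewrite <- Q. rewrite Cmod_mult, Cmod_inv by (rewrite Q; apply Cmult_neq_0; auto).
    assert (Hxin : In x [b1; b2]) by (rewrite E; apply in_or_app; right; left; auto).
    assert (A0 : 0 < 1 + Cmod (f z)) by (generalize (Cmod_ge_0 (f z)); lra).
    assert (Lw : c0 * (1 + Cmod (f z)) <= Cmod (Qprod (l1 ++ l2) (f z))).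
    { assert (Z := Qprod_lower (l1 ++ l2) (f z) (c0 * (1 + Cmod (f z)))%R ltac:(nra) Hs).
      assert (len : length (l1 ++ l2) = 1%nat). { apply (f_equal (@length C)) in E. rewrite length_app in *. simpl in E. lia. }
      rewrite len in Z. simpl in Z. lra. }
    rewrite exp_Ropp, exp_ln by auto. rewrite Cmod_mult. specialize (Hx x Hxin).
    assert (px : 0 < Cmod (f z - x)). { apply Cmod_gt_0. destruct Hxin as [<-|[<-|[]]]; auto. }
    set (A := (1 + Cmod (f z))%R) in *. set (q := Cmod (Qprod (l1 ++ l2) (f z))) in *. set (e := Cmod (f z - x)) in *.
    assert (q0 : 0 < q) by nra. simpl. rewrite Rmult_1_r.
    apply Rle_trans with (L * e * / (e * q) * A)%R.
    { apply Rmult_le_compat_r. lra. apply Rmult_le_compat_r. left; apply Rinv_0_lt_compat; apply Rmult_lt_0_compat; auto. auto. }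
    replace (L * e * / (e * q) * A)%R with (L * (A / q))%R by (field; lra).
    rewrite Rmult_comm. apply Rmult_le_compat_r. lra.
    apply Rmult_le_reg_r with (q * c0)%R. nra. replace (A / q * (q * c0))%R with (c0 * A)%R by (field; lra).
    replace (/ c0 * (q * c0))%R with q by (field; lra). auto.
Qed.

Lemma nonconst_Qprod l f : entire f -> (forall b, nz (fun z => f z - b)) -> nz (fun z => Qprod l (f z)).
Proof.
  intros Hf N. induction l; simpl. exists 0. apply C1_nz.
  apply (nz_mult (fun z => f z - a) (fun z => Qprod l (f z))); auto with ent. apply entire_comp; auto with ent.
Qed.

(** * Uniqueness *)

(** The first integration gives [F'/F^2 = kap * G'/G^2], the second [1/F = kap/G + B]. Both are done
    with [wronskian_zero] on cleared denominators, so zeros of [F] and [G] cause no trouble. *)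
Lemma mobius_or_equal (F G : C -> C) : entire F -> entire G -> nz F -> nz G -> nz (C_derive F) -> nz (C_derive G) ->
  (forall z, cross F G z = 0) ->
  exists kap B : C, kap <> 0 /\ forall z, G z - kap * F z = B * (F z * G z).
Proof.
  intros HF HG NF NG NF1 NG1 HU.
  assert (HF1 := entire_cderiv F). assert (HG1 := entire_cderiv G).
  assert (D1 : entire (C_derive F)) by auto with ent. assert (D2 : entire (C_derive G)) by auto with ent.
  destruct (wronskian_zero (fun z => C_derive F z * (G z * G z)) (fun z => C_derive G z * (F z * F z))) as [kap Hkap].
  - auto 10 with ent.
  - auto 10 with ent.
  - apply (nz_mult (C_derive G) (fun z => F z * F z)); auto with ent. apply nz_mult; auto.
  - intros z.
    rewrite (cderiv_unique_C _ _ _ (cderiv_mult _ _ z _ _ (entire_cderiv _ z D1) (cderiv_mult _ _ z _ _ (entire_cderiv _ z HG) (entire_cderiv _ z HG)))).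
    rewrite (cderiv_unique_C _ _ _ (cderiv_mult _ _ z _ _ (entire_cderiv _ z D2) (cderiv_mult _ _ z _ _ (entire_cderiv _ z HF) (entire_cderiv _ z HF)))).
    apply Ceq_minus. transitivity (F z * G z * cross F G z). unfold cross, bracket. ring. rewrite HU. ring.
  - destruct (wronskian_zero (fun z => G z - kap * F z) (fun z => F z * G z)) as [B HB].
    + auto 10 with ent.
    + auto with ent.
    + apply nz_mult; auto.
    + intros z.
      rewrite (cderiv_unique_C _ _ _ (cderiv_minus _ _ z _ _ (entire_cderiv _ z HG) (cderiv_scal kap _ z _ (entire_cderiv _ z HF)))).
      rewrite (cderiv_unique_C _ _ _ (cderiv_mult _ _ z _ _ (entire_cderiv _ z HF) (entire_cderiv _ z HG))).
      apply Ceq_minus. specialize (Hkap z). cbv beta in Hkap.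
      transitivity (kap * (C_derive G z * (F z * F z)) - C_derive F z * (G z * G z)). ring. rewrite Hkap. ring.
    + exists kap, B. split; auto. intros E.
      assert (N : nz (fun z => C_derive F z * (G z * G z))).
      { apply (nz_mult (C_derive F) (fun z => G z * G z)); auto with ent. apply nz_mult; auto. }
      destruct N as [z Hz]. apply Hz. rewrite Hkap, E. ring.
Qed.

Lemma entire_meromorphic f : entire f -> meromorphic f.
Proof.
  intros H z. split. exists (mkposreal 1 Rlt_0_1). intros. apply H. intros N. exfalso. apply N. apply H.
Qed.

Theorem theorem2p2 (n : nat) (a : list C) (m1 m2 k : nat) (f : C -> C) (c : C) :
  (1 <= n)%nat ->
  length a = n ->
  NoDup a ->
  strong_uniqueness_poly (Qprod a) ->
  ncard (fun z => Qprod a z - Qprod a 0 = 0 /\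
                  ~ is_derive (fun w => Qprod a w - Qprod a 0) z (RtoC 0)) m1 ->
  ncard (fun z => Qprod a z - Qprod a 0 = 0 /\
                  is_derive (fun w => Qprod a w - Qprod a 0) z (RtoC 0)) m2 ->
  ncard (fun z => is_derive (Qprod a) z (RtoC 0)) k ->
  (Nat.max (2 * k + 2) (m1 + m2) < n)%nat ->
  (2 < m1 + m2)%nat ->
  (2 <= k)%nat ->
  transcendental_entire f ->
  Rbar_lt (hyper_order_entire f) 1 ->
  c <> 0 ->
  share_weak_weight a 3 f (fun z => f (z + c)) ->
  forall z : C, f z = f (z + c).
Proof.
  intros _ Hn ND Hsu _ _ (ld & NDld & Hld0 & Hk) Hmax _ Hk2 [Hf Htr] Hh _ Hsh.
  set (Q := Qprod a) in *. assert (HQ : entire Q) by (apply entire_Qprod).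
  assert (Hld : forall z, C_derive Q z = 0 <-> In z ld).
  { intros z. rewrite Hld0. rewrite is_derive_cderiv. split; intros H.
    - rewrite <- H. apply entire_cderiv; auto.
    - apply cderiv_unique_C; auto. }
  set (g := fun z => f (z + c)). assert (Hg : entire g) by (apply entire_shift; auto).
  assert (Nf : forall b, nz (fun z => f z - b)).
  { intros b. apply NNPP. intros X. apply Htr. exists [b]. intros z. simpl. 
    assert (Y := not_nz _ X z). cbv beta in Y. apply Ceq_minus in Y. rewrite Y. ring. }
  assert (Ng : forall b, nz (fun z => g z - b)).
  { intros b. destruct (Nf b) as [z Hz]. exists (z - c). unfold g. replace (z - c + c) with z by ring. auto. }
  assert (Nf0 : nz f). { destruct (Nf 0) as [z Hz]. exists z. intros X. apply Hz. rewrite X. ring. }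
  set (F := fun z => Q (f z)). set (G := fun z => Q (g z)).
  assert (HF : entire F) by exact (entire_comp Q f HQ Hf). assert (HG : entire G) by exact (entire_comp Q g HQ Hg).
  assert (NF : nz F) by exact (nonconst_Qprod a f Hf Nf). assert (NG : nz G) by exact (nonconst_Qprod a g Hg Ng).
  assert (Nd : forall h, entire h -> (forall b, nz (fun z => h z - b)) -> nz (C_derive (fun z => Q (h z)))).
  { intros h Hh' Nh.
    assert (N1 : nz (fun z => C_derive Q (h z))).
    { destruct (nonconst_Qprod ld h Hh' Nh) as [z Hz]. exists z. intros X. apply Hz. apply Qprod_zero. apply Hld; auto. }
    assert (N2 : nz (C_derive h)).
    { apply NNPP. intros X. destruct (derive_zero_const h Hh') as [b Hb]. apply not_nz; auto.
      destruct (Nh b) as [z Hz]. apply Hz. rewrite Hb. ring. }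
    destruct (nz_mult (fun z => C_derive Q (h z)) (C_derive h)) as [z Hz]; auto with ent.
    apply entire_comp; auto with ent. exists z. rewrite (derive_comp Q h z HQ Hh'). exact Hz. }
  assert (NF1 : nz (C_derive F)) by (apply Nd; auto). assert (NG1 : nz (C_derive G)) by (apply Nd; auto).
  assert (NQ1 : nz (C_derive Q)).
  { destruct (exists_not_in ld) as [w Hw]. exists w. intros X. apply Hw. apply Hld; auto. }
  destruct (critical_quotient Q ld HQ NQ1) as (S & HS & ES). { intros z Hz. apply Hld; auto. }
  (* This is [T(h) * bracket (Q(h)) / Q'(h)] expanded by the chain rule, with [S] in place of
     [Q'' T / Q']; in this form it is visibly entire. *)
  set (Y := fun (h : C -> C) z => (S (h z) * (C_derive h z * C_derive h z) + Qprod ld (h z) * C_derive (C_derive h) z) * Q (h z)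
     - 2 * (C_derive (fun z => Q (h z)) z * (Qprod ld (h z) * C_derive h z))).
  set (Kh := fun (h : C -> C) z => C_derive h z * Qprod ld (h z)).
  assert (Ecomp : forall h u, entire u -> entire h -> entire (fun z => u (h z))) by exact (fun h u Hu Hh' => entire_comp u h Hu Hh').
  assert (HY : forall h, entire h -> entire (Y h)).
  { intros h Hh'. unfold Y. assert (E1 := Ecomp h S HS Hh'). assert (E2 := Ecomp h Q HQ Hh'). assert (E3 := Ecomp h _ (entire_Qprod ld) Hh').
    auto 12 with ent. }
  assert (HKh : forall h, entire h -> entire (Kh h)).
  { intros h Hh'. unfold Kh. assert (E3 := Ecomp h _ (entire_Qprod ld) Hh'). auto with ent. }
  assert (EY : forall h, entire h -> forall z, C_derive Q (h z) * Y h z = Qprod ld (h z) * bracket (fun z => Q (h z)) z).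
  { intros h Hh' z. unfold Y, bracket. rewrite (derive2_comp Q h z HQ Hh'), (derive_comp Q h z HQ Hh').
    transitivity ((C_derive Q (h z) * S (h z) * (C_derive h z * C_derive h z) + C_derive Q (h z) * Qprod ld (h z) * C_derive (C_derive h) z) * Q (h z)
      - 2 * (C_derive Q (h z) * C_derive h z * (C_derive Q (h z) * C_derive h z) * Qprod ld (h z))). ring.
    rewrite <- ES. ring. }
  assert (EK : forall h, entire h -> forall z, C_derive Q (h z) * Kh h z = C_derive (fun z => Q (h z)) z * Qprod ld (h z)).
  { intros h Hh' z. unfold Kh. rewrite (derive_comp Q h z HQ Hh'). ring. }
  set (U1 := auxf F G (Y f) (Y g) (Kh f) (Kh g)).
  assert (cross_rel := auxf_cross F G (Y f) (Y g) (Kh f) (Kh g) (fun z => C_derive Q (f z)) (fun z => C_derive Q (g z))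
     (fun z => Qprod ld (f z)) (fun z => Qprod ld (g z)) (EY f Hf) (EY g Hg) (EK f Hf) (EK g Hg)).
  fold U1 in cross_rel. cbv beta in cross_rel.
  destruct (classic (nz U1)) as [NU|NU].
  - exfalso. apply Htr.
    assert (simple : forall x, Q x = 0 -> C_derive Q x <> 0).
    { intros x Hx. apply Qprod_zero_inv in Hx. destruct (in_split x a Hx) as (l1 & l2 & Ea).
      assert (D : C_derive Q x = Qprod (l1 ++ l2) x).
      { apply cderiv_unique_C. apply cderiv_ext with (fun w => (w - x) * Qprod (l1 ++ l2) w).
        intros w. unfold Q. rewrite Ea, Qprod_split. auto.
        eapply cderiv_eq; [|apply cderiv_mult; [apply cderiv_minus; [apply cderiv_id|apply cderiv_const]|apply entire_cderiv; auto with ent]].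
        cbv beta. ring. }
      rewrite D. apply Qprod_nonzero. rewrite Ea in ND. apply NoDup_remove_2; auto. }
    destruct (auxf_quotient F G (Y f) (Y g) (Kh f) (Kh g) (fun z => C_derive Q (f z)) (fun z => C_derive Q (g z))
       (fun z => Qprod ld (f z)) (fun z => Qprod ld (g z))) as (V & HV & EV); auto with ent.
    { intros z0 p q u v Hu Hv Hu0 Hv0 EF EG. split; [|split].
      - intros Hp. apply simple. change (F z0 = 0). rewrite EF. replace p with (Datatypes.S (p - 1)) by lia. rewrite Cpow_S. ring.
      - intros Hp. apply simple. change (G z0 = 0). rewrite EG. replace q with (Datatypes.S (q - 1)) by lia. rewrite Cpow_S. ring.
      - intros m Hm.
        rewrite <- (root_point_order a f z0 p u m); auto; try lia.
        rewrite <- (root_point_order a g z0 q v m); auto; try lia.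
        apply Hsh. lia. }
    fold U1 in EV.
    destruct (root_estimate a ld ND) as [C1 [HC1 Hroot]]. { rewrite Hk, Hn. lia. }
    set (us := F :: C_derive F :: G :: C_derive G :: map (fun b z => f z - b) a ++ map (fun b z => g z - b) a).
    assert (df : dominated f f) by apply dominated_refl.
    assert (dg : dominated f g) by (apply dominated_shift; auto).
    assert (dF : dominated f F) by (apply dominated_Qprod; auto). assert (dG : dominated f G) by (apply dominated_Qprod; auto).
    (* The bound [6 * L] for [U1] is squared to [36 * L^2], and each of the two root estimates
       contributes [C1 * L^2]. *)
    apply (log_growth_polynomial f us V (ln (36 * (C1 * C1))) 6); auto.
    + destruct NU as [z Hz]. exists z. intros X. specialize (EV z). rewrite X in EV.
      apply (Cpow_nz _ 2 Hz). rewrite EV. ring.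
    + intros u Hu. unfold us in Hu. destruct Hu as [<-|[<-|[<-|[<-|Hu]]]].
      * auto.
      * split. auto with ent. split; auto. apply dominated_derive; auto.
      * auto.
      * split. auto with ent. split; auto. apply dominated_derive; auto.
      * apply in_app_or in Hu. destruct Hu as [Hu|Hu]; apply in_map_iff in Hu; destruct Hu as [b [<- _]].
        split. auto with ent. split. apply Nf. apply dominated_minus; auto. apply dominated_const.
        split. auto with ent. split. apply Ng. apply dominated_minus; auto. apply dominated_const.
    + intros z L HL Hus.
      assert (Db : forall h b, entire h -> C_derive (fun z => h z - b) z = C_derive h z).
      { intros h b Hh'. apply cderiv_unique_C. eapply cderiv_eq; [|apply cderiv_minus; [apply entire_cderiv; auto with ent|apply cderiv_const]]. ring. }
      destruct (Hus F) as [F0 B1]. left; auto.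
      destruct (Hus (C_derive F)) as [F10 B2]. right; left; auto.
      destruct (Hus G) as [G0 B3]. do 2 right; left; auto.
      destruct (Hus (C_derive G)) as [G10 B4]. do 3 right; left; auto.
      assert (Bf : forall b, In b a -> Cmod (C_derive f z) <= L * Cmod (f z - b)).
      { intros b Hb. rewrite <- (Db f b Hf). apply (Hus (fun z => f z - b)). do 4 right. apply in_or_app. left.
        apply (in_map (fun b z => f z - b)); auto. }
      assert (Bg : forall b, In b a -> Cmod (C_derive g z) <= L * Cmod (g z - b)).
      { intros b Hb. rewrite <- (Db g b Hg). apply (Hus (fun z => g z - b)). do 4 right. apply in_or_app. right.
        apply (in_map (fun b z => g z - b)); auto. }
      assert (Rf := Hroot (f z) (C_derive f z) L ltac:(lra) Bf). assert (Rg := Hroot (g z) (C_derive g z) L ltac:(lra) Bg).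
      change (Qprod a (f z)) with (F z) in Rf. change (Qprod a (g z)) with (G z) in Rg.
      assert (DF : C_derive F z = C_derive Q (f z) * C_derive f z) by exact (derive_comp Q f z HQ Hf).
      assert (DG : C_derive G z = C_derive Q (g z) * C_derive g z) by exact (derive_comp Q g z HQ Hg).
      assert (qf0 : C_derive Q (f z) <> 0). { intros X. apply F10. rewrite DF, X. ring. }
      assert (qg0 : C_derive Q (g z) <> 0). { intros X. apply G10. rewrite DG, X. ring. }
      assert (Yf := side_bound L (Y f z) (Qprod ld (f z)) _ _ (F z) _ _ ltac:(lra) (EY f Hf z) DF qf0 B1 B2).
      assert (Yg := side_bound L (Y g z) (Qprod ld (g z)) _ _ (G z) _ _ ltac:(lra) (EY g Hg z) DG qg0 B3 B4).
      apply Cmod_gt_0 in F0. apply Cmod_gt_0 in G0.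
      set (Tf := (Cmod (Qprod ld (f z)) * Cmod (C_derive f z))%R) in *.
      set (Tg := (Cmod (Qprod ld (g z)) * Cmod (C_derive g z))%R) in *.
      assert (Tf0 : 0 <= Tf) by (apply Rmult_le_pos; apply Cmod_ge_0). assert (Tg0 : 0 <= Tg) by (apply Rmult_le_pos; apply Cmod_ge_0).
      set (x := Cmod (F z)) in *. set (y := Cmod (G z)) in *.
      assert (BU : Cmod (U1 z) <= 6 * L * (Tf * Tg * (x * y))).
      { unfold U1, auxf. eapply Rle_trans. apply Cmod_minus_le. rewrite !Cmod_mult. fold x y.
        replace (Cmod (Kh g z)) with Tg by (unfold Kh, Tg; rewrite Cmod_mult; ring).
        replace (Cmod (Kh f z)) with Tf by (unfold Kh, Tf; rewrite Cmod_mult; ring).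
        assert (Cmod (Y f z) * y * Tg <= 3 * L * (Tf * x) * y * Tg)%R.
        { apply Rmult_le_compat_r; auto. apply Rmult_le_compat_r; auto. lra. }
        assert (Cmod (Y g z) * x * Tf <= 3 * L * (Tg * y) * x * Tf)%R.
        { apply Rmult_le_compat_r; auto. apply Rmult_le_compat_r; auto. lra. }
        lra. }
      assert (EVm : (Cmod (U1 z) ^ 2 = (x * y) ^ 3 * Cmod (V z))%R).
      { rewrite <- Cmod_pow, EV, Cmod_mult, Cmod_pow, Cmod_mult. auto. }
      assert (xy : 0 < x * y) by (apply Rmult_lt_0_compat; auto).
      assert (V0 := Cmod_ge_0 (V z)).
      assert (BV : Cmod (V z) * (x * y) <= 36 * L ^ 2 * (Tf ^ 2 * Tg ^ 2)).
      { apply Rmult_le_reg_l with ((x * y) ^ 2)%R. apply pow_lt; auto.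
        replace ((x * y) ^ 2 * (Cmod (V z) * (x * y)))%R with (Cmod (U1 z) ^ 2)%R by (rewrite EVm; ring).
        eapply Rle_trans. apply pow_incr. split. apply Cmod_ge_0. exact BU. right; ring. }
      set (Af := (1 + Cmod (f z))%R) in *. set (Ag := (1 + Cmod (g z))%R) in *.
      assert (Af1 : 1 <= Af) by (unfold Af; generalize (Cmod_ge_0 (f z)); lra).
      assert (Ag1 : 1 <= Ag) by (unfold Ag; generalize (Cmod_ge_0 (g z)); lra).
      rewrite exp_ln by nra.
      assert (L2 : 0 <= L ^ 2) by (apply pow_le; lra).
      apply Rmult_le_reg_r with (x * y)%R; auto.
      (* The factor [Ag >= 1] is inserted so that [root_estimate] applies to [f] and to [g]
         alike. *)
      apply Rle_trans with (Cmod (V z) * (x * y) * (Af * Ag))%R.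
      { replace (Cmod (V z) * Af * (x * y))%R with (Cmod (V z) * (x * y) * (Af * 1))%R by ring.
        apply Rmult_le_compat_l. apply Rmult_le_pos; lra. apply Rmult_le_compat_l; lra. }
      apply Rle_trans with (36 * L ^ 2 * (Tf ^ 2 * Tg ^ 2) * (Af * Ag))%R.
      { apply Rmult_le_compat_r. nra. auto. }
      replace (36 * L ^ 2 * (Tf ^ 2 * Tg ^ 2) * (Af * Ag))%R with (36 * L ^ 2 * ((Tf ^ 2 * Af) * (Tg ^ 2 * Ag)))%R by ring.
      replace (36 * (C1 * C1) * L ^ 6 * (x * y))%R with (36 * L ^ 2 * ((C1 * L ^ 2 * x) * (C1 * L ^ 2 * y)))%R by ring.
      apply Rmult_le_compat_l. lra.
      apply Rmult_le_compat; auto; (apply Rmult_le_pos; [apply pow_le; auto|lra]).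
  - assert (HU : forall z, cross F G z = 0).
    { apply not_nz. intros Nc. apply NU.
      assert (Hc : entire (cross F G)) by (unfold cross; assert (B1 := bracket_entire F HF); assert (B2 := bracket_entire G HG); auto 10 with ent).
      assert (Nt : nz (fun z => Qprod ld (f z) * Qprod ld (g z) * cross F G z)).
      { apply (nz_mult (fun z => Qprod ld (f z) * Qprod ld (g z)) (cross F G)); auto.
        apply entire_mult; apply Ecomp; auto with ent.
        apply (nz_mult (fun z => Qprod ld (f z)) (fun z => Qprod ld (g z))).
        apply Ecomp; auto with ent. apply Ecomp; auto with ent. apply nonconst_Qprod; auto. apply nonconst_Qprod; auto. }
      destruct Nt as [z Hz]. exists z. intros X. apply Hz. rewrite <- cross_rel, X. ring. }
    destruct (mobius_or_equal F G HF HG NF NG NF1 NG1 HU) as (kap & B & Nk & E).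
    destruct (Ceq_dec B 0) as [EB|NB].
    + intros z. apply (Hsu f g (/ kap)).
      * apply entire_meromorphic; auto.
      * apply entire_meromorphic; auto.
      * intros [b Hb]. destruct (Nf b) as [w Hw]. apply Hw. rewrite Hb. ring. apply Hf.
      * intros [b Hb]. destruct (Ng b) as [w Hw]. apply Hw. rewrite Hb. ring. apply Hg.
      * intros X. apply C1_nz. rewrite <- (Cinv_r kap Nk), X. ring.
      * intros w _ _. change (F w = / kap * G w). specialize (E w). rewrite EB in E.
        assert (E2 : G w = kap * F w). { apply Ceq_minus. rewrite E. ring. }
        rewrite E2. field. auto.
      * apply Hf.
      * apply Hg.
    + exfalso. apply Htr.
      destruct (two_roots a ld (/ B)) as (b1 & b2 & Hb & R1 & R2); auto. lia.
      (* If [B * F z = 1], the relation reads [G - kap * F = G] at [z], forcing [F z = 0], a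
         contradiction. *)
      assert (om : forall z, B * F z <> 1).
      { intros z X. specialize (E z). assert (E2 : kap * F z = 0).
        { replace (kap * F z) with (G z - (G z - kap * F z)) by ring. rewrite E.
          replace (B * (F z * G z)) with (B * F z * G z) by ring. rewrite X. ring. }
        assert (F z <> 0). { intros Y0. apply C1_nz. rewrite <- X, Y0. ring. }
        apply (Cmult_neq_0 _ _ Nk H E2). }
      apply (picard_growth f b1 b2); auto; intros z X; apply (om z); unfold F, Q; rewrite X.
      rewrite R1. apply Cinv_r; auto. rewrite R2. apply Cinv_r; auto.
Qed.
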